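(* Assume the standing setup and the one-dimensional splitting hypotheses in the context. Then there exist $\bar\beta>0$ and, for each $\beta\in(0,\bar\beta)$, $\bar\varepsilon(\beta)>0$ such that for $0<\beta<\bar\beta$ and $|\varepsilon|<\bar\varepsilon(\beta)$ there exist vector fields $\mathbf v_{1,\varepsilon},\dots,\mathbf v_{d,\varepsilon}$ on $\mathbb T^d$, linearly independent at every $\psi\in\mathbb T^d$, and scalar functions $L_{1,\varepsilon},\dots,L_{d,\varepsilon}$ on $\mathbb T^d$, all analytic in $\varepsilon$ and $\beta$-Hölder continuous in $\psi$, such that $$DA_\varepsilon(H_\varepsilon(\psi))\,\mathbf v_{i,\varepsilon}(\psi)=L_{i,\varepsilon}(\psi)\,\mathbf v_{i,\varepsilon}(A_0\psi)\qquad(\psi\in\mathbb T^d,\ i=1,\dots,d),$$ with $\mathbf v_{i,0}=\mathbf v_i$ and $L_{i,0}=\Lambda_i$.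
   Context: Standing setup. $\mathbb T^d=\mathbb R^d/2\pi\mathbb Z^d$ with the metric $\delta$ inherited from the Euclidean metric; tangent spaces are identified with $\mathbb R^d$. For $f$ on $\mathbb T^d$ and $0<\beta<1$, $|f|_\beta:=\sup_{\psi\neq\psi'}\|f(\psi)-f(\psi')\|/\delta(\psi,\psi')^\beta$, $\|f\|_\infty:=\sup_\psi\|f(\psi)\|$, $\|f\|_\beta:=\|f\|_\infty+|f|_\beta$. $A_0:\mathbb T^d\to\mathbb T^d$ is an analytic Anosov diffeomorphism; $\widetilde A_0$ is its lift to a map $\mathbb T^d\to\mathbb R^d$, $F:\mathbb T^d\to\mathbb R^d$ is analytic, and $A_\varepsilon(\psi):=\widetilde A_0(\psi)+\varepsilon F(\psi)\bmod 2\pi$. It is taken as known that for $|\varepsilon|$ small there is a homeomorphism $H_\varepsilon$ of $\mathbb T^d$ with $H_\varepsilon\circ A_0=A_\varepsilon\circ H_\varepsilon$, $H_\varepsilon(\psi)=\psi+\sum_{n\ge1}\varepsilon^nh^{(n)}(\psi)$, where for every sufficiently small $\beta>0$ there is $C_\beta$ with $\|h^{(n)}\|_\beta\le C_\beta^n$. One-dimensional splitting hypotheses. There are unit vector fields $\mathbf v_1(\psi),\dots,\mathbf v_d(\psi)$ forming a basis of $\mathrm T_\psi\mathbb T^d$ for every $\psi$, $\beta_0$-Hölder in $\psi$ for some $\beta_0>0$, and nonvanishing $\beta_0$-Hölder functions $\Lambda_i$ with $DA_0(\psi)\mathbf v_i(\psi)=\Lambda_i(\psi)\mathbf v_i(A_0\psi)$.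 With $\Lambda_i^{[n]}(\psi):=\prod_{j=0}^{n-1}\Lambda_i(A_0^j\psi)$, there is $N_0$ such that for all $n\ge N_0$ and $i=1,\dots,d-1$: $\|\Lambda_i^{[n]}\|_\infty\,\|(\Lambda_{i+1}^{[n]})^{-1}\|_\infty<1$. *)

(* Defs.v *)
From HB Require Import structures.
From mathcomp Require Import all_boot all_order all_algebra.
From mathcomp Require Import all_classical all_reals all_analysis.
Set Implicit Arguments. Unset Strict Implicit. Unset Printing Implicit Defensive.
Import Order.TTheory GRing.Theory Num.Theory.
Import numFieldNormedType.Exports.
Local Open Scope classical_set_scope.
Local Open Scope ring_scope.

Section TorusDefs.
Variables (R : realType) (d : nat).

(** Points of R^d (and of T^d, through the projection) are row vectors. *)
Notation vec := 'rV[R]_d.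

Definition tenorm (v : vec) : R := Num.sqrt (\sum_(i < d) (v 0 i) ^+ 2).

Definition tlattice (w : vec) : Prop :=
  exists k : 'I_d -> int, forall i, w 0 i = 2 * pi * (k i)%:~R.

(** Congruence modulo 2 pi Z^d: equality of the projections in T^d. *)
Definition tcong (x y : vec) : Prop := tlattice (x - y).

Definition tdist (x y : vec) : R :=
  inf [set tenorm (x - y - w) | w in tlattice].

(** Functions on T^d = 2 pi Z^d-tperiodic functions on R^d. *)
Definition tperiodic (V : Type) (f : vec -> V) : Prop :=
  forall x w, tlattice w -> f (x + w) = f x.

(** Maps T^d -> T^d, represented by a lift R^d -> R^d. *)
Definition is_lift (g : vec -> vec) : Prop :=
  forall x w, tlattice w -> tlattice (g (x + w) - g x).

Definition torus_homeo (g : vec -> vec) : Prop :=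
  is_lift g /\ continuous g /\
  exists g' : vec -> vec, is_lift g' /\ continuous g' /\
    (forall x, tcong (g' (g x)) x) /\ (forall y, tcong (g (g' y)) y).

Definition sup_le (V : Type) (nrm : V -> R) (f : vec -> V) (a : R) : Prop :=
  forall x, nrm (f x) <= a.

Definition hsemi_le (V : zmodType) (nrm : V -> R) (beta : R) (f : vec -> V)
    (b : R) : Prop :=
  forall x y, 0 < tdist x y -> nrm (f x - f y) <= b * (tdist x y) `^ beta.

Definition hnorm_le (V : zmodType) (nrm : V -> R) (beta : R) (f : vec -> V)
    (M : R) : Prop :=
  exists a b, a + b <= M /\ sup_le nrm f a /\ hsemi_le nrm beta f b.

Definition tholder (V : zmodType) (nrm : V -> R) (beta : R) (f : vec -> V) :
  Prop := exists b, hsemi_le nrm beta f b.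

Definition tsupnorm (f : vec -> R) : R := sup (range (fun x => `|f x|)).

(** Real analyticity of a scalar function on R^d at x: f is given on a
    polydisc around x by an absolutely convergent multivariate power series
    (grouped by total degree k, alpha ranging over multi-indices of degree k). *)
Definition mono_sum (a : ('I_d -> nat) -> R) (z : vec) (k : nat) : R :=
  \sum_(al : {ffun 'I_d -> 'I_k.+1} | (\sum_(i < d) (al i : nat) == k)%N)
     a (fun i => al i) * \prod_(i < d) (z 0 i) ^+ (al i).

Definition abs_mono_sum (a : ('I_d -> nat) -> R) (r : R) (k : nat) : R :=
  \sum_(al : {ffun 'I_d -> 'I_k.+1} | (\sum_(i < d) (al i : nat) == k)%N)
     `|a (fun i => al i)| * r ^+ k.

Definition ranalytic_at (f : vec -> R) (x : vec) : Prop :=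
  exists (a : ('I_d -> nat) -> R) (r : R), 0 < r /\
    cvgn (series (abs_mono_sum a r)) /\
    forall y : vec, (forall i, `|y 0 i - x 0 i| < r) ->
      series (mono_sum a (y - x)) @ \oo --> f y.

Definition ranalytic (g : vec -> vec) : Prop :=
  forall i x, ranalytic_at (fun y => g y 0 i) x.

Definition ranalytic_diffeo (g : vec -> vec) : Prop :=
  is_lift g /\ ranalytic g /\
  exists g' : vec -> vec, is_lift g' /\ ranalytic g' /\
    (forall x, tcong (g' (g x)) x) /\ (forall y, tcong (g (g' y)) y).

(** Anosov property of the torus map with lift g and inverse lift g':
    a DA-invariant splitting T = E^s (+) E^u (subspaces = row spaces of
    d x d matrices), depending only on the point of T^d, with uniform
    contraction of D(A^n) on E^s and of D(A^-n) on E^u. *)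
Definition tanosov (g : vec -> vec) : Prop :=
  ranalytic_diffeo g /\
  exists (g' : vec -> vec) (Es Eu : vec -> 'M[R]_d) (C lam : R),
    is_lift g' /\ (forall x, tcong (g' (g x)) x) /\ (forall y, tcong (g (g' y)) y) /\
    tperiodic Es /\ tperiodic Eu /\
    (forall x, (Es x :&: Eu x == (0 : 'M[R]_d))%MS /\ (Es x + Eu x == 1%:M)%MS) /\
    (forall x (v : vec), (v <= Es x)%MS -> ('D_v g x <= Es (g x))%MS) /\
    (forall x (v : vec), (v <= Eu x)%MS -> ('D_v g x <= Eu (g x))%MS) /\
    0 < C /\ 0 < lam < 1 /\
    (forall n x (v : vec), (v <= Es x)%MS ->
        tenorm ('D_v (iter n g) x) <= C * lam ^+ n * tenorm v) /\
    (forall n x (v : vec), (v <= Eu x)%MS ->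
        tenorm ('D_v (iter n g') x) <= C * lam ^+ n * tenorm v).

Definition tframe (v : 'I_d -> vec -> vec) (x : vec) : 'M[R]_d :=
  \matrix_(i < d, j < d) v i x 0 j.

End TorusDefs.

(* Main.v *)
Require Import Defs.
From HB Require Import structures.
From mathcomp Require Import all_boot all_order all_algebra.
From mathcomp Require Import all_classical all_reals all_analysis.
From mathcomp Require Import ring lra.
Set Implicit Arguments. Unset Strict Implicit. Unset Printing Implicit Defensive.
Import Order.TTheory GRing.Theory Num.Theory.
Import numFieldNormedType.Exports.
Local Open Scope classical_set_scope.
Local Open Scope ring_scope.

(** In the frames [v_i] at [x] and at [A0 x], the derivative of [A_eps] at
    [H_eps x] is a matrix [diag Lam + eps E(eps, x)].  Looking for
    [v_{i,eps} = v_i + eps sum_j w_j v_j] with [w_i = 0], invariance becomes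
    [Lam_j w_j - Lam_i (w_j o A0) = Q_j(w)] for [j <> i], with [Q_j] quadratic
    in [w] and its non-constant part divisible by [eps].  By the gap condition
    the left-hand side is inverted by a Neumann series, running forward along
    [A0] for [i < j] and backward for [j < i]; it converges in the beta-Hoelder
    norm for small beta.  The equation is then a contraction on power series in
    [eps] with Hoelder coefficients.

    That [E] is such a power series is seen by substituting
    [x - c + (H_eps x - x) + z] into the Taylor expansion of [A0] or [F] at [c],
    in a Banach algebra of first-order jets in [z] whose coefficients are power
    series in [eps] with Hoelder coefficients near [c]; the local coefficients
    glue because a power series in [eps] is determined by its sum. *)

(** * Real series *)

(** A norm is a relation [N f m] that gives an upper bound, so no supremum has to exist. Products
    are estimated with constant exactly 1: a homogeneous Taylor term is then bounded by its absolute
    version at the norm of the argument, and the substitution converges without loss of radius. Jets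
    avoid differentiating a Taylor series and composing the result with the merely Hoelder map
    [H_eps]: the linear coefficient in [z] is the derivative, and its regularity in [x] and [eps] is
    part of the norm.

    The plain Hoelder norm obstructs the linear equation. The gap contracts the sup norm, but
    composition with the base map stretches the seminorm by the power [beta] of a Lipschitz
    constant, and the variation of the multiplier feeds the sup norm into the seminorm. Small [beta]
    settles the former; counting the seminorm with a small weight [eta] settles the latter. Both are
    chosen before the radius [t] in [eps], on which the bound of the solver does not depend, so [t]
    can be shrunk last to make the nonlinear part contract. *)

Lemma seriesE0 (R : realType) (u : nat -> R) : series u 0%N = 0.
Proof. by rewrite /series /= big_nil. Qed.

Lemma series_homo (R : realType) (u : nat -> R) : (forall k, 0 <= u k) ->
  {homo series u : n m / (n <= m)%N >-> n <= m}.
Proof.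
move=> u0 n m; elim: m => [|m IH]; first by rewrite leqn0 => /eqP ->.
rewrite leq_eqVlt => /orP[/eqP ->//|]; rewrite ltnS => /IH /le_trans; apply.
by rewrite seriesSr lerDl.
Qed.

Lemma series_ge0 (R : realType) (u : nat -> R) n : (forall k, 0 <= u k) ->
  0 <= series u n.
Proof. by move=> u0; apply: sumr_ge0. Qed.

Lemma pseries_cvg (R : realType) (u : nat -> R) M : (forall k, 0 <= u k) ->
  (forall n, series u n <= M) -> cvgn (series u).
Proof.
move=> u0 uM; apply: nondecreasing_is_cvgn; first exact: series_homo.
by exists M => _ [n _ <-].
Qed.

Lemma pseries_le_lim (R : realType) (u : nat -> R) M n : (forall k, 0 <= u k) ->
  (forall n, series u n <= M) -> series u n <= limn (series u).
Proof.
move=> u0 uM; apply: nondecreasing_cvgn_le; first exact: series_homo.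
exact: pseries_cvg uM.
Qed.

Lemma cvgn_le_bound (R : realType) (u : nat -> R) (l M : R) : u @ \oo --> l ->
  (forall n, u n <= M) -> l <= M.
Proof. by move=> ul uM; apply: (cvgr_to_le ul); near=> n. Unshelve. all: by end_near. Qed.

Lemma cvgn_norm_bound (R : realType) (u : nat -> R) (l M : R) : u @ \oo --> l ->
  (forall n, `|u n| <= M) -> `|l| <= M.
Proof. by move=> ul uM; apply: cvgn_le_bound uM; apply: cvg_norm. Qed.

Lemma cvg_cstE (R : realType) (c l : R) : (fun _ : nat => c) @ \oo --> l -> l = c.
Proof. by move=> cl; apply: (cvg_unique _ cl); [exact: norm_hausdorff|exact: cvg_cst]. Qed.

Lemma cvgn_unique (R : realType) (u : nat -> R) (l l' : R) : u @ \oo --> l ->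
  u @ \oo --> l' -> l = l'.
Proof. by move=> h1 h2; apply: (cvg_unique _ h1 h2); exact: norm_hausdorff. Qed.

Lemma series_norm_le (R : realType) (f m : nat -> R) n :
  (forall k, `|f k| <= m k) -> `|series f n| <= series m n.
Proof.
by move=> fm; apply: le_trans (ler_norm_sum _ _ _) _; apply: ler_sum => k _.
Qed.

Lemma dom_series_cvg (R : realType) (f m : nat -> R) M :
  (forall k, `|f k| <= m k) -> (forall n, series m n <= M) -> cvgn (series f).
Proof.
move=> fm mM; apply: normed_cvg.
have H : cvgn (series (fun k => `|f k|)); last exact: H.
apply: (pseries_cvg (M := M)); first by move=> n; exact: normr_ge0.
by move=> n; apply: le_trans (mM n); apply: ler_sum => k _.
Qed.

Lemma series_tail_le (R : realType) (f m : nat -> R) (l M : R) n :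
  (forall k, `|f k| <= m k) -> (forall n, series m n <= M) ->
  series f @ \oo --> l -> `|l - series f n| <= M - series m n.
Proof.
move=> fm mM fl.
have m0 k : 0 <= m k by apply: le_trans (fm k).
have : (fun k => series f (k + n)%N - series f n) @ \oo --> l - series f n.
  apply: cvgB; last exact: cvg_cst.
  by rewrite (cvg_shiftn n (series f)).
move/cvgn_norm_bound; apply => k.
rewrite series_addn addrAC subrr add0r.
apply: le_trans (ler_norm_sum _ _ _) _.
apply: (@le_trans _ _ (\sum_(n <= i < k + n) m i)); first exact: ler_sum.
by rewrite lerBrDl -series_addn.
Qed.

Lemma cvgn_sum (R : realType) (I : Type) (r : seq I) (P : pred I)
    (u : I -> nat -> R) (l : I -> R) :
  (forall i, P i -> u i @ \oo --> l i) ->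
  (fun n => \sum_(i <- r | P i) u i n) @ \oo --> \sum_(i <- r | P i) l i.
Proof.
move=> ul; elim: r => [|i r IH].
  under eq_fun do rewrite big_nil; rewrite big_nil; exact: cvg_cst.
under eq_fun do rewrite big_cons; rewrite big_cons.
by case: ifPn => // Pi; apply: cvgD => //; exact: ul.
Qed.

(** Dominated convergence for series: cut at a [K] beyond which the tail of [m] is below a third of
    the tolerance; it controls the tails of [u] and [v] uniformly in [N], and the finite part
    converges termwise. *)
Lemma tannery (R : realType) (u : nat -> nat -> R) (v m s : nat -> R) (sv M : R) :
  (forall k N, `|u k N| <= m k) -> (forall n, series m n <= M) ->
  (forall k, u k @ \oo --> v k) ->
  (forall N, series (u ^~ N) @ \oo --> s N) -> series v @ \oo --> sv ->
  s @ \oo --> sv.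
Proof.
move=> um mM uv us vsv.
have m0 k : 0 <= m k by apply: le_trans (um k 0%N).
have vm k : `|v k| <= m k by apply: cvgn_norm_bound (uv k) _ => n.
apply/cvgrPdist_lt => e e0.
have e3 : 0 < e / 3 by lra.
set L := limn (series m).
have mL n : series m n <= L by apply: pseries_le_lim mM.
have mcvg : series m @ \oo --> L by exact: (pseries_cvg m0 mM).
have /cvgrPdist_lt/(_ _ e3) [K _ /(_ K (leqnn K))] := mcvg.
rewrite ger0_norm ?subr_ge0 // => HK.
have H1 := series_tail_le K vm mL vsv.
have H2 N := series_tail_le K (fun k => um k N) mL (us N).
have : (fun N => series (u ^~ N) K) @ \oo --> series v K.
  by rewrite /series /=; apply: cvgn_sum => i _; exact: uv.
move=> /cvgrPdist_lt/(_ _ e3); apply: filterS => N HN.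
have -> : sv - s N = (sv - series v K) + (series v K - series (u ^~ N) K)
   - (s N - series (u ^~ N) K) by ring.
apply: le_lt_trans (ler_normB _ _) _.
apply: le_lt_trans (lerD (ler_normD _ _) (le_refl _)) _.
have := H2 N; lra.
Qed.

Definition cprod (R : realType) (a b : nat -> R) n := \sum_(i < n.+1) a i * b (n - i)%N.

(** This triangular form exhibits the Cauchy product as a double sequence to which [tannery]
    applies. *)
Lemma series_cprod (R : realType) (a b : nat -> R) N :
  series (cprod a b) N = \sum_(i < N) a i * series b (N - i)%N.
Proof.
elim: N => [|N IH]; first by rewrite seriesE0 big_ord0.
rewrite seriesSr IH /cprod !big_ord_recr /= subnn subSnn seriesSr seriesE0 add0r addrA.
congr (_ + _); rewrite -big_split /=; apply: eq_bigr => i _.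
by rewrite subSn 1?ltnW // seriesSr mulrDr.
Qed.

Lemma series_cprod_cvg (R : realType) (a b m m' : nat -> R) (M M' A B : R) :
  (forall n, `|a n| <= m n) -> (forall n, `|b n| <= m' n) ->
  (forall n, series m n <= M) -> (forall n, series m' n <= M') ->
  series a @ \oo --> A -> series b @ \oo --> B ->
  series (cprod a b) @ \oo --> A * B.
Proof.
move=> am bm mM mM' aA bB.
have m0 n : 0 <= m n by apply: le_trans (am n).
have M0 : 0 <= M' by have := mM' 0%N; rewrite seriesE0.
apply: (@tannery _ (fun i N => a i * series b (N - i)%N) (fun i => a i * B)
  (fun i => m i * M') _ _ (M * M')).
- move=> k N; rewrite normrM; apply: ler_pM => //.
  apply: le_trans (series_norm_le _ bm) _; exact: mM'.
- move=> n; rewrite /series /= -mulr_suml ler_wpM2r //; exact: mM.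
- move=> k; apply: cvgM; first exact: cvg_cst.
  rewrite -(cvg_shiftn k) /=.
  by apply: cvg_trans bB; apply: near_eq_cvg; near=> n; rewrite addnK.
(* Truncated subtraction makes [series b (N - i)] empty for [i >= N], so the partial sums are
   constant from [N] on. *)
- move=> N; rewrite series_cprod.
  apply: cvg_near_cst; near=> n.
  have nN : (N <= n)%N by near: n; exists N.
  rewrite /series /= (big_cat_nat (n := N)) //= big_mkord.
  rewrite [X in _ + X]big_nat_cond [X in _ + X]big1 ?addr0 // => i /andP[/andP[Ni _] _].
  have -> : (N - i = 0)%N by apply/eqP; rewrite subn_eq0.
  by rewrite big_nil mulr0.
- have -> : series (fun i => a i * B) = (fun n => series a n * B).
    by apply: funext => n; rewrite /series /= mulr_suml.
  by apply: cvgM => //; exact: cvg_cst.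
Unshelve. all: by end_near. Qed.

Lemma series_cprod_le (R : realType) (m m' : nat -> R) (M M' : R) n :
  (forall n, 0 <= m n) -> (forall n, 0 <= m' n) ->
  (forall n, series m n <= M) -> (forall n, series m' n <= M') ->
  series (cprod m m') n <= M * M'.
Proof.
move=> m0 m0' mM mM'; rewrite series_cprod.
have M0 : 0 <= M' by have := mM' 0%N; rewrite seriesE0.
apply: (@le_trans _ _ (\sum_(i < n) m i * M')).
  by apply: ler_sum => i _; apply: ler_wpM2l.
by rewrite -mulr_suml ler_wpM2r //; have := mM n; rewrite /series /= big_mkord.
Qed.

(** * Norm algebras of functions *)

(* [N f m] reads: the norm of f, restricted to D, is at most m.  The record
   lists what is used of a commutative Banach algebra of functions on D. *)
Record nlike (R : realType) (X : Type) (D : X -> Prop)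
  (N : (X -> R) -> R -> Prop) : Prop := NLike {
  nl_cst : forall c, N (fun=> c) `|c|;
  nl_add : forall f g a b, N f a -> N g b -> N (fun x => f x + g x) (a + b);
  nl_mul : forall f g a b, N f a -> N g b -> N (fun x => f x * g x) (a * b);
  nl_le : forall f a b, N f a -> a <= b -> N f b;
  nl_bnd : forall f a x, N f a -> D x -> `|f x| <= a;
  nl_ge0 : forall f a, N f a -> 0 <= a;
  nl_sum : forall (f : nat -> X -> R) m M g, (forall k, N (f k) (m k)) ->
    (forall n, series m n <= M) ->
    (forall x, D x -> series (f ^~ x) @ \oo --> g x) -> N g M }.

Section NLikeTheory.
Variables (R : realType) (X : Type) (D : X -> Prop) (N : (X -> R) -> R -> Prop).
Hypothesis Nl : nlike D N.

Lemma nl_zero : N (fun=> 0) 0.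
Proof. by have := nl_cst Nl 0; rewrite normr0. Qed.

Lemma nl_scale c f a : N f a -> N (fun x => c * f x) (`|c| * a).
Proof. by move=> Nf; apply: (nl_mul Nl (nl_cst Nl c) Nf). Qed.

Lemma nl_opp f a : N f a -> N (fun x => - f x) a.
Proof.
move=> /(nl_scale (-1)); rewrite normrN1 mul1r.
by congr N; apply: funext => x; rewrite mulN1r.
Qed.

Lemma nl_sub f g a b : N f a -> N g b -> N (fun x => f x - g x) (a + b).
Proof. by move=> Nf /nl_opp Ng; exact: (nl_add Nl). Qed.

Lemma nl_bigsum (I : Type) (r : seq I) (P : pred I) (f : I -> X -> R) (a : I -> R) :
  (forall i, P i -> N (f i) (a i)) ->
  N (fun x => \sum_(i <- r | P i) f i x) (\sum_(i <- r | P i) a i).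
Proof.
move=> Nf; elim: r => [|i r IH].
  under eq_fun do rewrite big_nil; rewrite big_nil; exact: nl_zero.
under eq_fun do rewrite big_cons; rewrite big_cons.
by case: ifPn => // Pi; apply: (nl_add Nl) => //; exact: Nf.
Qed.

Lemma nl_bigprod (I : Type) (r : seq I) (P : pred I) (f : I -> X -> R) (a : I -> R) :
  (forall i, P i -> N (f i) (a i)) ->
  N (fun x => \prod_(i <- r | P i) f i x) (\prod_(i <- r | P i) a i).
Proof.
move=> Nf; elim: r => [|i r IH].
  under eq_fun do rewrite big_nil; rewrite big_nil.
  by have := nl_cst Nl 1; rewrite normr1.
under eq_fun do rewrite big_cons; rewrite big_cons.
by case: ifPn => // Pi; apply: (nl_mul Nl) => //; exact: Nf.
Qed.

Lemma nl_exp f a k : N f a -> N (fun x => f x ^+ k) (a ^+ k).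
Proof.
move=> Nf; elim: k => [|k IH]; first by have := nl_cst Nl 1; rewrite normr1.
by rewrite exprS; under eq_fun do rewrite exprS; exact: (nl_mul Nl).
Qed.

(** Extensionality on [D] follows from [nl_sum], applied to the series f + 0 + 0 + ..., because its
    convergence is only asked on [D]. *)
Lemma nl_ext f g a : N f a -> (forall x, D x -> f x = g x) -> N g a.
Proof.
move=> Nf fg.
pose h k := if k is 0%N then f else (fun=> 0).
pose m k := if k is 0%N then a else 0.
have Sh (V : zmodType) (u : nat -> V) n : (forall k, u k.+1 = 0) -> series u n.+1 = u 0%N.
  move=> u0; elim: n => [|n IH]; first by rewrite seriesSr /series /= big_nil add0r.
  by rewrite seriesSr IH u0 addr0.
apply: (nl_sum Nl (f := h) (m := m)) => [[|k]//=|[|n]|x Dx].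
- exact: nl_zero.
- by rewrite seriesE0; exact: (nl_ge0 Nl Nf).
- by rewrite Sh.
- apply: cvg_near_cst; exists 1%N => // -[//|n] _ /=.
  by rewrite Sh //= fg.
Qed.

Lemma nl_mono d (y : X -> 'rV[R]_d) (a : ('I_d -> nat) -> R) r k :
  (forall i, N (fun x => y x 0 i) r) ->
  N (fun x => mono_sum a (y x) k) (abs_mono_sum a r k).
Proof.
move=> Ny; apply: nl_bigsum => al /eqP alk.
apply: nl_scale; have -> : r ^+ k = \prod_(i < d) r ^+ al i by rewrite prodrXr alk.
by apply: nl_bigprod => i _; exact: nl_exp.
Qed.

(** Substitution into a power series, for any algebra at once: with coordinates of norm at most [r],
    the part of degree [k] has norm at most [abs_mono_sum a r k]. With a Lipschitz modulus this
    yields local Lipschitz bounds, with jets the regularity of the derivative. *)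
Lemma nl_analytic d (y : X -> 'rV[R]_d) (a : ('I_d -> nat) -> R) r M g :
  (forall i, N (fun x => y x 0 i) r) ->
  (forall n, series (abs_mono_sum a r) n <= M) ->
  (forall x, D x -> series (mono_sum a (y x)) @ \oo --> g x) -> N g M.
Proof.
move=> Ny aM yg; apply: (nl_sum Nl (f := fun k x => mono_sum a (y x) k) _ aM yg).
by move=> k; exact: nl_mono.
Qed.

End NLikeTheory.

Section Hol.
Variables (R : realType) (X : Type) (D : X -> Prop) (w : X -> X -> R).
Hypothesis w0 : forall x y, 0 <= w x y.

(* Amounts to [sup |f| + [f]_w <= m], where [f]_w is the seminorm with modulus w. *)
Definition hol (f : X -> R) (m : R) : Prop :=
  [/\ 0 <= m, (forall z, D z -> `|f z| <= m) &
   forall x y z, D x -> D y -> D z -> w x y * `|f z| + `|f x - f y| <= m * w x y].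

Lemma hol_mod f m x y : hol f m -> D x -> D y -> `|f x - f y| <= m * w x y.
Proof.
move=> [_ _ H] Dx Dy; apply: le_trans (H _ _ _ Dx Dy Dx).
by rewrite lerDr mulr_ge0.
Qed.

Lemma hol_intro f a b : 0 <= a -> 0 <= b -> (forall z, D z -> `|f z| <= a) ->
  (forall x y, D x -> D y -> `|f x - f y| <= b * w x y) -> hol f (a + b).
Proof.
move=> a0 b0 Ha Hb; split; first exact: addr_ge0.
  by move=> z Dz; apply: le_trans (Ha _ Dz) _; rewrite lerDl.
by move=> x y z Dx Dy Dz; rewrite mulrDl mulrC lerD ?ler_wpM2r ?Ha ?Hb.
Qed.

Lemma hol_nlike : nlike D hol.
Proof.
split.
- move=> c; rewrite -[`|c|]addr0; apply: hol_intro => // x y _ _.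
  by rewrite subrr normr0 mul0r.
- move=> f g a b [a0 fa Hf] [b0 gb Hg]; split; first exact: addr_ge0.
    by move=> z Dz; apply: le_trans (ler_normD _ _) _; apply: lerD; auto.
  move=> x y z Dx Dy Dz; have := Hf x y z Dx Dy Dz; have := Hg x y z Dx Dy Dz.
  have h1 := ler_normD (f z) (g z).
  have h2 : `|f x + g x - (f y + g y)| <= `|f x - f y| + `|g x - g y|.
    have -> : f x + g x - (f y + g y) = (f x - f y) + (g x - g y) by ring.
    exact: ler_normD.
  have := ler_wpM2l (w0 x y) h1; rewrite !mulrDl mulrDr; lra.
- move=> f g a b [a0 fa Hf] [b0 gb Hg]; split; first exact: mulr_ge0.
    by move=> z Dz; rewrite normrM; apply: ler_pM; auto.
  move=> x y z Dx Dy Dz.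
  (* Each factor is measured at two points at once: [z], for the sup part, and the point where it
     multiplies a difference of the other factor. What the product estimate then lacks is exactly w
     (a - F)(b - G) >= 0. *)
  set F := Num.max `|f z| `|f x|; set G := Num.max `|g z| `|g y|.
  have HF : w x y * F + `|f x - f y| <= a * w x y.
    by rewrite /F; case: (leP `|f z| `|f x|) => _; apply: Hf.
  have HG : w x y * G + `|g x - g y| <= b * w x y.
    by rewrite /G; case: (leP `|g z| `|g y|) => _; apply: Hg.
  have Fa : F <= a by rewrite ge_max !fa.
  have Gb : G <= b by rewrite ge_max !gb.
  have [Fz Fx] : `|f z| <= F /\ `|f x| <= F by rewrite !le_max !lexx orbT.
  have [Gz Gy] : `|g z| <= G /\ `|g y| <= G by rewrite !le_max !lexx orbT.
  have F0 : 0 <= F by apply: le_trans Fz.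
  have G0 : 0 <= G by apply: le_trans Gz.
  have W0 := w0 x y.
  have h1 : `|f z * g z| <= F * G by rewrite normrM ler_pM.
  have h2 : `|f x * g x - f y * g y| <= F * `|g x - g y| + G * `|f x - f y|.
    have -> : f x * g x - f y * g y = f x * (g x - g y) + g y * (f x - f y) by ring.
    by apply: le_trans (ler_normD _ _) _; rewrite !normrM lerD // ler_wpM2r.
  have h3 := ler_wpM2l W0 h1.
  have h4 : F * (w x y * G + `|g x - g y|) <= F * (b * w x y) by rewrite ler_wpM2l.
  have h5 : G * (w x y * F + `|f x - f y|) <= G * (a * w x y) by rewrite ler_wpM2l.
  have h6 : 0 <= w x y * ((a - F) * (b - G)) by rewrite !mulr_ge0 // subr_ge0.
  apply: (le_trans (lerD h3 h2)).
  rewrite -subr_ge0 in h4; rewrite -subr_ge0 in h5; rewrite -subr_ge0.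
  apply: (le_trans (addr_ge0 (addr_ge0 h4 h5) h6)).
  by rewrite le_eqVlt; apply/orP; left; apply/eqP; ring.
- move=> f a b [a0 fa Hf] ab; split; first exact: le_trans ab.
    by move=> z Dz; apply: le_trans (fa _ Dz) ab.
  by move=> x y z Dx Dy Dz; apply: le_trans (Hf _ _ _ Dx Dy Dz) _; rewrite ler_wpM2r.
- by move=> f a x [_ H _] /H.
- by move=> f a [].
- move=> f m M g Hf mM fg.
  have f1 x : D x -> forall k, `|f k x| <= m k by move=> Dx k; case: (Hf k) => _ H _; exact: H.
  split.
  + by have := mM 0%N; rewrite seriesE0.
  + move=> z Dz; apply: (cvgn_norm_bound (fg z Dz)) => n.
    by apply: le_trans (mM n); apply: series_norm_le; exact: f1.
  + move=> x y z Dx Dy Dz.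
    have c1 : (fun n => w x y * `|series (f ^~ z) n| +
       `|series (f ^~ x) n - series (f ^~ y) n|) @ \oo -->
       w x y * `|g z| + `|g x - g y|.
      apply: cvgD; first by apply: cvgM; [exact: cvg_cst|apply: cvg_norm; exact: fg].
      by apply: cvg_norm; apply: cvgB; exact: fg.
    apply: (cvgn_le_bound c1) => n.
    apply: (@le_trans _ _ (series m n * w x y)); last by rewrite ler_wpM2r.
    rewrite /series /= mulr_suml -sumrB.
    apply: (@le_trans _ _ (\sum_(0 <= k < n) (w x y * `|f k z| + `|f k x - f k y|))).
      rewrite [leRHS]big_split /= -mulr_sumr; apply: lerD; last exact: ler_norm_sum.
      by rewrite ler_wpM2l //; exact: ler_norm_sum.
    by apply: ler_sum => k _; case: (Hf k) => _ _; apply.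
Qed.

End Hol.

(** * Power series in the parameter, with coefficients in a norm algebra *)

Section PowerSeries.
Variables (R : realType) (X : Type) (D : X -> Prop) (N : (X -> R) -> R -> Prop).
Hypothesis Nl : nlike D N.

Definition PSdom (t : R) (p : R * X) : Prop := `|p.1| <= t /\ D p.2.

(** The weighted l1 norm of the coefficients at radius [t]. The coefficients are existentially
    hidden, so that the elements are again functions, now of the pair (e, x), and the record [nlike]
    applies to them. *)
Definition PS (t : R) (g : R * X -> R) (m : R) : Prop :=
  exists (c : nat -> X -> R) (mc : nat -> R),
    [/\ forall n, N (c n) (mc n), forall n, series (fun k => t ^+ k * mc k) n <= m &
     forall e x, `|e| <= t -> D x -> series (fun n => e ^+ n * c n x) @ \oo --> g (e, x)].

Lemma PS_term t c mc e x n : (forall n, N (c n) (mc n)) -> `|e| <= t -> D x ->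
  `|e ^+ n * c n x| <= t ^+ n * mc n.
Proof.
move=> Nc et Dx; rewrite normrM normrX ler_pM ?exprn_ge0 //.
  by rewrite lerXn2r // nnegrE ?(le_trans _ et).
exact: (nl_bnd Nl).
Qed.

Lemma PS_lift t f m : N f m -> PS t (fun p => f p.2) m.
Proof.
move=> Nf; exists (fun n => if n is 0%N then f else fun=> 0), (fun n => if n is 0%N then m else 0).
have Sh (u : nat -> R) n : (forall k, u k.+1 = 0) -> series u n.+1 = u 0%N.
  move=> u0; elim: n => [|n IH]; first by rewrite seriesSr seriesE0 add0r.
  by rewrite seriesSr IH u0 addr0.
split=> [[|n]//|[|n]|e x et Dx].
- exact: (nl_zero Nl).
- by rewrite seriesE0; exact: (nl_ge0 Nl Nf).
- by rewrite Sh ?expr0 ?mul1r // => k; rewrite mulr0.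
- apply: cvg_near_cst; exists 1%N => // -[//|n] _ /=.
  by rewrite Sh ?expr0 ?mul1r // => k; rewrite mulr0.
Qed.

Lemma PS_nlike t : 0 < t -> nlike (PSdom t) (PS t).
Proof.
move=> t0.
have tn0 n : 0 <= t ^+ n by rewrite exprn_ge0 ?ltW.
split.
- by move=> c; exact: PS_lift (nl_cst Nl c).
- move=> f g a b [c [mc [Nc Hm Hc]]] [c' [mc' [Nc' Hm' Hc']]].
  exists (fun n x => c n x + c' n x), (fun n => mc n + mc' n); split.
  + by move=> n; exact: (nl_add Nl).
  + move=> n; have := lerD (Hm n) (Hm' n).
    by rewrite /series /= -big_split /=; under eq_bigr do rewrite -mulrDr.
  + move=> e x et Dx.
    have -> : series (fun n => e ^+ n * (c n x + c' n x)) =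
      (fun k => series (fun n => e ^+ n * c n x) k + series (fun n => e ^+ n * c' n x) k).
      apply: funext => n; rewrite /series /= -big_split /=.
      by apply: eq_bigr => i _; rewrite mulrDr.
    by apply: cvgD; [exact: Hc|exact: Hc'].
- move=> f g a b [c [mc [Nc Hm Hc]]] [c' [mc' [Nc' Hm' Hc']]].
  exists (fun n x => cprod (c ^~ x) (c' ^~ x) n), (cprod mc mc').
  have E (q : R) (u v : nat -> R) : (fun n => q ^+ n * cprod u v n) =
      cprod (fun n => q ^+ n * u n) (fun n => q ^+ n * v n).
    apply: funext => n; rewrite /cprod mulr_sumr; apply: eq_bigr => i _.
    have -> : q ^+ n = q ^+ i * q ^+ (n - i) by rewrite -exprD subnKC // -ltnS.
    ring.
  split.
  + move=> n; apply: (nl_bigsum Nl) => i _; exact: (nl_mul Nl).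
  + move=> n; rewrite E; apply: series_cprod_le => // k; rewrite mulr_ge0 //.
      exact: (nl_ge0 Nl).
    exact: (nl_ge0 Nl).
  + move=> e x et Dx; rewrite E.
    apply: (series_cprod_cvg (m := fun n => t ^+ n * mc n)
      (m' := fun n => t ^+ n * mc' n) (M := a) (M' := b)) => //.
    * by move=> n; exact: PS_term.
    * by move=> n; exact: PS_term.
    * exact: Hc.
    * exact: Hc'.
- move=> f a b [c [mc [Nc Hm Hc]]] ab; exists c, mc; split => // n.
  exact: le_trans ab.
- move=> f a [e x] [c [mc [Nc Hm Hc]]] [/= et Dx].
  apply: (cvgn_norm_bound (Hc e x et Dx)) => n; apply: le_trans (Hm n).
  by apply: series_norm_le => k; exact: PS_term.
- by move=> f a [c [mc [Nc Hm Hc]]]; have := Hm 0%N; rewrite seriesE0.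
(* The coefficients are summed over [k] at each fixed power of [e]. They are dominated by
   [m k / t ^+ n], which is where [t > 0] enters; [tannery] exchanges this sum with the one over
   powers. *)
- move=> f m M g Hf mM fg.
  have /choice[cm Hcm] k : exists q : (nat -> X -> R) * (nat -> R),
    [/\ forall n, N (q.1 n) (q.2 n), forall n, series (fun j => t ^+ j * q.2 j) n <= m k &
     forall e x, `|e| <= t -> D x -> series (fun n => e ^+ n * q.1 n x) @ \oo --> f k (e, x)].
    by have [c [mc H]] := Hf k; exists (c, mc).
  pose c k := (cm k).1; pose mc k := (cm k).2.
  have Nc k n : N (c k n) (mc k n) by case: (Hcm k) => H _ _; exact: H.
  have mc0 k n : 0 <= mc k n by exact: (nl_ge0 Nl (Nc k n)).
  have m_ge k n : series (fun j => t ^+ j * mc k j) n <= m k by case: (Hcm k) => _ H _; exact: H.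
  have mck k n : mc k n <= m k / t ^+ n.
    rewrite ler_pdivlMr ?exprn_gt0 // mulrC; apply: le_trans (m_ge k n.+1).
    by rewrite seriesSr lerDr; apply: series_ge0 => j; rewrite mulr_ge0.
  have mcM n k : series (mc ^~ n) k <= M / t ^+ n.
    apply: (@le_trans _ _ (series m k / t ^+ n)); last by rewrite ler_wpM2r ?invr_ge0.
    by rewrite /series /= mulr_suml; apply: ler_sum => i _.
  have mccvg n : cvgn (series (mc ^~ n)) by apply: pseries_cvg (mcM n).
  exists (fun n x => limn (series (fun k => c k n x))), (fun n => limn (series (mc ^~ n))).
  split.
  + move=> n; apply: (nl_sum Nl (f := fun k => c k n) (m := mc ^~ n)) => // [k|x Dx].
      by apply: (pseries_le_lim _ _ (mcM n)).
    by apply: (dom_series_cvg (m := mc ^~ n) _ (mcM n)) => k; exact: (nl_bnd Nl).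
  + move=> n; rewrite /series /=.
    have c1 : (fun k => \sum_(0 <= i < n) t ^+ i * series (mc ^~ i) k) @ \oo -->
       \sum_(0 <= i < n) t ^+ i * limn (series (mc ^~ i)).
      by apply: cvgn_sum => i _; apply: cvgM; [exact: cvg_cst|exact: mccvg].
    apply: (cvgn_le_bound c1) => k.
    apply: le_trans (mM k); rewrite /series /=.
    under eq_bigr do rewrite mulr_sumr.
    by rewrite exchange_big /=; apply: ler_sum => j _; exact: m_ge.
  + move=> e x et Dx.
    apply: (tannery (u := fun k n => series (fun i => e ^+ i * c k i x) n)
       (v := fun k => f k (e, x)) (m := m) (M := M)) => //.
    * move=> k n; apply: le_trans (m_ge k n); apply: series_norm_le => j.
      exact: PS_term.
    * by move=> k; case: (Hcm k) => _ _; apply.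
    * move=> n.
      have -> : series (fun k => series (fun i => e ^+ i * c k i x) n) =
        (fun K => \sum_(0 <= i < n) e ^+ i * series (fun k => c k i x) K).
        apply: funext => K; rewrite /series /= exchange_big /=.
        by apply: eq_bigr => i _; rewrite mulr_sumr.
      apply: cvgn_sum => i _; apply: cvgM; first exact: cvg_cst.
      by apply: (dom_series_cvg (m := mc ^~ i) _ (mcM i)) => k; exact: (nl_bnd Nl).
    * by apply: fg.
Qed.

End PowerSeries.

(** * Sup norm against Euclidean norm on row vectors *)

Section RowNorm.
Variables (R : realType) (d : nat).
Implicit Types z : 'rV[R]_d.

Lemma rV_coord_le z i : `|z 0 i| <= `|z|.
Proof.
rewrite [leRHS]/Num.Def.normr /= mx_normrE.
exact: (le_bigmax _ (fun ij : 'I_1 * 'I_d => `|z ij.1 ij.2|) (0, i)).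
Qed.

Lemma rV_norm_le z m : 0 <= m -> (forall i, `|z 0 i| <= m) -> `|z| <= m.
Proof.
move=> m0 zm; rewrite [leLHS]/Num.Def.normr /= mx_normrE; apply: bigmax_le => // -[i j] _ /=.
by rewrite (ord1 i).
Qed.

Lemma norm_le_tenorm z : `|z| <= tenorm z.
Proof.
apply: rV_norm_le => [|i]; first exact: sqrtr_ge0.
rewrite -sqrtr_sqr ler_wsqrtr // (bigD1 i) //= lerDl sumr_ge0 // => j _.
exact: sqr_ge0.
Qed.

Lemma tenorm_le_sum z : tenorm z <= \sum_i `|z 0 i|.
Proof.
have S0 : 0 <= \sum_i `|z 0 i| by apply: sumr_ge0.
rewrite /tenorm -(ger0_norm S0) -sqrtr_sqr ler_wsqrtr //.
rewrite expr2 mulr_suml; apply: ler_sum => i _.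
rewrite -(real_normK (num_real (z 0 i))) expr2 ler_wpM2l //.
by rewrite (bigD1 i) //= lerDl sumr_ge0.
Qed.

Lemma tenorm_le_norm z : tenorm z <= d%:R * `|z|.
Proof.
apply: le_trans (tenorm_le_sum z) _.
rewrite mulr_natl -[X in _ *+ X]card_ord -sumr_const.
by apply: ler_sum => i _; exact: rV_coord_le.
Qed.

Lemma tenorm_ge0 z : 0 <= tenorm z. Proof. exact: sqrtr_ge0. Qed.

Lemma lin_le z (q : 'I_d -> R) b : (forall k, `|q k| <= b) ->
  `|\sum_k z 0 k * q k| <= `|z| * (d%:R * b).
Proof.
move=> qb; apply: le_trans (ler_norm_sum _ _ _) _.
rewrite mulrCA mulr_natl -[X in _ *+ X]card_ord -sumr_const.
by apply: ler_sum => i _; rewrite normrM ler_pM // rV_coord_le.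
Qed.

End RowNorm.

(** * The algebra of first-order jets *)

Section Jets.
Variables (R : realType) (d : nat) (X : Type) (D : X -> Prop) (N : (X -> R) -> R -> Prop).
Hypothesis Nl : nlike D N.
Notation vec := 'rV[R]_d.

Definition Jdom (rho : R) (p : X * vec) : Prop := D p.1 /\ `|p.2| <= rho.

(** Scaling by [rho] makes [c] the size of the remainder on the whole ball, hence comparable with
    the bounds for the constant and the linear part. *)
Definition jet_approx rho (g : X * vec -> R) (p : X -> R) (q : 'I_d -> X -> R) (c : R) :=
  forall x z, D x -> `|z| <= rho ->
    `|g (x, z) - p x - \sum_k z 0 k * q k x| <= c * (`|z| / rho) ^+ 2.

(* First-order Taylor expansions in z with coefficients in N; the remainder
   constant is part of the norm, which makes it submultiplicative. *)
Definition J (rho : R) (g : X * vec -> R) (m : R) : Prop :=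
  exists (p : X -> R) (q : 'I_d -> X -> R) (a b c : R), [/\ N p a, forall k, N (q k) b, 0 <= b /\ 0 <= c,
    a + rho * (d.+1%:R * b) + c <= m & jet_approx rho g p q c].

Lemma J_cst rho f m : N f m -> J rho (fun p => f p.1) m.
Proof.
move=> Nf; exists f, (fun _ _ => 0), m, 0, 0; split => //.
- by move=> k; exact: (nl_zero Nl).
- by rewrite !mulr0 !addr0.
- move=> x z Dx _ /=; rewrite subrr sub0r normrN mul0r.
  by rewrite big1 ?normr0 // => i _; rewrite mulr0.
Qed.

Lemma J_coord rho i : 0 < rho -> J rho (fun p => p.2 0 i) (rho * d.+1%:R).
Proof.
move=> r0; exists (fun=> 0), (fun k _ => (k == i)%:R), 0, 1, 0; split => //.
- exact: (nl_zero Nl).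
- move=> k; apply: (nl_le Nl (nl_cst Nl _)); by case: (k == i); rewrite ?normr1 ?normr0.
- by rewrite add0r addr0 mulr1.
- move=> x z Dx _ /=; rewrite subr0 mul0r (bigD1 i) //= eqxx mulr1 big1 ?addr0 ?subrr ?normr0 //.
  by move=> k /negbTE ->; rewrite mulr0.
Qed.

Lemma J_nlike rho : 0 < rho -> nlike (Jdom rho) (J rho).
Proof.
move=> r0.
have zeta0 (z : vec) : 0 <= `|z| / rho by rewrite divr_ge0 // ltW.
have zeta1 (z : vec) : `|z| <= rho -> `|z| / rho <= 1 by rewrite ler_pdivrMr // mul1r.
have linb (z : vec) (q : 'I_d -> R) b : 0 <= b -> (forall k, `|q k| <= b) ->
    `|\sum_k z 0 k * q k| <= `|z| / rho * (rho * (d.+1%:R * b)).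
  move=> b0 qb; apply: le_trans (lin_le z qb) _.
  rewrite [leRHS]mulrA divfK ?lt0r_neq0 // ler_wpM2l //.
  by rewrite ler_wpM2r // ler_nat.
split.
- by move=> c; exact: J_cst (nl_cst Nl c).
- move=> f g A A' [p [q [a [b [c [Np Nq [b0 c0] m1 H]]]]]] [p' [q' [a' [b' [c' [Np' Nq' [b0' c0'] m1' H']]]]]].
  exists (fun x => p x + p' x), (fun k x => q k x + q' k x), (a + a'), (b + b'), (c + c').
  split.
  + exact: (nl_add Nl).
  + by move=> k; exact: (nl_add Nl).
  + by split; exact: addr_ge0.
  + apply: le_trans (lerD m1 m1').
    by rewrite le_eqVlt; apply/orP; left; apply/eqP; ring.
  + move=> x z Dx zr; rewrite mulrDl.
    have -> : f (x, z) + g (x, z) - (p x + p' x) - \sum_k z 0 k * (q k x + q' k x) =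
      (f (x, z) - p x - \sum_k z 0 k * q k x) + (g (x, z) - p' x - \sum_k z 0 k * q' k x).
      by under eq_bigr do rewrite mulrDr; rewrite big_split /=; ring.
    by apply: le_trans (ler_normD _ _) _; apply: lerD; [exact: H|exact: H'].
- move=> f g A A' [p [q [a [b [c [Np Nq [b0 c0] m1 H]]]]]] [p' [q' [a' [b' [c' [Np' Nq' [b0' c0'] m1' H']]]]]].
  have a0 := nl_ge0 Nl Np; have a0' := nl_ge0 Nl Np'.
  pose B := rho * (d.+1%:R * b); pose B' := rho * (d.+1%:R * b').
  have B0 : 0 <= B by rewrite !mulr_ge0 // ltW.
  have B0' : 0 <= B' by rewrite !mulr_ge0 // ltW.
  (* The new remainder constant collects every term of (a + B + c)(a' + B' + c') except a a', a B'
     and B a', which belong to the constant and linear parts; so the norms multiply exactly. Powers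
     of |z| / rho above the second are absorbed since it is at most 1. *)
  exists (fun x => p x * p' x), (fun k x => p x * q' k x + q k x * p' x), (a * a'),
    (a * b' + b * a'), (B * B' + a * c' + c * a' + B * c' + c * B' + c * c').
  split.
  + exact: (nl_mul Nl).
  + by move=> k; apply: (nl_add Nl); exact: (nl_mul Nl).
  + by split; repeat (apply: addr_ge0); apply: mulr_ge0.
  + apply: (@le_trans _ _ ((a + B + c) * (a' + B' + c'))).
      by rewrite /B /B' le_eqVlt; apply/orP; left; apply/eqP; ring.
    by apply: ler_pM => //; rewrite !addr_ge0.
  + move=> x z Dx zr.
    have := H x z Dx zr; have := H' x z Dx zr.
    have pa := nl_bnd Nl Np Dx; have pa' := nl_bnd Nl Np' Dx.
    have Q := linb z (fun k => q k x) b b0 (fun k => nl_bnd Nl (Nq k) Dx).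
    have Q' := linb z (fun k => q' k x) b' b0' (fun k => nl_bnd Nl (Nq' k) Dx).
    move: (zeta0 z) (zeta1 z zr); set s := `|z| / rho => s0 s1.
    move: Q Q'; rewrite -/B -/B'.
    set lq := \sum_k _; set lq' := \sum_k _ => Q Q'.
    have -> : \sum_k z 0 k * (p x * q' k x + q k x * p' x) = p x * lq' + lq * p' x.
      rewrite /lq /lq' mulr_sumr mulr_suml -big_split /=.
      by apply: eq_bigr => k _; ring.
    set r := f (x, z) - p x - lq; set r' := g (x, z) - p' x - lq' => r'c rc.
    have -> : f (x, z) * g (x, z) - p x * p' x - (p x * lq' + lq * p' x) =
       lq * lq' + p x * r' + r * p' x + lq * r' + r * lq' + r * r'.
      by rewrite /r /r'; ring.
    have s20 : 0 <= s ^+ 2 by rewrite exprn_ge0.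
    have s2s : s ^+ 2 <= s by rewrite expr2 ler_piMr.
    have s21 : s ^+ 2 <= 1 by apply: le_trans s1.
    have Q1 : `|lq| <= B by apply: le_trans Q _; rewrite ler_piMl.
    have Q1' : `|lq'| <= B' by apply: le_trans Q' _; rewrite ler_piMl.
    have rc1 : `|r| <= c by apply: le_trans rc _; rewrite ler_piMr.
    have nD (u v U V : R) : `|u| <= U -> `|v| <= V -> `|u + v| <= U + V.
      by move=> uU vV; apply: le_trans (ler_normD _ _) _; exact: lerD.
    clearbody r r'; rewrite !mulrDl; repeat apply: (nD).
    * apply: (@le_trans _ _ ((s * B) * (s * B'))); first by rewrite normrM ler_pM.
      by rewrite expr2 le_eqVlt; apply/orP; left; apply/eqP; ring.
    * by rewrite normrM -mulrA ler_pM.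
    * by rewrite normrM mulrAC ler_pM.
    * by rewrite normrM -mulrA ler_pM.
    * by rewrite normrM mulrAC ler_pM.
    * by rewrite normrM -mulrA ler_pM.
- move=> f A A' [p [q [a [b [c [Np Nq bc m1 H]]]]]] AA.
  by exists p, q, a, b, c; split => //; apply: le_trans AA.
- move=> f A [x z] [p [q [a [b [c [Np Nq [b0 c0] m1 H]]]]]] [/= Dx zr].
  have Hx := H x z Dx zr.
  have Q := linb z (fun k => q k x) b b0 (fun k => nl_bnd Nl (Nq k) Dx).
  have pa := nl_bnd Nl Np Dx.
  have s1 := zeta1 z zr; have s0 := zeta0 z.
  apply: le_trans m1.
  have -> : f (x, z) = p x + \sum_k z 0 k * q k x + (f (x, z) - p x - \sum_k z 0 k * q k x) by ring.
  apply: le_trans (ler_normD _ _) _; apply: lerD.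
    apply: le_trans (ler_normD _ _) _; apply: lerD => //.
    by apply: le_trans Q _; rewrite ler_piMl // !mulr_ge0 // ltW.
  by apply: le_trans Hx _; rewrite ler_piMr // exprn_ile1.
- move=> f A [p [q [a [b [c [Np Nq [b0 c0] m1 H]]]]]].
  by apply: le_trans m1; rewrite !addr_ge0 // ?(nl_ge0 Nl Np) // !mulr_ge0 // ltW.
- move=> f m M g Hf mM fg.
  have /choice[T HT] j : exists T : (X -> R) * ('I_d -> X -> R) * (R * R * R),
    [/\ N T.1.1 T.2.1.1, forall k, N (T.1.2 k) T.2.1.2, 0 <= T.2.1.2 /\ 0 <= T.2.2,
     T.2.1.1 + rho * (d.+1%:R * T.2.1.2) + T.2.2 <= m j & jet_approx rho (f j) T.1.1 T.1.2 T.2.2].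
    by have [p [q [a [b [c H]]]]] := Hf j; exists ((p, q), ((a, b), c)).
  pose p j := (T j).1.1; pose q j := (T j).1.2.
  pose a j := (T j).2.1.1; pose b j := (T j).2.1.2; pose c j := (T j).2.2.
  have Np j : N (p j) (a j) by case: (HT j).
  have Nq j k : N (q j k) (b j) by case: (HT j) => _ H _ _ _; exact: H.
  have b0 j : 0 <= b j by case: (HT j) => _ _ [].
  have c0 j : 0 <= c j by case: (HT j) => _ _ [].
  have a0 j : 0 <= a j by exact: (nl_ge0 Nl (Np j)).
  have mj j : a j + rho * (d.+1%:R * b j) + c j <= m j by case: (HT j).
  have jj j : jet_approx rho (f j) (p j) (q j) (c j) by case: (HT j).
  have rd0 : 0 <= rho * d.+1%:R by rewrite mulr_ge0 // ltW.
  have SM n : series a n + rho * (d.+1%:R * series b n) + series c n <= M.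
    apply: le_trans (mM n); rewrite /series /= !mulr_sumr -!big_split /=.
    by apply: ler_sum => j _; exact: mj.
  have d0 n : 0 <= rho * (d.+1%:R * series b n).
    by rewrite mulrA mulr_ge0 //; exact: series_ge0.
  have aM n : series a n <= M.
    apply: le_trans (SM n); rewrite -addrA lerDl addr_ge0 //; exact: series_ge0.
  have cM n : series c n <= M.
    apply: le_trans (SM n); rewrite lerDr addr_ge0 //; exact: series_ge0.
  (* The factor [d.+1] instead of [d] is positive also in dimension 0, so the bound on the linear
     coefficients can be divided by it. *)
  have rd : 0 < rho * d.+1%:R by rewrite mulr_gt0.
  have bM n : series b n <= M / (rho * d.+1%:R).
    rewrite ler_pdivlMr // mulrC -mulrA; apply: le_trans (SM n).
    by rewrite addrAC lerDr addr_ge0 //; exact: series_ge0.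
  have ac := pseries_cvg a0 aM.
  have bc := pseries_cvg b0 bM.
  have cc := pseries_cvg c0 cM.
  have pc x : D x -> cvgn (series (p ^~ x)).
    by move=> Dx; apply: (dom_series_cvg (m := a) _ aM) => k; exact: (nl_bnd Nl).
  have qc k x : D x -> cvgn (series (fun j => q j k x)).
    by move=> Dx; apply: (dom_series_cvg (m := b) _ bM) => j; exact: (nl_bnd Nl).
  exists (fun x => limn (series (p ^~ x))), (fun k x => limn (series (fun j => q j k x))),
    (limn (series a)), (limn (series b)), (limn (series c)).
  split.
  + by apply: (nl_sum Nl (f := p) (m := a)) => // n; exact: pseries_le_lim aM.
  + move=> k; apply: (nl_sum Nl (f := fun j => q j k) (m := b)) => // [n|x Dx].
      exact: pseries_le_lim bM.
    exact: qc.
  + by split; [apply: le_trans (pseries_le_lim 0%N b0 bM)|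
      apply: le_trans (pseries_le_lim 0%N c0 cM)]; rewrite seriesE0.
  + apply: (@cvgn_le_bound _ (fun n => series a n + rho * (d.+1%:R * series b n) + series c n)) => //.
    apply: cvgD => //; apply: cvgD => //.
    by apply: cvgM; [exact: cvg_cst|apply: cvgM => //; exact: cvg_cst].
  + move=> x z Dx zr.
    have C1 : (fun n => series (f ^~ (x, z)) n - series (p ^~ x) n -
        \sum_k z 0 k * series (fun j => q j k x) n) @ \oo -->
      g (x, z) - limn (series (p ^~ x)) - \sum_k z 0 k * limn (series (fun j => q j k x)).
      apply: cvgB; first by apply: cvgB; [exact: fg|exact: pc].
      by apply: cvgn_sum => k _; apply: cvgM; [exact: cvg_cst|exact: qc].
    apply: (cvgn_norm_bound C1) => n.
    apply: (@le_trans _ _ (series c n * (`|z| / rho) ^+ 2)); last first.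
      by rewrite ler_wpM2r ?exprn_ge0 //; exact: pseries_le_lim cM.
    have -> : series (f ^~ (x, z)) n - series (p ^~ x) n -
        \sum_k z 0 k * series (fun j => q j k x) n =
      series (fun j => f j (x, z) - p j x - \sum_k z 0 k * q j k x) n.
      rewrite /series /= !sumrB; congr (_ - _).
      by rewrite exchange_big /=; apply: eq_bigr => k _; rewrite mulr_sumr.
    rewrite {2}/series /= mulr_suml.
    by apply: series_norm_le => j; exact: jj.
Qed.

End Jets.

(** * Torus geometry and Hoelder functions *)

Lemma fin_uniform (R : realType) (I : finType) (P : I -> R -> Prop) :
  (forall i, exists2 r, 0 < r & P i r) ->
  (forall i r r', 0 < r' -> r' <= r -> P i r -> P i r') ->
  exists2 r, 0 < r & forall i, P i r.
Proof.
move=> exP mono.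
have /choice[f Hf] i : exists r, 0 < r /\ P i r by have [r] := exP i; exists r.
have f0 i : 0 < f i by case: (Hf i).
have Pf i : P i (f i) by case: (Hf i).
have [r r0 rf] : exists2 r, 0 < r & forall i, r <= f i.
  exists (\big[Num.min/1]_i f i).
    by elim/big_ind: _ => // x y x0 y0; rewrite lt_min x0.
  by move=> i; rewrite (bigD1 i) //= ge_min lexx.
by exists r => // i; apply: mono (Pf i).
Qed.

Section Torus.
Variables (R : realType) (d : nat).
Notation vec := 'rV[R]_d.
Implicit Types x y z w : vec.

Lemma lattice0 : tlattice (0 : vec).
Proof. by exists (fun=> 0) => i; rewrite mxE mulr0. Qed.

Lemma latticeD w w' : tlattice w -> tlattice w' -> tlattice (w + w').
Proof.
move=> [k Hk] [k' Hk']; exists (fun i => k i + k' i) => i.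
rewrite mxE Hk Hk' intrD. ring.
Qed.

Lemma latticeN w : tlattice w -> tlattice (- w).
Proof. by move=> [k Hk]; exists (fun i => - k i) => i; rewrite mxE Hk intrN mulrN. Qed.

Lemma latticeB w w' : tlattice w -> tlattice w' -> tlattice (w - w').
Proof. by move=> lw /latticeN; exact: latticeD. Qed.

Lemma lattice_small w : tlattice w -> (forall i, `|w 0 i| < 2 * pi) -> w = 0.
Proof.
move=> [k Hk] wl; apply/rowP => i; rewrite mxE; have := wl i.
have pi0 : 0 < 2 * pi :> R by rewrite mulr_gt0 // pi_gt0.
rewrite Hk normrM (gtr0_norm pi0) -[ltRHS]mulr1 ltr_pM2l // -intr_norm ltrz1.
case: (k i) => [[|n]|n] //; first by rewrite mulr0z mulr0.
Qed.

Lemma lattice_reduce x : exists2 w, tlattice w & forall i, 0 <= (x - w) 0 i <= 2 * pi.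
Proof.
have pi0 : 0 < 2 * pi :> R by rewrite mulr_gt0 // pi_gt0.
exists (\row_i (2 * pi * (Num.floor (x 0 i / (2 * pi)))%:~R)).
  by exists (fun i => Num.floor (x 0 i / (2 * pi))) => i; rewrite mxE.
move=> i; rewrite !mxE.
have h1 := floor_le (x 0 i / (2 * pi)); have := floorD1_gt (x 0 i / (2 * pi)).
rewrite intrD ltr_pdivrMr // mulrDl mul1r mulrC => /ltW h2.
move: h1; rewrite ler_pdivlMr // mulrC => h1.
by rewrite subr_ge0 h1 lerBlDl.
Qed.

Let dset x y := [set tenorm (x - y - w) | w in tlattice (R := R) (d := d)].

Lemma tdist_has_inf x y : has_inf (dset x y).
Proof.
split; first by exists (tenorm (x - y - 0)), 0 => //; exact: lattice0.
by exists 0 => _ [w _ <-]; exact: tenorm_ge0.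
Qed.

Lemma tdist_ge0 x y : 0 <= tdist x y.
Proof.
apply: lb_le_inf; first by case: (tdist_has_inf x y).
by move=> _ [w _ <-]; exact: tenorm_ge0.
Qed.

Lemma tdist_le x y w : tlattice w -> tdist x y <= tenorm (x - y - w).
Proof. by move=> lw; apply: (ge_inf (proj2 (tdist_has_inf x y))); exists w. Qed.

Lemma tdist_near x y e : tdist x y < e -> exists2 w, tlattice w & tenorm (x - y - w) < e.
Proof. by move=> /(inf_lt (proj1 (tdist_has_inf x y))) [_ [w lw <-] we]; exists w. Qed.

Lemma tdist_le_norm x y : tdist x y <= d%:R * `|x - y|.
Proof.
apply: le_trans (tdist_le x y lattice0) _; rewrite subr0; exact: tenorm_le_norm.
Qed.

Lemma tdist_cong x x' y y' : tcong x x' -> tcong y y' -> tdist x y = tdist x' y'.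
Proof.
have le (a a' b b' : vec) : tcong a a' -> tcong b b' -> tdist a b <= tdist a' b'.
  move=> ca cb; rewrite leNgt; apply/negP => /tdist_near[w lw].
  have lw' : tlattice (w + ((a - a') - (b - b'))) by apply: latticeD => //; exact: latticeB.
  apply/negP; rewrite -leNgt; apply: le_trans (tdist_le a b lw') _.
  by rewrite le_eqVlt; apply/orP; left; apply/eqP; congr tenorm; apply/rowP => i; rewrite !mxE; ring.
have sym (a b : vec) : tcong a b -> tcong b a by rewrite /tcong => /latticeN; rewrite opprB.
by move=> cx cy; apply: le_anti; rewrite !le //; exact: sym.
Qed.

Lemma tcong_refl x : tcong x x.
Proof. by rewrite /tcong subrr; exact: lattice0. Qed.

Lemma tcongDr x w : tlattice w -> tcong (x + w) x.
Proof. by rewrite /tcong addrC addKr. Qed.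

(** The infimum need not be attained a priori, but two lattice vectors within 1 of x - y differ by
    less than 2 pi in each coordinate and so coincide. A single [w] therefore serves every
    tolerance. *)
Lemma tdist0_cong x y : tdist x y = 0 -> tcong x y.
Proof.
move=> xy0.
have [w lw w1] : exists2 w, tlattice w & tenorm (x - y - w) < 1.
  by apply: tdist_near; rewrite xy0.
suff E : x - y - w = 0 by rewrite /tcong; move/subr0_eq: E => ->.
apply/eqP; rewrite -normr_le0 leNgt; apply/negP => p0.
have [w' lw' w'1] : exists2 u, tlattice u & tenorm (x - y - u) < Num.min 1 `|x - y - w|.
  by apply: tdist_near; rewrite xy0 lt_min ltr01.
move: w'1; rewrite lt_min => /andP[w'1 w'2].
have E : w' - w = 0.
  apply: lattice_small; first exact: latticeB.
  move=> i; apply: le_lt_trans (rV_coord_le _ _) _.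
  have -> : w' - w = (x - y - w) - (x - y - w') by apply/rowP => j; rewrite !mxE; ring.
  apply: le_lt_trans (ler_normB _ _) _.
  have := norm_le_tenorm (x - y - w); have := norm_le_tenorm (x - y - w').
  have := pi_ge2 R; lra.
move: w'2; rewrite (subr0_eq E) ltNge; apply/negP; rewrite negbK; exact: norm_le_tenorm.
Qed.

(** Only an upper bound for the diameter: the norm bound of a representative in the cube
    [0, 2 pi]^d. *)
Definition tdiam : R := d%:R * (2 * pi).

Lemma tdist_diam x y : tdist x y <= tdiam.
Proof.
have [w lw H] := lattice_reduce (x - y).
apply: le_trans (tdist_le x y lw) _; apply: le_trans (tenorm_le_norm _) _.
rewrite ler_wpM2l //; apply: rV_norm_le => [|i].
  by rewrite mulr_ge0 // pi_ge0.
by case/andP: (H i) => h1 h2; rewrite ger0_norm.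
Qed.

(** Compactness of the closed cube, in its near-covering form, merges the local radii into one [e];
    invariance under the lattice carries the result from the cube to the whole space. Every passage
    from local to global bounds on the torus goes through here. *)
Lemma torus_uniform (P : R -> vec -> Prop) :
  (forall e x w, tlattice w -> P e x -> P e (x + w)) ->
  (forall c, exists2 r, 0 < r & forall x e, `|x - c| < r -> 0 < e -> e < r -> P e x) ->
  exists2 e, 0 < e & forall x, P e x.
Proof.
move=> Pper Ploc.
have cK : compact [set v : vec | forall i, `[0, 2 * pi]%classic (v ord0 i : R)].
  by apply: (rV_compact (A := fun=> `[0, 2 * pi]%classic)) => _; exact: segment_compact.
move/compact_near_coveringP: cK => /(_ R 0^'+ P _) H.
have {}H : \forall e \near 0^'+, [set v : vec | forall i, `[0, 2 * pi]%classic (v ord0 i : R)] `<=` P e.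
  apply: H => c _; have [r r0 Hr] := Ploc c.
  exists (ball c r, [set e | 0 < e < r]) => /=; last first.
    move=> [x e] /= [bx /andP[e0 er]]; apply: Hr => //.
    by move: bx; rewrite mx_norm_ball /ball_ /= distrC.
  split; first exact: nbhsx_ballx.
  near=> e; apply/andP; split; first by near: e; exact: nbhs_right_gt.
  by near: e; exact: nbhs_right_lt.
have : \forall e \near (0:R)^'+, 0 < e /\ [set v : vec | forall i, `[0, 2 * pi]%classic (v ord0 i : R)] `<=` P e.
  by near=> e; split; [near: e; exact: nbhs_right_gt|near: e; exact: H].
move=> /filter_ex [e [e0 He]]; exists e => // x.
have [w lw Hw] := lattice_reduce x.
rewrite -(subrK w x); apply: Pper => //; apply: He => i /=.
by rewrite in_itv /=; exact: Hw.
Unshelve. all: by end_near. Qed.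

End Torus.

Lemma hol_inv (R : realType) (X : Type) (D : X -> Prop) (w : X -> X -> R) (f : X -> R) (m e : R) :
  (forall x y, 0 <= w x y) -> 0 < e -> hol D w f m -> (forall x, D x -> e <= `|f x|) ->
  hol D w (fun x => (f x)^-1) (e^-1 + m / e ^+ 2).
Proof.
move=> w0 e0 Hf fe; have [m0 fm _] := Hf.
have i0 : 0 <= e^-1 by rewrite invr_ge0 ltW.
have f0 x : D x -> f x != 0 by move=> Dx; rewrite -normr_gt0 (lt_le_trans e0) // fe.
have fi x : D x -> `|(f x)^-1| <= e^-1.
  by move=> Dx; rewrite normfV lef_pV2 ?posrE ?fe // normr_gt0 f0.
apply: hol_intro => //; first by rewrite divr_ge0 // exprn_ge0 // ltW.
move=> x y Dx Dy.
have -> : (f x)^-1 - (f y)^-1 = (f y - f x) * ((f x)^-1 * (f y)^-1).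
  by field; rewrite !f0.
rewrite normrM -mulrA [_^-1 * w _ _]mulrC mulrA; apply: ler_pM => //.
  by rewrite distrC; exact: (hol_mod w0 Hf).
by rewrite normrM expr2 invfM; apply: ler_pM; rewrite ?fi.
Qed.

Section TorusHoelder.
Variables (R : realType) (d : nat).
Notation vec := 'rV[R]_d.
Implicit Types x y z w : vec.

(** With this modulus the norm of [hol] is sup |f| + eta [f]_beta: [eta] is the weight of the
    seminorm. *)
Definition tw (beta eta : R) (x y : vec) : R := tdist x y `^ beta / eta.

Definition thol (beta eta : R) (f : vec -> R) (m : R) : Prop :=
  hol (fun _ : vec => True) (tw beta eta) f m.

Lemma tw_ge0 beta eta x y : 0 < eta -> 0 <= tw beta eta x y.
Proof. by move=> e0; rewrite divr_ge0 ?powR_ge0 // ltW. Qed.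

Lemma thol_nlike beta eta : 0 < eta -> nlike (fun _ : vec => True) (thol beta eta).
Proof. by move=> e0; apply: hol_nlike => x y; exact: tw_ge0. Qed.

Lemma tdist_xx x : tdist x x = 0.
Proof.
apply: le_anti; rewrite tdist_ge0 andbT.
by apply: le_trans (tdist_le_norm _ _) _; rewrite subrr normr0 mulr0.
Qed.

(** The modulus vanishes at congruent points, so a finite norm already forces periodicity; it never
    has to be carried along separately. *)
Lemma thol_cong beta eta f m x y : 0 < beta -> 0 < eta -> thol beta eta f m ->
  tcong x y -> f x = f y.
Proof.
move=> b0 e0 Hf cxy; apply/eqP; rewrite -subr_eq0 -normr_le0.
apply: le_trans (hol_mod (fun x y => tw_ge0 beta x y e0) Hf I I) _.
by rewrite /tw (tdist_cong cxy (tcong_refl y)) tdist_xx powR0 ?lt0r_neq0 // mul0r mulr0.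
Qed.

Lemma thol_periodic beta eta f m : 0 < beta -> 0 < eta -> thol beta eta f m -> tperiodic f.
Proof. by move=> b0 e0 Hf x w lw; apply: (thol_cong b0 e0 Hf); exact: tcongDr. Qed.

Lemma periodic_cong (V : Type) (f : vec -> V) x y : tperiodic f -> tcong x y -> f x = f y.
Proof. by move=> pf c; rewrite -(pf y _ c) addrC subrK. Qed.

Lemma thol_eta beta eta f m : 0 < eta -> eta <= 1 ->
  thol beta 1 f m -> thol beta eta f m.
Proof.
move=> e0 e1 [m0 fm H]; split => // x y z _ _ _.
have := H x y z I I I; rewrite /tw divr1 => h.
rewrite ![_ * (_ / eta)]mulrA; have /= h2 := fm z I.
have t0 := powR_ge0 (tdist x y) beta.
have i0 : 1 <= eta^-1 by rewrite invf_ge1.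
set t := _ `^ _ in h t0 *.
have : 0 <= t * (m - `|f z|) * (eta^-1 - 1) by rewrite !mulr_ge0 // subr_ge0.
have -> : t * (m - `|f z|) * (eta^-1 - 1) = m * t / eta - t / eta * `|f z| - (m * t - t * `|f z|) by ring.
move=> h3; move: h; rewrite mulrC -subr_ge0 => h.
rewrite -subr_ge0; lra.
Qed.

Lemma thol_eta1 beta eta f m : 0 < eta -> eta <= 1 ->
  thol beta eta f m -> thol beta 1 f (m + m / eta).
Proof.
move=> e0 e1 Hf; have [m0 fm _] := Hf.
apply: hol_intro => //; [by move=> *; exact: tw_ge0|by rewrite divr_ge0 // ltW|].
move=> x y _ _; have := hol_mod (fun x y => tw_ge0 beta x y e0) Hf (x := x) (y := y) I I.
by rewrite /tw divr1 mulrA mulrAC.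
Qed.

(** Seminorm bounds are tested only at positive distance; one such pair is needed to conclude that
    their constant is nonnegative. A unit vector is not in the lattice because 2 pi > 1. *)
Lemma exists_tdist_gt0 (i : 'I_d) : exists x y, 0 < tdist x y.
Proof.
exists (delta_mx 0 i), 0; rewrite lt_neqAle tdist_ge0 andbT eq_sym.
apply/eqP => /tdist0_cong [k /(_ i)]; rewrite !mxE !eqxx subr0 => E.
have : `|1 : R| = `|2 * pi * (k i)%:~R| by rewrite -E.
rewrite normr1 normrM ger0_norm ?mulr_ge0 ?pi_ge0 // -intr_norm.
have p2 := pi_ge2 R.
case: (k i) => [[|n]|n] /=.
- by rewrite mulr0 => /eqP; rewrite oner_eq0.
- have : 1 <= `|Posz n.+1|%:~R :> R by rewrite ler1z.
  by move=> h1 h2; have := @ler_pM R 2 (2 * pi) 1 _ (ler0n _ 2) ler01 _ h1; lra.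
- have : 1 <= `|Negz n|%:~R :> R by rewrite ler1z.
  by move=> h1 h2; have := @ler_pM R 2 (2 * pi) 1 _ (ler0n _ 2) ler01 _ h1; lra.
Qed.

Lemma coord_le_tenorm x i : `|x 0 i| <= tenorm x.
Proof. by apply: le_trans (norm_le_tenorm _); exact: rV_coord_le. Qed.

Lemma thol_of_hnorm beta (h : vec -> vec) M i : 0 < beta -> tperiodic h ->
  hnorm_le (@tenorm R d) beta h M -> thol beta 1 (fun x => h x 0 i) M.
Proof.
move=> b0 ph [a [b [abM [ha hb]]]].
have a0 : 0 <= a by apply: le_trans (ha 0); exact: tenorm_ge0.
have bb0 : 0 <= b.
  have [x [y xy]] := exists_tdist_gt0 i.
  have := le_trans (tenorm_ge0 _) (hb x y xy).
  by rewrite pmulr_lge0 // powR_gt0.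
have Nl := thol_nlike beta (ltr01 : 0 < 1 :> R).
apply: (nl_le Nl _ abM); apply: hol_intro => //.
  by move=> *; exact: tw_ge0.
  by move=> x _; apply: le_trans (coord_le_tenorm _ _) (ha x).
move=> x y _ _; have [xy|] := ltP 0 (tdist x y).
  rewrite /tw divr1; apply: le_trans (hb x y xy).
  by apply: le_trans (coord_le_tenorm _ i); rewrite !mxE.
move=> xy; have E : h x = h y.
  by apply: periodic_cong ph _; apply: tdist0_cong; apply: le_anti; rewrite xy tdist_ge0.
by rewrite E subrr normr0 mulr_ge0 // tw_ge0.
Qed.

Lemma hnorm_of_thol beta f m : 
  thol beta 1 f m -> hnorm_le Num.norm beta f (m + m).
Proof.
move=> Hf; have [m0 fm _] := Hf; exists m, m; split => //; split; first by move=> x; exact: fm.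
move=> x y _; have := hol_mod (fun x y => tw_ge0 beta x y ltr01) Hf (x := x) (y := y) I I.
by rewrite /tw divr1.
Qed.

Lemma hnorm_vec_of_thol beta (f : vec -> vec) m : 0 <= m ->
  (forall i, thol beta 1 (fun x => f x 0 i) m) ->
  hnorm_le (@tenorm R d) beta f (d%:R * m + d%:R * m).
Proof.
move=> m0 Hf; exists (d%:R * m), (d%:R * m); split => //.
have S (u : R) : \sum_(i < d) u = d%:R * u by rewrite sumr_const card_ord mulr_natl.
split.
  move=> x; apply: le_trans (tenorm_le_sum _) _; rewrite -S.
  by apply: ler_sum => i _; case: (Hf i) => _ H _; exact: H.
move=> x y _; apply: le_trans (tenorm_le_sum _) _; rewrite -mulrA -S.
apply: ler_sum => i _; have := hol_mod (fun x y => tw_ge0 beta x y ltr01) (Hf i) (x := x) (y := y) I I.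
by rewrite /tw divr1 !mxE.
Qed.

(** Finite diameter does both jobs: it bounds [f] by its value at 0 plus its oscillation, and it
    lowers the exponent, since delta^beta0 <= tdiam^(beta0 - beta) delta^beta. *)
Lemma thol_of_tholder beta0 beta f : 0 < beta -> beta <= beta0 -> tperiodic f ->
  tholder Num.norm beta0 f -> exists m, thol beta 1 f m.
Proof.
move=> b0 bb pf [b hb].
have D0 : 0 <= tdiam R d by rewrite mulr_ge0 // mulr_ge0 // pi_ge0.
have B x y : `|f x - f y| <= `|b| * (tdist x y `^ beta0).
  have [xy|xy] := ltP 0 (tdist x y).
    by apply: le_trans (hb x y xy) _; rewrite ler_wpM2r ?powR_ge0 ?ler_norm.
  have -> : f x = f y.
    by apply: periodic_cong pf _; apply: tdist0_cong; apply: le_anti; rewrite xy tdist_ge0.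
  by rewrite subrr normr0 mulr_ge0 // powR_ge0.
have le0 : 0 <= beta0 by rewrite (le_trans _ bb) // ltW.
exists ((`|f 0| + `|b| * (tdiam R d `^ beta0)) + `|b| * (tdiam R d `^ (beta0 - beta))).
apply: hol_intro.
- by move=> *; exact: tw_ge0.
- by rewrite addr_ge0 // mulr_ge0 // powR_ge0.
- by rewrite mulr_ge0 // powR_ge0.
- move=> x _; rewrite -[f x](subrK (f 0)) addrC; apply: le_trans (ler_normD _ _) _.
  rewrite lerD2l; apply: le_trans (B _ _) _; rewrite ler_wpM2l //.
  by apply: ge0_ler_powR => //; rewrite ?nnegrE ?tdist_ge0 ?tdist_diam.
- move=> x y _ _; apply: le_trans (B _ _) _; rewrite -mulrA ler_wpM2l // /tw divr1.
  have [->|xy] := eqVneq (tdist x y) 0.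
    by rewrite !powR0 ?mulr0 // lt0r_neq0 // (lt_le_trans b0).
  have -> : beta0 = (beta0 - beta) + beta by rewrite subrK.
  rewrite powRD ?xy ?implybT // ler_wpM2r ?powR_ge0 //.
  rewrite addrK; apply: ge0_ler_powR; rewrite ?subr_ge0 ?nnegrE ?tdist_ge0 ?tdist_diam //.
Qed.

Lemma thol_away0 beta f m : 0 < beta -> thol beta 1 f m -> (forall x, f x != 0) ->
  exists2 e, 0 < e & forall x, e <= `|f x|.
Proof.
move=> b0 Hf f0; apply: (torus_uniform (P := fun e x => e <= `|f x|)).
  by move=> e x w lw; rewrite (thol_periodic b0 ltr01 Hf).
move=> c; have [m0 _ _] := Hf.
have fc : 0 < `|f c| by rewrite normr_gt0.
(* Once tdist x c ^ beta <= s, the function moves by at most |f c| / 2; [m + 1] replaces [m] to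
   avoid a zero denominator. *)
pose s := `|f c| / (2 * (m + 1)).
have s0 : 0 < s by rewrite divr_gt0 // mulr_gt0 //; lra.
exists (Num.min (`|f c| / 2) (s `^ beta^-1 / d.+1%:R)).
  by rewrite lt_min !divr_gt0 // powR_gt0.
move=> x e; rewrite !lt_min => /andP[_ xc] _ /andP[ec _].
have tx : tdist x c <= s `^ beta^-1.
  apply: le_trans (tdist_le_norm _ _) _.
  move: xc; rewrite ltr_pdivlMr // => /ltW; apply: le_trans.
  by rewrite mulrC ler_wpM2l // ler_nat.
have tb : tdist x c `^ beta <= s.
  have -> : s = (s `^ beta^-1) `^ beta.
    by rewrite -powRrM mulVf ?lt0r_neq0 // powRr1 // ltW.
  by apply: ge0_ler_powR; rewrite ?nnegrE ?tdist_ge0 ?powR_ge0 // ltW.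
have := hol_mod (fun x y => tw_ge0 beta x y ltr01) Hf (x := x) (y := c) I I.
rewrite /tw divr1 => h.
have h2 : `|f x - f c| <= `|f c| / 2.
  apply: le_trans h _; apply: (@le_trans _ _ (m * s)); first by rewrite ler_wpM2l.
  have -> : m * s = `|f c| / 2 * (m / (m + 1)) by rewrite /s; field; lra.
  rewrite ler_piMr ?divr_ge0 // ler_pdivrMr; lra.
have := lerB_dist (f c) (f x); rewrite distrC; lra.
Qed.

End TorusHoelder.

(** * Analytic maps and their jets *)

Section Analytic.
Variables (R : realType) (d : nat).
Notation vec := 'rV[R]_d.

Lemma abs_mono_sum_ge0 (a : ('I_d -> nat) -> R) r k : 0 <= r -> 0 <= abs_mono_sum a r k.
Proof. by move=> r0; apply: sumr_ge0 => al _; rewrite mulr_ge0 // exprn_ge0. Qed.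

Lemma analytic_bound (f : vec -> R) c : ranalytic_at f c ->
  exists a r M, [/\ 0 < r, forall n, series (abs_mono_sum a r) n <= M &
    forall y, (forall i, `|(y - c) 0 i| < r) -> series (mono_sum a (y - c)) @ \oo --> f y].
Proof.
move=> [a [r [r0 [ca H]]]]; exists a, r, (limn (series (abs_mono_sum a r))); split => //.
  move=> n; apply: nondecreasing_cvgn_le => //; apply: series_homo => k.
  by apply: abs_mono_sum_ge0; exact: ltW.
by move=> y yc; apply: H => i; have := yc i; rewrite !mxE.
Qed.

(** Taking |x - y| as modulus turns [hol] into a Lipschitz norm, so the bound is a substitution of x
    - c into the Taylor series. The number [e] is both radius and inverse Lipschitz constant:
    shrinking it weakens the claim, as [fin_uniform] requires. *)
Lemma analytic_lipschitz_loc (f : vec -> R) c : ranalytic_at f c ->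
  exists2 e, 0 < e & forall x y, `|x - c| < e -> `|y - c| < e ->
    `|f x - f y| <= e^-1 * `|x - y|.
Proof.
move=> /analytic_bound [a [r [M [r0 aM H]]]].
pose D (x : vec) := `|x - c| < r / 4.
pose w (x y : vec) := `|x - y| / (r / 4).
have r4 : 0 < r / 4 by rewrite divr_gt0.
have w0 x y : 0 <= w x y by rewrite divr_ge0 // ltW.
have Nl := hol_nlike D w0.
have Hf : hol D w f M.
  apply: (nl_analytic Nl (y := fun x => x - c) _ aM).
    move=> i; apply: (nl_le Nl (a := r / 4 + r / 4)); last by lra.
    apply: hol_intro => //; rewrite ?ltW //.
      by move=> z Dz; apply: le_trans (rV_coord_le _ _) (ltW Dz).
    move=> x y _ _; rewrite /w mulrCA divff ?lt0r_neq0 // mulr1.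
    by apply: le_trans (rV_coord_le _ i); rewrite !mxE; rewrite le_eqVlt; apply/orP; left; apply/eqP; congr `|_|; ring.
  move=> x Dx; apply: H => i; apply: le_lt_trans (rV_coord_le _ _) _.
  by apply: lt_trans Dx _; lra.
have [M0 _ _] := Hf.
exists (Num.min (r / 4) (r / (4 * (M + 1)))).
  by rewrite lt_min r4 divr_gt0 // mulr_gt0 //; lra.
move=> x y; rewrite !lt_min => /andP[xc _] /andP[yc _].
apply: le_trans (hol_mod w0 Hf xc yc) _.
rewrite /w mulrCA mulrC; apply: ler_wpM2r => //.
have M1 : 0 < M + 1 by lra.
apply: (@le_trans _ _ (r / (4 * (M + 1)))^-1).
  have -> : (r / (4 * (M + 1)))^-1 = (M + 1) / (r / 4) by field; lra.
  by rewrite ler_wpM2r ?invr_ge0 ?ltW //; lra.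
rewrite lef_pV2 ?posrE ?ge_min ?lexx ?orbT // ?lt_min ?r4 /= ?divr_gt0 ?mulr_gt0 //.
Qed.

Lemma analytic_vec_lipschitz_loc (g : vec -> vec) c : ranalytic g ->
  exists2 e, 0 < e & forall x y, `|x - c| < e -> `|y - c| < e ->
    `|g x - g y| <= e^-1 * `|x - y|.
Proof.
move=> ag.
have [e e0 He] : exists2 e, 0 < e & forall (i : 'I_d) x y, `|x - c| < e -> `|y - c| < e ->
    `|g x 0 i - g y 0 i| <= e^-1 * `|x - y|.
  apply: (fin_uniform (P := fun (i : 'I_d) e => forall x y, `|x - c| < e -> `|y - c| < e ->
    `|g x 0 i - g y 0 i| <= e^-1 * `|x - y|)).
    by move=> i; exact: analytic_lipschitz_loc (ag i c).
  move=> i r r' r0 rr' H x y xr yr.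
  apply: le_trans (H x y (lt_le_trans xr rr') (lt_le_trans yr rr')) _.
  by rewrite ler_wpM2r // lef_pV2 // posrE (lt_le_trans r0 rr').
exists e => // x y xc yc; apply: rV_norm_le => [|i].
  by rewrite mulr_ge0 // invr_ge0 ltW.
by rewrite !mxE; exact: He.
Qed.

(** Points closer than a uniform [e] are handled by the local bound; for points farther apart, tdiam
    / e is a Lipschitz constant for trivial reasons. *)
Lemma lift_lipschitz (g : vec -> vec) : ranalytic g -> is_lift g ->
  exists2 K, 1 <= K & forall x y, tdist (g x) (g y) <= K * tdist x y.
Proof.
move=> ag lg.
have tcD (x w : vec) : tlattice w -> tcong (g (x + w)) (g x) by exact: lg.
have [e e0 He] : exists2 e, 0 < e & forall x y : vec, `|y - x| < e ->
    tdist (g y) (g x) <= d%:R * (e^-1 * `|y - x|).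
  apply: (torus_uniform (P := fun e x => forall y : vec, `|y - x| < e ->
    tdist (g y) (g x) <= d%:R * (e^-1 * `|y - x|))).
    move=> e x w lw H y yx.
    have -> : y - (x + w) = (y - w) - x by rewrite opprD addrA addrAC.
    rewrite (tdist_cong (x' := g (y - w)) (y' := g x)); last exact: tcD.
      by apply: H; rewrite addrAC -addrA -opprD.
    by have := tcD (y - w) w lw; rewrite subrK.
  move=> c; have [r r0 Hr] := analytic_vec_lipschitz_loc c ag.
  exists (r / 2); first lra.
  move=> x e xc e0 er y yx; apply: le_trans (tdist_le_norm _ _) _.
  rewrite ler_wpM2l //; apply: le_trans (Hr _ _ _ _) _.
  - rewrite -(subrK x y) -addrA; apply: le_lt_trans (ler_normD _ _) _; lra.
  - lra.
  - by rewrite ler_wpM2r // lef_pV2 ?posrE //; lra.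
pose L := d%:R * e^-1.
have L0 : 0 <= L by rewrite mulr_ge0 // invr_ge0 ltW.
have D0 : 0 <= tdiam R d / e by apply: divr_ge0; [rewrite /tdiam !mulr_ge0 // pi_ge0|exact: ltW].
exists (1 + L + tdiam R d / e); first lra.
move=> x y; have t0 := tdist_ge0 x y.
have [te|te] := ltP (tdist x y) e; last first.
  apply: le_trans (tdist_diam _ _) _.
  have : tdiam R d / e * e <= tdiam R d / e * tdist x y by rewrite ler_wpM2l.
  rewrite divfK ?lt0r_neq0 // => h; apply: le_trans h _.
  by rewrite ler_wpM2r //; lra.
(* The distance is an infimum, so a nearly optimal lattice vector is chosen under the contrary
   assumption. The summand 1 makes the factor positive even if [L] is 0. *)
apply: (@le_trans _ _ ((1 + L) * tdist x y)); last by rewrite ler_wpM2r //; lra.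
rewrite leNgt; apply/negP => lt.
have L1 : 0 < 1 + L by lra.
set T := tdist (g x) (g y) in lt.
have : tdist x y < Num.min e (T / (1 + L)).
  by rewrite lt_min te /= ltr_pdivlMr // mulrC.
move=> /tdist_near [w lw]; rewrite lt_min => /andP[we wT].
have n := norm_le_tenorm (x - y - w).
have : T <= d%:R * (e^-1 * `|x - (y + w)|).
  rewrite /T (tdist_cong (y' := g (y + w)) (tcong_refl _)).
    by apply: He; rewrite opprD addrA; apply: le_lt_trans n we.
  by have := latticeN (tcD y w lw); rewrite opprB.
rewrite opprD addrA mulrA -/L leNgt => /negP; apply.
apply: (@le_lt_trans _ _ ((1 + L) * `|x - y - w|)); first by rewrite ler_wpM2r //; lra.
by rewrite mulrC -ltr_pdivlMr //; apply: le_lt_trans n wT.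
Qed.

(* The increments [g (x + w) - g x] are lattice points, so they are locally constant. *)
Lemma lift_increment (g : vec -> vec) (x w : vec) : ranalytic g -> is_lift g -> tlattice w ->
  exists2 r, 0 < r & forall z, `|z| <= r -> g (x + w + z) - g (x + w) = g (x + z) - g x.
Proof.
move=> ag lg lw.
have [r r0 Hr] := analytic_vec_lipschitz_loc x ag.
have [s s0 Hs] := analytic_vec_lipschitz_loc (x + w) ag.
exists (Num.min r s / 2); first by rewrite divr_gt0 // lt_min r0.
move=> z; rewrite ler_pdivlMr // le_min => /andP[zr zs].
have z0 := normr_ge0 z.
have h1 : `|g (x + z) - g x| <= 1 / 2.
  apply: le_trans (Hr _ _ _ _) _; rewrite ?subrr ?normr0 ?[x + z]addrC ?addrK //; first lra.
  by rewrite mulrC ler_pdivrMr //; lra.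
have h2 : `|g (x + w + z) - g (x + w)| <= 1 / 2.
  apply: le_trans (Hs _ _ _ _) _; rewrite ?subrr ?normr0 ?[x + w + z]addrC ?addrK //; first lra.
  by rewrite mulrC ler_pdivrMr //; lra.
apply/eqP; rewrite -subr_eq0; apply/eqP; apply: lattice_small.
  have -> : g (x + w + z) - g (x + w) - (g (x + z) - g x) =
    (g (x + z + w) - g (x + z)) - (g (x + w) - g x).
    by rewrite [x + z + w]addrAC; apply/rowP => i; rewrite !mxE; ring.
  by apply: latticeB; exact: lg.
move=> i; apply: le_lt_trans (rV_coord_le _ _) _.
apply: le_lt_trans (ler_normB _ _) _; have := pi_ge2 R; lra.
Qed.

(** The remainder is quadratic, as [jet_approx] supplies it. This determines [q] and gives the
    directional derivatives used in the statement. *)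
Definition jet (f : vec -> R) (y : vec) (q : 'I_d -> R) : Prop :=
  exists C rho, 0 < rho /\ forall z, `|z| <= rho ->
    `|f (y + z) - f y - \sum_k z 0 k * q k| <= C * `|z| ^+ 2.

Lemma jet_shift f y y' q : (exists2 r, 0 < r & forall z : vec, `|z| <= r ->
    f (y' + z) - f y' = f (y + z) - f y) -> jet f y q -> jet f y' q.
Proof.
move=> [r r0 Hr] [C [rho [rho0 H]]]; exists C, (Num.min r rho).
split; first by rewrite lt_min r0.
by move=> z; rewrite le_min => /andP[zr zrho]; rewrite Hr //; exact: H.
Qed.

Lemma jet_derivative f y q (v : vec) : jet f y q ->
  (fun h : R => h^-1 *: (f (h *: v + y) - f y)) @ 0^' --> \sum_k v 0 k * q k.
Proof.
move=> [C [rho [rho0 H]]]; apply/cvgrPdist_le => e e0.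
have C0 : 0 <= `|C| * `|v| ^+ 2 by rewrite mulr_ge0 // exprn_ge0.
near=> h.
have hn0 : h != 0 by near: h; exact: nbhs_dnbhs_neq.
have h1 : `|h| <= rho / (`|v| + 1).
  near: h; apply: dnbhs0_le; rewrite divr_gt0 //.
have h2 : `|h| <= e / (`|C| * `|v| ^+ 2 + 1).
  by near: h; apply: dnbhs0_le; rewrite divr_gt0 //; lra.
have v0 := normr_ge0 v.
have hv : `|h *: v| <= rho.
  rewrite normrZ; move: h1; rewrite ler_pdivlMr; last lra.
  by move=> /(le_trans _); apply; rewrite ler_wpM2l //; lra.
have := H _ hv.
have -> : \sum_k (h *: v) 0 k * q k = h * \sum_k v 0 k * q k.
  by rewrite mulr_sumr; apply: eq_bigr => k _; rewrite mxE mulrA.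
rewrite [y + _]addrC; set s := \sum_k _; set F := f _ - f y => B.
have -> : s - h^-1 *: F = - (h^-1 * (F - h * s)).
  by rewrite /GRing.scale /=; field.
rewrite normrN normrM normfV mulrC ler_pdivrMr ?normr_gt0 //.
apply: le_trans B _; rewrite normrZ exprMn.
apply: (@le_trans _ _ ((`|C| * `|v| ^+ 2) * `|h| * `|h|)).
  have -> : `|C| * `|v| ^+ 2 * `|h| * `|h| = `|C| * (`|h| ^+ 2 * `|v| ^+ 2) by ring.
  by rewrite ler_wpM2r ?mulr_ge0 ?exprn_ge0 // ler_norm.
rewrite ler_wpM2r // mulrC; move: h2; rewrite ler_pdivlMr; last lra.
by move=> /(le_trans _); apply; rewrite ler_wpM2l //; lra.
Unshelve. all: by end_near. Qed.

Lemma jet_unique f y q q' : jet f y q -> jet f y q' -> q = q'.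
Proof.
move=> jq jq'; apply: funext => k.
have S (u : 'I_d -> R) : \sum_j (delta_mx 0 k : vec) 0 j * u j = u k.
  rewrite (bigD1 k) //= mxE !eqxx mul1r big1 ?addr0 // => j /negbTE jk.
  by rewrite mxE jk andbF mul0r.
have := jet_derivative (v := delta_mx 0 k) jq; rewrite S.
have := jet_derivative (v := delta_mx 0 k) jq'; rewrite S => h1 h2.
by apply: (cvg_unique _ h2 h1); exact: norm_hausdorff.
Qed.

Lemma jet_derive (g : vec -> vec) y (q : 'I_d -> 'I_d -> R) (v : vec) :
  (forall i, jet (fun x => g x 0 i) y (q i)) ->
  'D_v g y = \row_i \sum_k v 0 k * q i k.
Proof.
move=> jq.
have E i : (fun h : R => h^-1 *: (((fun x => g x 0 i) \o shift y) (h *: v) - g y 0 i)) @ 0^' -->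
    \sum_k v 0 k * q i k by exact: jet_derivative (jq i).
rewrite derive_mx; last first.
  apply/derivable_mxP => o i; rewrite (ord1 o); apply/cvg_ex.
  by exists (\sum_k v 0 k * q i k); exact: E.
apply/rowP => i; rewrite !mxE.
by apply/cvg_lim; [exact: norm_hausdorff|exact: E].
Qed.

End Analytic.

(** A bounded weighted composition operator acts coefficient by coefficient, hence with the same
    bound at every radius [t]. All estimates for Hoelder functions reach power series in this
    way. *)
Lemma PS_op (R : realType) (X X' : Type) (D : X -> Prop) (D' : X' -> Prop)
    (N : (X -> R) -> R -> Prop) (N' : (X' -> R) -> R -> Prop)
    (s : X' -> R) (C : X' -> X) k t g m :
  0 <= k -> (forall x, D' x -> D (C x)) ->
  (forall f m, N f m -> N' (fun x => s x * f (C x)) (k * m)) ->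
  PS D N t g m -> PS D' N' t (fun p => s p.2 * g (p.1, C p.2)) (k * m).
Proof.
move=> k0 DC NN' [c [mc [Nc Hm Hc]]].
exists (fun n x => s x * c n (C x)), (fun n => k * mc n); split.
- by move=> n; exact: NN'.
- move=> n; apply: le_trans (ler_wpM2l k0 (Hm n)).
  rewrite /series /= mulr_sumr; apply: ler_sum => i _.
  by rewrite mulrCA.
- move=> e x et Dx.
  have -> : series (fun n => e ^+ n * (s x * c n (C x))) =
    (fun n => s x * series (fun n => e ^+ n * c n (C x)) n).
    apply: funext => n; rewrite /series /= mulr_sumr; apply: eq_bigr => i _.
    by rewrite mulrCA.
  by apply: cvgM; [exact: cvg_cst|apply: Hc => //; exact: DC].
Qed.

Lemma PS_op_id (R : realType) (X : Type) (D D' : X -> Prop)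
    (N N' : (X -> R) -> R -> Prop) k t g m :
  0 <= k -> (forall x, D' x -> D x) ->
  (forall f m, N f m -> N' f (k * m)) -> PS D N t g m -> PS D' N' t g (k * m).
Proof.
move=> k0 DD NN' Hg.
have H f m' : N f m' -> N' (fun x => 1 * f x) (k * m').
  by move=> /NN'; congr N'; apply: funext => x; rewrite mul1r.
have := PS_op (s := fun=> 1) (C := id) k0 DD H Hg.
by congr PS; apply: funext => -[e x]; rewrite mul1r.
Qed.

Lemma PS_cong (R : realType) (d : nat) beta t (g : R * 'rV[R]_d -> R) m e x y :
  0 < beta -> PS (fun=> True) (thol beta 1) t g m -> `|e| <= t -> tcong x y ->
  g (e, x) = g (e, y).
Proof.
move=> b0 [c [mc [Nc _ Hc]]] et cxy.
apply: (cvgn_unique (Hc e x et I)).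
have -> : series (fun n => e ^+ n * c n x) = series (fun n => e ^+ n * c n y).
  congr series; apply: funext => n.
  by rewrite (thol_cong b0 ltr01 (Nc n) cxy).
exact: Hc.
Qed.

Lemma geo_series (R : realType) (q : R) n : q != 1 ->
  series (fun k => q ^+ k) n = (1 - q ^+ n) / (1 - q).
Proof.
move=> q1; have q1' : 1 - q != 0 by rewrite subr_eq0 eq_sym.
elim: n => [|n IH]; first by rewrite seriesE0 expr0 subrr mul0r.
by rewrite seriesSr IH exprS; field.
Qed.

(** If [a n] is the first nonzero coefficient, the rest of the series is of order x^(n+1) and cannot
    cancel a_n x^n at one small real [x]. *)
Lemma powser_zero (R : realType) (a : nat -> R) K e : 0 < e -> 0 < K ->
  (forall n, `|a n| <= K ^+ n.+1) ->
  (forall x, `|x| < e -> series (fun n => x ^+ n * a n) @ \oo --> 0) ->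
  forall n, a n = 0.
Proof.
move=> e0 K0 aK H n; elim/ltn_ind: n => n IH.
apply/eqP; rewrite -normr_le0 leNgt; apply/negP => an0.
have [KN Kn EK] : exists2 KN, 0 < KN & KN = K ^+ n.+2.
  by exists (K ^+ n.+2) => //; rewrite exprn_gt0.
(* The three bounds keep [x] in the domain, make the geometric ratio K x at most 1/2, and push the
   tail below half of |a_n| x^n. *)
pose x := Num.min (e / 2) (Num.min (K^-1 / 2) (`|a n| / (4 * KN))).
have x0 : 0 < x.
  by rewrite !lt_min; apply/and3P; split; apply: divr_gt0 => //; rewrite ?invr_gt0 ?mulr_gt0.
have xe : x <= e / 2 by rewrite ge_min lexx.
have xK : x <= K^-1 / 2 by rewrite !ge_min lexx orbT.
have xa : x <= `|a n| / (4 * KN) by rewrite !ge_min lexx !orbT.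
have xe' : `|x| < e by rewrite gtr0_norm //; lra.
pose q := K * x.
have q0 : 0 < q by rewrite mulr_gt0.
have q2 : q <= 1 / 2.
  by rewrite /q; apply: le_trans (ler_wpM2l (ltW K0) xK) _; rewrite mulrA divff ?lt0r_neq0.
have q1 : q != 1 by apply/eqP; lra.
have ser k : series (fun k => K * q ^+ k) k = K * ((1 - q ^+ k) / (1 - q)).
  by rewrite -geo_series // /series /= mulr_sumr.
have bnd k : `|x ^+ k * a k| <= K * q ^+ k.
  rewrite normrM normrX gtr0_norm // /q exprMn.
  have -> : K * (K ^+ k * x ^+ k) = x ^+ k * K ^+ k.+1 by rewrite exprS; ring.
  by apply: ler_wpM2l => //; rewrite exprn_ge0 // ltW.
have bM k : series (fun k => K * q ^+ k) k <= K / (1 - q).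
  rewrite ser ler_pM2l // -[leRHS]mul1r ler_pM2r ?invr_gt0; last lra.
  by rewrite gerBl exprn_ge0 // ltW.
have := series_tail_le n.+1 bnd bM (H x xe').
rewrite sub0r normrN seriesSr /series /= big_nat_cond big1 ?add0r; last first.
  by move=> i /andP[/andP[_ /IH ->] _]; rewrite mulr0.
have := ser n.+1; rewrite /series /= => ->.
have -> : K / (1 - q) - K * ((1 - q ^+ n.+1) / (1 - q)) = K * q ^+ n.+1 / (1 - q).
  by field; lra.
rewrite normrM normrX gtr0_norm // ler_pdivlMr; last lra.
have xn : 0 < x ^+ n by rewrite exprn_gt0.
have -> : K * q ^+ n.+1 = x ^+ n * (KN * x) by rewrite /q EK exprMn !exprS; ring.
rewrite -mulrA ler_pM2l // => h.
have h2 : KN * x <= `|a n| / 4.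
  apply: le_trans (ler_wpM2l (ltW Kn) xa) _.
  by rewrite le_eqVlt; apply/orP; left; apply/eqP; field; rewrite lt0r_neq0.
have : `|a n| * (1 - q) >= `|a n| * (1 / 2) by rewrite ler_pM2l //; lra.
lra.
Qed.

Lemma powser_unique (R : realType) (a b : nat -> R) K e : 0 < e -> 0 < K ->
  (forall n, `|a n| <= K ^+ n.+1) -> (forall n, `|b n| <= K ^+ n.+1) ->
  (forall x, `|x| < e -> exists2 l : R, series (fun n => x ^+ n * a n) @ \oo --> l &
     series (fun n => x ^+ n * b n) @ \oo --> l) -> a = b.
Proof.
move=> e0 K0 aK bK H; apply: funext => n; apply/eqP; rewrite -subr_eq0; apply/eqP.
apply: (powser_zero (a := fun n => a n - b n) (K := 2 * K) e0) => [|k|x xe].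
- by rewrite mulr_gt0.
- apply: le_trans (ler_normB _ _) _; apply: le_trans (lerD (aK k) (bK k)) _.
  rewrite exprMn; have u0 : 0 <= K ^+ k.+1 by rewrite exprn_ge0 // ltW.
  move: u0; set u := K ^+ k.+1 => u0; have -> : u + u = 2 * u by ring.
  apply: ler_wpM2r => //.
  by rewrite [leRHS]exprS ler_peMr // exprn_ege1 // ler1n.
- have [l al bl] := H x xe.
  have -> : series (fun n => x ^+ n * (a n - b n)) =
     (fun k => series (fun n => x ^+ n * a n) k - series (fun n => x ^+ n * b n) k).
    by apply: funext => k; rewrite /series /= -sumrB; apply: eq_bigr => i _; rewrite mulrBr.
  by rewrite -(subrr l); exact: cvgB.
Qed.

(** * The jet of an analytic function along the conjugacy *)

Section JetFamily.
Variables (R : realType) (d : nat).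
Notation vec := 'rV[R]_d.
Variables (f : vec -> R) (beta : R) (H : R -> vec -> vec) (B T : R).
Hypotheses (b0 : 0 < beta) (b1 : beta < 1) (T0 : 0 < T) (B0 : 0 <= B).
Hypothesis HPS : forall i t, 0 < t -> t <= T ->
  PS (fun=> True) (thol beta 1) t (fun p => (H p.1 p.2 - p.2) 0 i) (B * t).
Hypothesis fan : forall c, ranalytic_at f c.
Hypothesis finc : forall x w : vec, tlattice w -> exists2 r, 0 < r &
  forall z, `|z| <= r -> f (x + w + z) - f (x + w) = f (x + z) - f x.

Lemma H_shift e x w : `|e| <= T -> tlattice w -> H e (x + w) = H e x + w.
Proof.
move=> eT lw; suff E : H e (x + w) - (x + w) = H e x - x.
  by rewrite -(subrK (x + w) (H e (x + w))) E; apply/rowP => i; rewrite !mxE; ring.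
by apply/rowP => i; exact: (PS_cong b0 (HPS i T0 (lexx _)) eT (tcongDr x lw)).
Qed.

(** The single number [e] bounds the neighbourhood of [c] and the range of [eps], and its inverse
    bounds the growth of the coefficients, so that shrinking it preserves the property. The exponent
    [n.+1] absorbs multiplicative constants. *)
Definition jetfam (e : R) (c : vec) (Q : 'I_d -> nat -> vec -> R) : Prop :=
  [/\ forall k n x, `|x - c| < e -> `|Q k n x| <= e^-1 ^+ n.+1,
   forall k n x y, `|x - c| < e -> `|y - c| < e ->
     `|Q k n x - Q k n y| <= e^-1 ^+ n.+1 * `|x - y| `^ beta &
   forall eps x, `|eps| < e -> `|x - c| < e -> exists2 q, jet f (H eps x) q &
     forall k, series (fun n => eps ^+ n * Q k n x) @ \oo --> q k].

Lemma jetfam_loc c : exists2 e, 0 < e & exists Q, jetfam e c Q.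
Proof.
have [a [r [M [r0 aM Hf]]]] := analytic_bound (fan c).
(* The four pieces of the argument share r/2 equally: x - c has norm at most lam + eta, H_eps x - x
   at most 2 B t, and [z] at most rho (d + 1). Besides, lam <= 1/2 gives |x - y| <= 1, hence |x - y|
   <= |x - y|^beta, and eta (d + 1) <= 1 absorbs the ratio of [tdist] to the sup norm. *)
pose lam := Num.min (1 / 2) (r / 8).
pose eta := Num.min (d.+1%:R^-1) (r / 8).
pose rho := r / (8 * d.+1%:R).
pose t := Num.min T (r / (16 * (B + 1))).
have d0 : 0 < d.+1%:R :> R by [].
have lam0 : 0 < lam by rewrite lt_min !divr_gt0.
have eta0 : 0 < eta by rewrite lt_min invr_gt0 !divr_gt0 // andbT.
have rho0 : 0 < rho by rewrite divr_gt0 // mulr_gt0.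
have t0 : 0 < t by rewrite lt_min T0 divr_gt0 // mulr_gt0 // ltr_wpDl.
have tT : t <= T by rewrite ge_min lexx.
have tr : t <= r / (16 * (B + 1)) by rewrite ge_min lexx orbT.
have lam2 : lam <= 1 / 2 by rewrite ge_min lexx.
have lamr : lam <= r / 8 by rewrite ge_min lexx orbT.
have etar : eta <= r / 8 by rewrite ge_min lexx orbT.
have etad : eta * d.+1%:R <= 1 by rewrite -ler_pdivlMr // div1r ge_min lexx.
clearbody lam eta t.
pose D (x : vec) := `|x - c| < lam.
pose w (x y : vec) := `|x - y| `^ beta / eta.
have w0 x y : 0 <= w x y by rewrite divr_ge0 ?powR_ge0 // ltW.
have Nh := hol_nlike D w0.
have Np := PS_nlike Nh t0.
have Nj := J_nlike d Np rho0.
have cx i : hol D w (fun x => (x - c) 0 i) (lam + eta).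
  apply: hol_intro => //; rewrite ?ltW //.
    by move=> x Dx; apply: le_trans (rV_coord_le _ _) (ltW Dx).
  move=> x y Dx Dy; rewrite /w mulrCA divff ?lt0r_neq0 // mulr1.
  have -> : (x - c) 0 i - (y - c) 0 i = (x - y) 0 i by rewrite !mxE; ring.
  apply: le_trans (rV_coord_le _ _) _.
  have [->|xy] := eqVneq `|x - y| 0; first exact: powR_ge0.
  apply: ger1_powR; last exact: ltW.
  rewrite lt_neqAle eq_sym xy normr_ge0 /=.
  have -> : x - y = (x - c) - (y - c) by rewrite opprB addrA subrK.
  by apply: le_trans (ler_normB _ _) _; move: Dx Dy; rewrite /D; lra.
have locN g m : thol beta 1 g m -> hol D w g (2 * m).
  move=> Hg; have [m0 gm _] := Hg.
  have -> : 2 * m = m + m by ring.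
  apply: hol_intro => //; first by move=> z _; exact: gm.
  move=> x y _ _.
  apply: le_trans (hol_mod (fun x y => tw_ge0 beta x y ltr01) Hg (x := x) (y := y) I I) _.
  rewrite ler_wpM2l // /tw divr1 /w ler_pdivlMr //.
  apply: (@le_trans _ _ ((d.+1%:R * `|x - y|) `^ beta * eta)).
    rewrite ler_pM2r //; apply: ge0_ler_powR; [exact: ltW|by rewrite nnegrE tdist_ge0|by rewrite nnegrE mulr_ge0|].
    by apply: le_trans (tdist_le_norm _ _) _; rewrite ler_wpM2r // ler_nat.
  rewrite powRM // mulrAC ler_piMl ?powR_ge0 //.
  apply: le_trans etad; rewrite mulrC ler_pM2l //.
  by apply: ler1_powR; rewrite ?ler1n // ltW.
have hx i : PS D (hol D w) t (fun p => (H p.1 p.2 - p.2) 0 i) (2 * (B * t)).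
  exact: (PS_op_id (ler0n R 2) (fun _ _ => I) locN (HPS i t0 tT)).
pose F (p : (R * vec) * vec) : R := f (H p.1.1 p.1.2 + p.2).
pose Y (p : (R * vec) * vec) : vec := H p.1.1 p.1.2 + p.2 - c.
have rho1 : rho * d.+1%:R = r / 8 by rewrite /rho; field; rewrite lt0r_neq0.
have Bt : 2 * (B * t) <= r / 8.
  move: tr; rewrite ler_pdivlMr; last by rewrite mulr_gt0 // ltr_wpDl.
  lra.
have NY i : J (PSdom D t) (PS D (hol D w) t) rho (fun p => Y p 0 i) (r / 2).
  have h1 := J_cst d Np rho (nl_add Np (PS_lift Nh t (cx i)) (hx i)).
  have h2 := nl_add Nj h1 (J_coord Np i rho0).
  have h3 : J (PSdom D t) (PS D (hol D w) t) rho (fun p => Y p 0 i) (lam + eta + 2 * (B * t) + rho * d.+1%:R).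
    by move: h2; congr J; apply: funext => p; rewrite /Y !mxE /=; ring.
  by apply: (nl_le Nj h3); rewrite rho1; lra.
have NF : J (PSdom D t) (PS D (hol D w) t) rho F M.
  apply: (nl_analytic Nj (y := Y) (a := a) (r := r) _ aM).
    by move=> i; apply: (nl_le Nj (NY i)); lra.
  move=> p Dp; apply: Hf => i; apply: le_lt_trans (nl_bnd Nj (NY i) Dp) _; lra.
have [p [q [A [b [C [_ Nq [bb C0] _ jF]]]]]] := NF.
have /choice[Q HQ] k : exists c : nat -> vec -> R, exists mc : nat -> R,
    [/\ forall n, hol D w (c n) (mc n), forall n, series (fun k => t ^+ k * mc k) n <= b &
     forall e x, `|e| <= t -> D x -> series (fun n => e ^+ n * c n x) @ \oo --> q k (e, x)].
  exact: Nq.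
have Qb k n : hol D w (Q k n) (b / t ^+ n).
  have [mc [Nc mcb _]] := HQ k; apply: (nl_le Nh (Nc n)).
  rewrite ler_pdivlMr ?exprn_gt0 // mulrC; apply: le_trans (mcb n.+1).
  rewrite seriesSr lerDr; apply: series_ge0 => j.
  by rewrite mulr_ge0 ?exprn_ge0 ?(nl_ge0 Nh (Nc j)) // ltW.
have e1 : 0 < (b + 1)^-1 by rewrite invr_gt0; lra.
have e2 : 0 < eta / (b + 1) by rewrite divr_gt0 //; lra.
(* The last two entries give b <= 1/e and b / eta <= 1/e, so that b / t^n is turned into e^-(n+1)
   both for the values and for the Hoelder constants. *)
pose e := Num.min (Num.min t lam) (Num.min (b + 1)^-1 (eta / (b + 1))).
have e0 : 0 < e by rewrite !lt_min t0 lam0 e1.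
have et : e <= t by rewrite !ge_min lexx.
have el : e <= lam by rewrite !ge_min lexx !orbT.
have eb : b + 1 <= e^-1.
  rewrite -[b + 1]invrK lef_pV2 ?posrE // !ge_min lexx !orbT //.
have eb2 : (b + 1) / eta <= e^-1.
  by rewrite -[(b + 1) / eta]invrK invf_div lef_pV2 ?posrE // !ge_min lexx !orbT.
have tn n : (t ^+ n)^-1 <= e^-1 ^+ n.
  rewrite -exprVn lerXn2r ?nnegrE ?invr_ge0 ?(ltW t0) ?(ltW e0) //.
  by rewrite lef_pV2 ?posrE.
have tn0 n : 0 <= (t ^+ n)^-1 by rewrite invr_ge0 exprn_ge0 // ltW.
exists e => //; exists Q; split.
- move=> k n x xe; have [_ Qx _] := Qb k n.
  apply: le_trans (Qx x (lt_le_trans xe el)) _.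
  rewrite exprS; apply: ler_pM => //; lra.
- move=> k n x y xe ye.
  apply: le_trans (hol_mod w0 (Qb k n) (lt_le_trans xe el) (lt_le_trans ye el)) _.
  rewrite /w mulrCA mulrC; apply: ler_wpM2r; first exact: powR_ge0.
  rewrite mulrAC exprS; apply: ler_pM => //; first by rewrite divr_ge0 // ltW.
  by apply: le_trans eb2; rewrite ler_wpM2r ?invr_ge0 ?ltW //; lra.
- move=> eps x epse xe.
  have Dx : D x by exact: lt_le_trans el.
  have et' : `|eps| <= t by rewrite ltW // (lt_le_trans epse).
  exists (fun k => q k (eps, x)); last first.
    by move=> k; case: (HQ k) => mc [_ _]; apply.
  (* At z = 0 the remainder vanishes, which identifies the constant term of the jet with the value
     of [f]. *)
  have fp : f (H eps x) = p (eps, x).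
    have := jF (eps, x) 0 (conj et' Dx); rewrite normr0 mul0r expr0n mulr0 /F /= addr0.
    rewrite big1 ?subr0; last by move=> k _; rewrite mxE mul0r.
    by move=> /(_ (ltW rho0)); rewrite normr_le0 subr_eq0 => /eqP.
  exists (C / rho ^+ 2), rho; split => // z zrho.
  have := jF (eps, x) z (conj et' Dx) zrho; rewrite /F /= fp.
  by move=> h; apply: le_trans h _; rewrite exprMn exprVn mulrA mulrAC.
Qed.

Lemma jetfam_mono e c Q e' c' : 0 < e' -> e' <= e -> `|c' - c| + e' <= e ->
  jetfam e c Q -> jetfam e' c' Q.
Proof.
move=> e0' ee' cc [Q1 Q2 Q3].
have ball x : `|x - c'| < e' -> `|x - c| < e.
  move=> xc; apply: lt_le_trans cc.
  have -> : x - c = (x - c') + (c' - c) by rewrite addrA subrK.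
  by apply: le_lt_trans (ler_normD _ _) _; rewrite [ltLHS]addrC ltrD2l.
have K n : e^-1 ^+ n.+1 <= e'^-1 ^+ n.+1.
  have e0 : 0 < e by exact: lt_le_trans ee'.
  by rewrite lerXn2r ?nnegrE ?invr_ge0 ?(ltW e0) ?(ltW e0') // lef_pV2 ?posrE.
split.
- by move=> k n x /ball xe; apply: le_trans (Q1 k n x xe) _.
- move=> k n x y /ball xe /ball ye; apply: le_trans (Q2 k n x y xe ye) _.
  by rewrite ler_wpM2r // powR_ge0.
- by move=> eps x epse /ball xe; apply: Q3 => //; exact: lt_le_trans ee'.
Qed.

Lemma jet_H_shift eps x w q : `|eps| <= T -> tlattice w ->
  jet f (H eps x) q -> jet f (H eps (x + w)) q.
Proof.
move=> epsT lw; apply: jet_shift; have [r r0 Hr] := finc (H eps x) lw.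
by exists r => // z zr; rewrite H_shift //; exact: Hr.
Qed.

Lemma jetfam_shift e c w Q : e <= T -> tlattice w -> jetfam e c Q ->
  jetfam e (c + w) (fun k n x => Q k n (x - w)).
Proof.
move=> eT lw [Q1 Q2 Q3].
have ball x : `|x - (c + w)| < e -> `|x - w - c| < e by rewrite opprD addrA addrAC.
split.
- by move=> k n x /ball; exact: Q1.
- move=> k n x y /ball xe /ball ye; have := Q2 k n _ _ xe ye.
  by have -> : x - w - (y - w) = x - y by apply/rowP => i; rewrite !mxE; ring.
- move=> eps x epse /ball xe; have [q jq Hq] := Q3 eps (x - w) epse xe.
  exists q => //; rewrite -(subrK w x); apply: jet_H_shift => //.
  by rewrite ltW // (lt_le_trans epse).
Qed.

(** The jets determine the sums, and the sums determine the coefficients. Allowing two points [x]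
    and [y] covers both overlapping neighbourhoods (y = x) and lattice translates (y = x + w). *)
Lemma jetfam_unique e c c' Q Q' x y k : 0 < e -> jetfam e c Q -> jetfam e c' Q' ->
  `|x - c| < e -> `|y - c'| < e ->
  (forall eps q, `|eps| < e -> jet f (H eps x) q -> jet f (H eps y) q) ->
  Q k ^~ x = Q' k ^~ y.
Proof.
move=> e0 [Q1 _ Q3] [Q1' _ Q3'] xc yc xy.
apply: (powser_unique (K := e^-1) e0); rewrite ?invr_gt0 //.
- by move=> n; exact: Q1.
- by move=> n; exact: Q1'.
- move=> eps epse; have [q jq Hq] := Q3 eps x epse xc.
  have [q' jq' Hq'] := Q3' eps y epse yc.
  by exists (q k); rewrite // (jet_unique (xy _ _ epse jq) jq').
Qed.

Lemma jet_global : exists t M (G : 'I_d -> R * vec -> R), [/\ 0 < t, t <= T,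
  forall k, PS (fun=> True) (thol beta 1) t (G k) M &
  forall eps x, `|eps| <= t -> jet f (H eps x) (G ^~ (eps, x))].
Proof.
have [e e0 He] : exists2 e, 0 < e & forall c, e <= T /\ exists Q, jetfam e c Q.
  apply: (torus_uniform (P := fun e c => e <= T /\ exists Q, jetfam e c Q)).
    move=> e c w lw [eT [Q HQ]]; split => //.
    by exists (fun k n x => Q k n (x - w)); exact: jetfam_shift.
  move=> c; have [e e0 [Q HQ]] := jetfam_loc c.
  exists (Num.min (e / 2) T); first by rewrite lt_min divr_gt0.
  move=> x e'; rewrite !lt_min => /andP[xc _] e0' /andP[ee' eT']; split; first exact: ltW.
  exists Q; apply: jetfam_mono HQ => //; lra.
have eT : e <= T by case: (He 0).
have /choice[Qc HQ] c : exists Q, jetfam e c Q by case: (He c).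
(* The family centred at [x] is read off at [x] itself; by uniqueness any other admissible centre
   gives the same value, so local Hoelder bounds and periodicity carry over. *)
pose Q k n x := Qc x k n x.
have xx (x : vec) : `|x - x| < e by rewrite subrr normr0.
have QE (c x : vec) k : `|x - c| < e -> Qc x k ^~ x = Qc c k ^~ x.
  move=> xc; apply: (jetfam_unique k e0 (HQ x) (HQ c) (xx x) xc) => //.
have Qper k n x w : tlattice w -> Q k n (x + w) = Q k n x.
  move=> lw; suff : Qc x k ^~ x = Qc (x + w) k ^~ (x + w) by move=> /(congr1 (fun u => u n)).
  apply: (jetfam_unique k e0 (HQ x) (HQ (x + w))) => // eps q epse.
  by apply: jet_H_shift => //; rewrite ltW // (lt_le_trans epse).
have en n : 0 <= e^-1 ^+ n.+1 by rewrite exprn_ge0 // invr_ge0 ltW.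
have Qb k n x : `|Q k n x| <= e^-1 ^+ n.+1.
  by have [Q1 _ _] := HQ x; exact: Q1.
have Qh k n x y : `|x - y| < e -> `|Q k n x - Q k n y| <= e^-1 ^+ n.+1 * `|x - y| `^ beta.
  move=> xy; have [_ Q2 _] := HQ y.
  by have /(congr1 (fun u => u n)) /= := QE y x k xy; rewrite /Q => ->; exact: Q2.
(* The part 2 / e^beta serves points at distance at least [e], through the sup bound. The part 2
   serves near points: the infimum in [tdist] is approached within a factor 2, and 2^beta <= 2. *)
pose Cc := 2 + 2 / e `^ beta.
have eb0 : 0 < e `^ beta by rewrite powR_gt0.
have Cc0 : 0 <= Cc by rewrite addr_ge0 // divr_ge0 // ltW.
have Qt k n : thol beta 1 (Q k n) ((1 + Cc) * e^-1 ^+ n.+1).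
  rewrite mulrDl mul1r; apply: hol_intro => //.
  - by move=> x y; exact: tw_ge0.
  - exact: mulr_ge0.
  - move=> x y _ _; rewrite /tw divr1.
    have t0 := tdist_ge0 x y.
    have tb0 := powR_ge0 (tdist x y) beta.
    have [te|te] := ltP (tdist x y) e; last first.
      apply: (@le_trans _ _ (e^-1 ^+ n.+1 + e^-1 ^+ n.+1)).
        by apply: le_trans (ler_normB _ _) _; apply: lerD.
      rewrite mulrAC mulrC; have -> : e^-1 ^+ n.+1 + e^-1 ^+ n.+1 = e^-1 ^+ n.+1 * 2 by ring.
      apply: ler_wpM2l => //.
      have h : e `^ beta <= tdist x y `^ beta.
        by apply: ge0_ler_powR; rewrite ?nnegrE //; exact: ltW.
      apply: (@le_trans _ _ (2 / e `^ beta * tdist x y `^ beta)).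
        by rewrite mulrAC ler_pdivlMr // ler_pM2l.
      by apply: ler_wpM2r => //; rewrite lerDr.
    have [t00|tn0] := eqVneq (tdist x y) 0.
      have -> : Q k n x = Q k n y.
        have cxy := tdist0_cong t00.
        by rewrite -(subrK y x) addrC Qper.
      by rewrite subrr normr0 !mulr_ge0.
    have tp : 0 < tdist x y by rewrite lt_neqAle eq_sym tn0.
    have : tdist x y < Num.min e (2 * tdist x y) by rewrite lt_min te; lra.
    move=> /tdist_near [w lw]; rewrite lt_min => /andP[we w2].
    have nw := norm_le_tenorm (x - y - w).
    have xyw : `|x - (y + w)| < e by rewrite opprD addrA; exact: le_lt_trans we.
    rewrite -(Qper k n y w lw); apply: le_trans (Qh k n _ _ xyw) _.
    rewrite mulrAC mulrC; apply: ler_wpM2r => //.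
    apply: (@le_trans _ _ ((2 * tdist x y) `^ beta)).
      apply: ge0_ler_powR; rewrite ?nnegrE ?mulr_ge0 //; first exact: ltW.
      by rewrite opprD addrA; apply: le_trans nw (ltW w2).
    rewrite powRM //; apply: ler_wpM2r => //.
    apply: (@le_trans _ _ 2); last by rewrite lerDl divr_ge0 // ltW.
    by apply: ler1_powR; rewrite ?ler1n // ltW.
pose t := e / 2.
have t0 : 0 < t by rewrite divr_gt0.
have te : t < e by rewrite /t; lra.
have jG eps x : `|eps| <= t -> exists2 q, jet f (H eps x) q &
    forall k, series (fun n => eps ^+ n * Q k n x) @ \oo --> q k.
  by move=> epst; have [_ _ Q3] := HQ x; apply: Q3 => //; exact: le_lt_trans te.
pose G k (p : R * vec) := limn (series (fun n => p.1 ^+ n * Q k n p.2)).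
exists t, ((1 + Cc) * (2 / e)), G; split => //; first by rewrite (le_trans (ltW te)).
- move=> k; exists (Q k), (fun n => (1 + Cc) * e^-1 ^+ n.+1); split => //.
    move=> n.
    have -> : series (fun k0 => t ^+ k0 * ((1 + Cc) * e^-1 ^+ k0.+1)) n =
        (1 + Cc) * (e^-1 * series (fun k => (1 / 2) ^+ k) n).
      rewrite /series /= !mulr_sumr; apply: eq_bigr => i _.
      rewrite exprS mulrCA; congr (_ * _); rewrite mulrCA -exprMn; congr (_ * _ ^+ _).
      by rewrite /t; field; rewrite lt0r_neq0.
    rewrite geo_series; last by apply/eqP; lra.
    apply: ler_wpM2l; first by rewrite addr_ge0.
    rewrite mulrC; apply: ler_wpM2r; first by rewrite invr_ge0 ltW.
    have -> : (1 - (1 / 2) ^+ n) / (1 - 1 / 2) = 2 * (1 - (1 / 2) ^+ n) :> R by field.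
    by rewrite ler_piMr // gerBl exprn_ge0 // divr_ge0.
  move=> eps x epst _; have [q _ Hq] := jG eps x epst.
  by have /cvgP := Hq k.
- move=> eps x epst; have [q jq Hq] := jG eps x epst.
  suff -> : G ^~ (eps, x) = q by [].
  by apply: funext => k; apply: cvg_lim; [exact: norm_hausdorff|exact: Hq].
Qed.

End JetFamily.

(** * Linear and nonlinear fixed points *)

Section Neumann.
Variables (R : realType) (X : Type) (D : X -> Prop) (N : (X -> R) -> R -> Prop).
Hypothesis Nl : nlike D N.
Variables (s : X -> R) (C : X -> X) (K th : R) (n : nat).
Hypotheses (DC : forall x, D x -> D (C x)) (K0 : 0 <= K) (n0 : (0 < n)%N)
  (th0 : 0 <= th) (th1 : th < 1).

Definition wcomp (f : X -> R) : X -> R := fun x => s x * f (C x).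

Hypothesis Nw : forall f m, N f m -> N (wcomp f) (K * m).
Hypothesis Nwn : forall f m, N f m -> N (iter n wcomp f) (th * m).

(** The inverse of [id - wcomp], that is, the solution [u] of u = f + s (u o C). Only the [n]-th
    iterate of [wcomp] has to contract. *)
Definition neumann (f : X -> R) (x : X) : R := limn (series (fun k => iter k wcomp f x)).

(** The bound for the [k]-th iterate: complete blocks of length [n] contract by [th], and the
    remaining steps cost at most [K] each. *)
Let kap k := K ^+ (k %% n) * th ^+ (k %/ n).

Lemma N_iter_wcomp f m k : N f m -> N (iter k wcomp f) (kap k * m).
Proof.
move=> Nf.
have Nq q : N (iter (q * n) wcomp f) (th ^+ q * m).
  elim: q => [|q IH]; first by rewrite mul1r.
  by rewrite mulSn iterD exprS -mulrA; exact: Nwn.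
have Nr g m' r : N g m' -> N (iter r wcomp g) (K ^+ r * m').
  move=> Ng; elim: r => [|r IH]; first by rewrite mul1r.
  by rewrite exprS -mulrA; exact: Nw.
by rewrite {1}(divn_eq k n) addnC iterD /kap -mulrA; exact: Nr.
Qed.

Let kap0 k : 0 <= kap k. Proof. by rewrite mulr_ge0 // exprn_ge0. Qed.

Let A := series kap n / (1 - th).

Lemma neumann_cst_ge0 : 0 <= A.
Proof. by rewrite divr_ge0 ?series_ge0 // subr_ge0 ltW. Qed.

(** Since kap (k + n) = th kap k, the constant satisfies A = series kap n + th A, and induction by
    steps of [n] closes. *)
Let kapA k : series kap k <= A.
Proof.
elim/ltn_ind: k => k IH; case: (leqP k n) => [kn|nk].
  apply: le_trans (series_homo kap0 kn) _.
  rewrite /A ler_pdivlMr ?subr_gt0 // ler_piMr ?series_ge0 //.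
  by rewrite gerBl.
have -> : k = ((k - n) + n)%N by rewrite subnK // ltnW.
have -> : series kap (k - n + n)%N = series kap n + th * series kap (k - n)%N.
  rewrite series_addn; congr (_ + _); rewrite -{1}[n]add0n big_addn addnK.
  rewrite /series /= mulr_sumr; apply: eq_bigr => i _.
  by rewrite /kap modnDr divnDr // divnn n0 addn1 exprS; ring.
have th1' : 1 - th != 0 by rewrite subr_eq0 eq_sym lt_eqF.
have -> : A = series kap n + th * A by rewrite /A; field.
rewrite lerD2l ler_wpM2l //; apply: IH.
by rewrite ltn_subrL n0 (leq_trans _ nk).
Qed.

Lemma neumann_cvg f m x : N f m -> D x -> cvgn (series (fun k => iter k wcomp f x)).
Proof.
move=> Nf Dx; have m0 := nl_ge0 Nl Nf.
apply: (dom_series_cvg (m := fun k => kap k * m) (M := A * m)) => k.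
  by apply: (nl_bnd Nl) Dx; exact: N_iter_wcomp.
by rewrite /series /= -mulr_suml; apply: ler_wpM2r => //; exact: kapA.
Qed.

Lemma N_neumann f m : N f m -> N (neumann f) (A * m).
Proof.
move=> Nf; have m0 := nl_ge0 Nl Nf.
apply: (nl_sum Nl (f := fun k => iter k wcomp f) (m := fun k => kap k * m)) => [k|k|x Dx].
- exact: N_iter_wcomp.
- by rewrite /series /= -mulr_suml; apply: ler_wpM2r => //; exact: kapA.
- exact: neumann_cvg Nf Dx.
Qed.

Lemma neumannE f m x : N f m -> D x -> neumann f x = f x + s x * neumann f (C x).
Proof.
move=> Nf Dx.
have c1 := neumann_cvg Nf Dx; have c2 := neumann_cvg Nf (DC Dx).
apply: (cvgn_unique c1); rewrite -(cvg_shiftS (series _)).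
have -> : [sequence series (fun k => iter k wcomp f x) k.+1]_k =
    (fun k => f x + s x * series (fun k => iter k wcomp f (C x)) k).
  apply: funext => k /=; rewrite /series /= big_nat_recl //= mulr_sumr.
  by [].
apply: cvgD; first exact: cvg_cst.
by apply: cvgM; [exact: cvg_cst|exact: c2].
Qed.

Lemma neumannB f g m m' x : N f m -> N g m' -> D x ->
  neumann (fun y => f y - g y) x = neumann f x - neumann g x.
Proof.
move=> Nf Ng Dx; apply: cvg_lim; first exact: norm_hausdorff.
have E k : iter k wcomp (fun y => f y - g y) = (fun y => iter k wcomp f y - iter k wcomp g y).
  elim: k => [//|k /= ->]; rewrite /wcomp; apply: funext => y; exact: mulrBr.
have -> : series (fun k => iter k wcomp (fun y => f y - g y) x) =
  (fun K => series (fun k => iter k wcomp f x) K - series (fun k => iter k wcomp g x) K).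
  by apply: funext => j; rewrite /series /= -sumrB; apply: eq_bigr => k _; rewrite E.
by apply: cvgB; [exact: neumann_cvg Nf Dx|exact: neumann_cvg Ng Dx].
Qed.

End Neumann.

Lemma half_series (R : realType) (m0 : R) n :
  series (fun k => m0 / 2 ^+ k) n = m0 * (2 - 2 / 2 ^+ n).
Proof.
elim: n => [|n IH]; first by rewrite seriesE0 expr0 divr1 subrr mulr0.
by rewrite seriesSr IH exprS; field; rewrite expf_neq0.
Qed.

Lemma half_cvg0 (R : realType) (m0 : R) : (fun k => m0 / 2 ^+ k : R) @ \oo --> (0 : R).
Proof.
rewrite -[X in _ --> X](mulr0 m0); apply: cvgM; first exact: cvg_cst.
have -> : (fun k => (2 ^+ k : R)^-1) = (fun k => (2^-1) ^+ k : R).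
  by apply: funext => k; rewrite exprVn.
apply: cvg_expr; rewrite ger0_norm ?invr_ge0 //; lra.
Qed.

Section Banach.
Variables (R : realType) (X I : Type) (D : X -> Prop) (N : (X -> R) -> R -> Prop).
Hypothesis Nl : nlike D N.
Variables (Phi : (I -> X -> R) -> I -> X -> R) (m0 : R).
Hypothesis m00 : 0 <= m0.
Hypothesis Phi0 : forall i, N (Phi (fun _ _ => 0) i) m0.
Hypothesis PhiC : forall w w' dl,
  (forall i, N (w i) (2 * m0)) -> (forall i, N (w' i) (2 * m0)) ->
  (forall i, N (fun x => w i x - w' i x) dl) ->
  forall i, N (fun x => Phi w i x - Phi w' i x) (dl / 2).

(** Picard iteration from 0. The radii m0 (2 - 2 / 2^k) are the partial sums of m0 / 2^j, so the
    iterates stay in the ball where [PhiC] holds. Completeness is [nl_sum] for the telescoping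
    series of increments. *)
Lemma banach_fix : exists w, (forall i, N (w i) (2 * m0)) /\
  forall i x, D x -> Phi w i x = w i x.
Proof.
pose W k := iter k Phi (fun _ _ => 0).
have p2 k : 0 < 2 ^+ k :> R by rewrite exprn_gt0.
have le2 k : m0 * (2 - 2 / 2 ^+ k) <= 2 * m0.
  by rewrite mulrC ler_wpM2r // gerBl divr_ge0 // ltW.
have [WA WB] : (forall k i, N (W k i) (m0 * (2 - 2 / 2 ^+ k))) /\
    (forall k i, N (fun x => W k.+1 i x - W k i x) (m0 / 2 ^+ k)).
  suff H k : (forall i, N (W k i) (m0 * (2 - 2 / 2 ^+ k))) /\
    (forall i, N (fun x => W k.+1 i x - W k i x) (m0 / 2 ^+ k)).
    by split=> k i; case: (H k).
  have step j : (forall i, N (W j i) (m0 * (2 - 2 / 2 ^+ j))) ->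
      (forall i, N (fun x => W j.+1 i x - W j i x) (m0 / 2 ^+ j)) ->
      forall i, N (W j.+1 i) (m0 * (2 - 2 / 2 ^+ j.+1)).
    move=> HA HB i.
    have -> : m0 * (2 - 2 / 2 ^+ j.+1) = m0 * (2 - 2 / 2 ^+ j) + m0 / 2 ^+ j.
      by rewrite exprS; field; rewrite lt0r_neq0.
    have := nl_add Nl (HA i) (HB i); congr N; apply: funext => x; ring.
  elim: k => [|k [HA HB]].
    split=> i; first by rewrite expr0 divr1 subrr mulr0; exact: (nl_zero Nl).
    by rewrite expr0 divr1; have := Phi0 i; congr N; apply: funext => x; rewrite subr0.
  have HA' := step k HA HB; split => // i.
  have -> : m0 / 2 ^+ k.+1 = (m0 / 2 ^+ k) / 2 by rewrite exprS; field; rewrite lt0r_neq0.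
  apply: PhiC => // j; first exact: (nl_le Nl (HA' j)).
  exact: (nl_le Nl (HA j)).
have tel i x n k : series (fun j => W (k + j).+1 i x - W (k + j)%N i x) n = W (k + n)%N i x - W k i x.
  elim: n => [|n IH]; first by rewrite seriesE0 addn0 subrr.
  by rewrite seriesSr IH addnS; ring.
have hs n : series (fun k => m0 / 2 ^+ k) n <= 2 * m0 by rewrite half_series.
have Wc i x : D x -> cvgn (fun n => W n i x).
  move=> Dx.
  have : cvgn (series (fun j => W (0 + j).+1 i x - W (0 + j)%N i x)).
    by apply: (dom_series_cvg (m := fun k => m0 / 2 ^+ k) _ hs) => k; apply: (nl_bnd Nl (WB k i)).
  have -> : series (fun j => W (0 + j).+1 i x - W (0 + j)%N i x) = (fun n => W n i x).
    by apply: funext => n; rewrite tel add0n subr0.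
  by [].
pose w i x := limn (fun n => W n i x).
have Nw i : N (w i) (2 * m0).
  apply: (nl_sum Nl (f := fun k x => W k.+1 i x - W k i x) (m := fun k => m0 / 2 ^+ k)) => // x Dx.
  have -> : series (fun k => W k.+1 i x - W k i x) = (fun n => W n i x).
    by apply: funext => n; rewrite (tel i x n 0%N) add0n subr0.
  exact: Wc.
have Nd k i : N (fun x => w i x - W k i x) (2 * m0 / 2 ^+ k).
  apply: (nl_sum Nl (f := fun j x => W (k + j).+1 i x - W (k + j)%N i x)
     (m := fun j => m0 / 2 ^+ (k + j))) => // [n|x Dx].
    have -> : series (fun j => m0 / 2 ^+ (k + j)) n = series (fun j => m0 / 2 ^+ j) n / 2 ^+ k.
      rewrite /series /= mulr_suml; apply: eq_bigr => j _.
      by rewrite exprD invfM; ring.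
    by apply: ler_wpM2r; rewrite ?invr_ge0 ?(ltW (p2 k)).
  have -> : series (fun j => W (k + j).+1 i x - W (k + j)%N i x) = (fun n => W (n + k)%N i x - W k i x).
    by apply: funext => n; rewrite tel addnC.
  apply: cvgB; last exact: cvg_cst.
  by rewrite (cvg_shiftn k (fun n => W n i x)); exact: Wc.
exists w; split => // i x Dx.
have c1 : (fun k => W k.+1 i x) @ \oo --> w i x.
  by rewrite (cvg_shiftS (fun k => W k i x)); exact: Wc.
apply/esym; apply: (cvgn_unique c1).
apply/subr_cvg0.
have H k : `|W k.+1 i x - Phi w i x| <= m0 / 2 ^+ k.
  have -> : m0 / 2 ^+ k = (2 * m0 / 2 ^+ k) / 2 by field; rewrite lt0r_neq0.
  rewrite distrC.
  apply: (nl_bnd Nl (PhiC Nw (fun i => nl_le Nl (WA k i) (le2 k)) (Nd k) i) Dx).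
apply: norm_cvg0; apply: (squeeze_cvgr (f := fun=> 0) (h := fun k => m0 / 2 ^+ k)).
- by near=> k; rewrite normr_ge0 H.
- exact: cvg_cst.
- exact: half_cvg0.
Unshelve. all: by end_near. Qed.

End Banach.

Section PSMore.
Variables (R : realType) (X : Type) (D : X -> Prop) (N : (X -> R) -> R -> Prop).
Hypothesis Nl : nlike D N.

Lemma PS_mono t t' g m : 0 <= t' -> t' <= t -> PS D N t g m -> PS D N t' g m.
Proof.
move=> t0 tt [c [mc [Nc Hm Hc]]]; exists c, mc; split => //.
  move=> n; apply: le_trans (Hm n); apply: ler_sum => k _.
  apply: ler_wpM2r; first exact: (nl_ge0 Nl (Nc k)).
  by apply: lerXn2r => //; rewrite nnegrE (le_trans t0).
by move=> e x et; apply: Hc; exact: le_trans tt.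
Qed.

Lemma PS_eps t : 0 <= t -> PS D N t (fun p => p.1) t.
Proof.
move=> t0; exists (fun n => if n == 1%N then (fun=> 1) else (fun=> 0)), (fun n => (n == 1%N)%:R).
have S (u : nat -> R) n : (forall k, k != 1%N -> u k = 0) -> series u n.+2 = u 1%N.
  move=> u0; elim: n => [|n IH]; first by rewrite !seriesSr seriesE0 u0 // !add0r.
  by rewrite seriesSr IH (u0 n.+2) // addr0.
split.
- move=> n; case: ifP => _ /=; last exact: (nl_zero Nl).
  by have := nl_cst Nl 1; rewrite normr1.
- move=> [|[|n]].
  + by rewrite seriesE0.
  + by rewrite seriesSr seriesE0 /= mulr0 add0r.
  + by rewrite S //= ?mulr1 // => k /negbTE ->; rewrite mulr0.
- move=> e x et Dx; apply: cvg_near_cst; exists 2%N => // -[//|[//|n]] _ /=.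
  by rewrite S //= ?mulr1 // => k /negbTE ->; rewrite mulr0.
Qed.

(** The constant coefficient vanishes, so the coefficients can be shifted, at the cost 1/t. This
    produces the factor [eps] in front of the perturbation of the cocycle. *)
Lemma PS_divide t g m : 0 < t -> PS D N t g m -> (forall x, D x -> g (0, x) = 0) ->
  exists2 g', PS D N t g' (m / t) &
    forall e x, `|e| <= t -> D x -> g (e, x) = e * g' (e, x).
Proof.
move=> t0 [c [mc [Nc Hm Hc]]] g0.
have bnd n : series (fun k => t ^+ k * mc k.+1) n <= m / t.
  rewrite ler_pdivlMr //; apply: le_trans (Hm n.+1).
  rewrite /series /= big_nat_recl //= expr0 mul1r mulr_suml.
  rewrite -[leLHS]add0r; apply: lerD; first exact: (nl_ge0 Nl (Nc 0%N)).
  by apply: ler_sum => k _; rewrite exprSr mulrAC.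
have c0 x : D x -> c 0%N x = 0.
  move=> Dx; rewrite -(g0 x Dx).
  have H0 : `|0 : R| <= t by rewrite normr0 ltW.
  apply: (cvgn_unique _ (Hc 0 x H0 Dx)).
  apply: cvg_near_cst; exists 1%N => // -[//|n] _.
  rewrite /series /= big_nat_recl //= expr0 mul1r big1 ?addr0 // => k _.
  by rewrite expr0n mul0r.
have cv e x : `|e| <= t -> D x -> cvgn (series (fun n => e ^+ n * c n.+1 x)).
  move=> et Dx; apply: (dom_series_cvg (m := fun k => t ^+ k * mc k.+1) _ bnd) => k.
  exact: (PS_term Nl (c := fun n => c n.+1) (mc := fun n => mc n.+1)).
exists (fun p => limn (series (fun n => p.1 ^+ n * c n.+1 p.2))).
  by exists (fun n => c n.+1), (fun n => mc n.+1); split => // e x et Dx; exact: cv.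
move=> e x et Dx; apply/esym.
have := Hc e x et Dx; rewrite -(cvg_shiftS (series _)) => h.
apply: (cvgn_unique _ h).
have -> : [sequence series (fun n => e ^+ n * c n x) k.+1]_k =
   (fun k => e * series (fun n => e ^+ n * c n.+1 x) k).
  apply: funext => k /=; rewrite /series /= big_nat_recl //= c0 // mulr0 add0r mulr_sumr.
  by apply: eq_bigr => j _; rewrite exprS mulrA.
by apply: cvgM; [exact: cvg_cst|exact: cv].
Qed.

End PSMore.

Lemma iter_wcomp (R : realType) (X : Type) (s : X -> R) (C : X -> X) n f x :
  iter n (wcomp s C) f x = (\prod_(k < n) s (iter k C x)) * f (iter n C x).
Proof.
elim: n f x => [|n IH] f x; first by rewrite big_ord0 mul1r.
rewrite iterS /wcomp IH big_ord_recl /= -mulrA -iterSr; congr (_ * (_ * _)).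
by apply: eq_bigr => k _; rewrite -iterSr.
Qed.

(** The smallness of [beta] needed for the linear equation: beta ln K < - ln th. The denominator ln
    K + 1 stays positive when K = 1. *)
Lemma powR_small (R : realType) (th K : R) : 0 <= th -> th < 1 -> 1 <= K ->
  exists2 b, 0 < b & forall beta, 0 < beta -> beta < b -> th * K `^ beta < 1.
Proof.
move=> th0 th1 K1; have [->|thn0] := eqVneq th 0.
  by exists 1 => // beta _ _; rewrite mul0r.
have thp : 0 < th by rewrite lt_neqAle eq_sym thn0.
have lK : 0 <= ln K by rewrite ln_ge0.
have lt : ln th < 0 by rewrite ln_lt0 // thp.
have d0 : 0 < ln K + 1 by lra.
exists (- ln th / (ln K + 1)); first by rewrite divr_gt0 // oppr_gt0.
move=> beta b0; rewrite ltr_pdivlMr // => h.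
have K0 : K != 0 by rewrite lt0r_neq0 // (lt_le_trans _ K1).
rewrite /powR (negbTE K0) -{1}(lnK (x := th)) ?posrE // -expRD -[ltRHS]expR0 ltr_expR.
have : 0 <= beta by exact: ltW.
nra.
Qed.

Lemma weight_small (R : realType) (th B : R) : th < 1 -> 0 <= B ->
  th + B * Num.min 1 ((1 - th) / (2 * (B + 1))) < 1.
Proof.
move=> th1 B0; have B1 : 0 < B + 1 by lra.
set e := Num.min _ _.
have e0 : 0 < e by rewrite lt_min ltr01 divr_gt0 ?subr_gt0 // mulr_gt0.
have : e <= (1 - th) / (2 * (B + 1)) by rewrite ge_min lexx orbT.
by rewrite ler_pdivlMr ?mulr_gt0 //; clearbody e; lra.
Qed.

Lemma comp_aux (R : realType) (a b m k w w' : R) : w' * a + b <= m * w' ->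
  (m - a) * w' <= (m - a) * (k * w) -> a * w <= a * (k * w) -> w * a + b <= k * m * w.
Proof.
move=> h1 h2 h3; apply: (@le_trans _ _ (a * w + (m - a) * w')).
  by rewrite mulrC lerD2l mulrBl lerBrDr addrC [a * _]mulrC.
apply: (@le_trans _ _ (a * (k * w) + (m - a) * (k * w))); first exact: lerD.
by rewrite le_eqVlt; apply/orP; left; apply/eqP; ring.
Qed.

(** * Weighted composition operators on Hoelder functions *)

Section LinearSolver.
Variables (R : realType) (d : nat).
Notation vec := 'rV[R]_d.
Variables (beta : R) (s : vec -> R) (C : vec -> vec) (K : R).
Hypotheses (b0 : 0 < beta) (K1 : 1 <= K).
Hypothesis CL : forall x y, tdist (C x) (C y) <= K * tdist x y.

Let Kb1 : 1 <= K `^ beta.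
Proof.
have E : 1 = 1 `^ beta :> R by rewrite powR1.
by rewrite {1}E; apply: ge0_ler_powR; rewrite ?nnegrE ?(ltW b0) // (le_trans _ K1).
Qed.

Lemma tw_comp eta x y : 0 < eta -> tw beta eta (C x) (C y) <= K `^ beta * tw beta eta x y.
Proof.
move=> e0; have K0 : 0 <= K by rewrite (le_trans _ K1).
rewrite /tw mulrA; apply: ler_wpM2r; first by rewrite invr_ge0 ltW.
rewrite -powRM ?tdist_ge0 //; apply: ge0_ler_powR; rewrite ?nnegrE ?tdist_ge0 ?(ltW b0) //.
by rewrite mulr_ge0 // tdist_ge0.
Qed.

(* The norm bound on the image uses the pointwise gap [th] against the loss
   [K `^ beta] of the Hoelder seminorm; the weight eta absorbs the seminorm of s. *)
Lemma thol_wcomp eta th B f m : 0 < eta -> 0 <= th -> thol beta 1 s B ->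
  (forall x, `|s x| <= th) -> thol beta eta f m ->
  thol beta eta (fun x => s x * f (C x)) (Num.max (th + B * eta) (th * K `^ beta) * m).
Proof.
move=> e0 th0 HB sth [m0 fm Hf].
have [B0 _ _] := HB.
set M := Num.max _ _.
have M1 : th + B * eta <= M by rewrite le_max lexx.
have M2 : th * K `^ beta <= M by rewrite le_max lexx orbT.
have thM : th <= M by apply: le_trans M1; rewrite lerDl mulr_ge0 // ltW.
have M0 : 0 <= M by apply: le_trans thM.
split; first exact: mulr_ge0.
  by move=> z _; rewrite normrM; apply: ler_pM => //; [exact: le_trans (sth z) thM|exact: fm].
move=> x y z _ _ _.
have w0 := tw_ge0 beta x y e0; have w0' := tw_ge0 beta (C x) (C y) e0.
have wK := tw_comp x y e0.
have HBs : `|s x - s y| <= B * eta * tw beta eta x y.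
  have := hol_mod (fun x y => tw_ge0 beta x y ltr01) HB (x := x) (y := y) I I.
  rewrite /tw divr1; suff -> : B * eta * (tdist x y `^ beta / eta) = B * tdist x y `^ beta by [].
  by field; rewrite lt0r_neq0.
move: w0 w0' wK HBs; set w := tw beta eta x y; set w' := tw beta eta (C x) (C y) => w0 w0' wK HBs.
set F := Num.max `|f (C z)| `|f (C y)|.
have HF : w' * F + `|f (C x) - f (C y)| <= m * w'.
  by rewrite /F; case: (leP `|f (C z)| `|f (C y)|) => _; apply: Hf.
have Fm : F <= m by rewrite ge_max !fm.
have [Fz Fy] : `|f (C z)| <= F /\ `|f (C y)| <= F by rewrite !le_max !lexx orbT.
clearbody F w w'.
have F0 : 0 <= F by apply: le_trans Fz.
have h1 : `|f (C x) - f (C y)| <= (m - F) * (K `^ beta * w).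
  apply: (@le_trans _ _ ((m - F) * w')).
    by rewrite mulrBl lerBrDr addrC [F * _]mulrC.
  by apply: ler_wpM2l; rewrite ?subr_ge0.
have h2 : `|s x * f (C x) - s y * f (C y)| <= th * ((m - F) * (K `^ beta * w)) + F * (B * eta * w).
  have -> : s x * f (C x) - s y * f (C y) = s x * (f (C x) - f (C y)) + f (C y) * (s x - s y) by ring.
  apply: le_trans (ler_normD _ _) _; rewrite !normrM.
  by apply: lerD; apply: ler_pM.
have h3 : w * `|s z * f (C z)| <= w * (th * F).
  by apply: ler_wpM2l => //; rewrite normrM; apply: ler_pM.
have mF : 0 <= m - F by rewrite subr_ge0.
have h4 : (m - F) * w * (th * K `^ beta) <= (m - F) * w * M by apply: ler_wpM2l => //; rewrite mulr_ge0.
have h5 : F * w * (th + B * eta) <= F * w * M by apply: ler_wpM2l => //; rewrite mulr_ge0.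
apply: (le_trans (lerD h3 h2)).
apply: (le_trans _ (_ : (m - F) * w * M + F * w * M <= _)).
  apply: le_trans (lerD h4 h5).
  by rewrite le_eqVlt; apply/orP; left; apply/eqP; ring.
by rewrite le_eqVlt; apply/orP; left; apply/eqP; ring.
Qed.

Lemma thol_comp eta f m : 0 < eta -> thol beta eta f m ->
  thol beta eta (f \o C) (K `^ beta * m).
Proof.
move=> e0 [m0 fm Hf]; split; first by rewrite mulr_ge0 // powR_ge0.
  by move=> z _ /=; apply: le_trans (fm _ I) _; rewrite ler_peMl.
move=> x y z _ _ _ /=.
have w0 := tw_ge0 beta x y e0; have wK := tw_comp x y e0.
have h := Hf (C x) (C y) (C z) I I I.
have mf : 0 <= m - `|f (C z)| by rewrite subr_ge0; exact: fm.
have h2 := ler_wpM2l mf wK.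
have h3 : `|f (C z)| * tw beta eta x y <= `|f (C z)| * (K `^ beta * tw beta eta x y).
  by apply: ler_wpM2l; [exact: normr_ge0|exact: (ler_peMl w0 Kb1)].
exact: comp_aux h h2 h3.
Qed.

End LinearSolver.

Lemma PS_thol_comp (R : realType) (d : nat) (beta K t : R) (C : 'rV[R]_d -> 'rV[R]_d)
    (f : R * 'rV[R]_d -> R) (m : R) :
  0 < beta -> 1 <= K -> (forall x y, tdist (C x) (C y) <= K * tdist x y) ->
  PS (fun=> True) (thol beta 1) t f m ->
  PS (fun=> True) (thol beta 1) t (fun p => f (p.1, C p.2)) (K `^ beta * m).
Proof.
move=> b0 K1 CL Hf.
have cN g m' : thol beta 1 g m' -> thol beta 1 (fun x => 1 * g (C x)) (K `^ beta * m').
  by move=> Hg; under eq_fun do rewrite mul1r; exact: (thol_comp b0 K1 CL ltr01 Hg).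
have := PS_op (D' := fun=> True) (N' := thol beta 1) (s := fun=> 1) (C := C)
  (powR_ge0 K beta) (fun _ _ => I) cN Hf.
by congr PS; apply: funext => p /=; rewrite mul1r.
Qed.

Section LinearSolver2.
Variables (R : realType) (d : nat).
Notation vec := 'rV[R]_d.
Variables (beta : R) (s : vec -> R) (C : vec -> vec) (K sm th : R) (n : nat).
Hypotheses (b0 : 0 < beta) (K1 : 1 <= K) (n0 : (0 < n)%N) (th0 : 0 <= th) (th1 : th < 1).
Hypothesis CL : forall x y, tdist (C x) (C y) <= K * tdist x y.
Hypothesis Hs : thol beta 1 s sm.
Hypothesis Hn : forall x, `|\prod_(k < n) s (iter k C x)| <= th.
Hypothesis Hth : th * (K ^+ n) `^ beta < 1.

Let K0 : 0 <= K. Proof. by rewrite (le_trans _ K1). Qed.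

Lemma iter_lipschitz k x y : tdist (iter k C x) (iter k C y) <= K ^+ k * tdist x y.
Proof.
elim: k => [|k IH]; first by rewrite mul1r.
by rewrite !iterS exprS -mulrA; apply: le_trans (CL _ _) _; apply: ler_wpM2l.
Qed.

Let Ps (p : R * vec) := s p.2.
Let PC (p : R * vec) := (p.1, C p.2).
Notation PSt t := (PS (fun _ : vec => True) (thol beta 1) t).

Lemma lin_solver : exists2 A, 0 <= A & forall t, 0 < t ->
  [/\ forall f m, PSt t f m -> PSt t (neumann Ps PC f) (A * m),
   forall f m p, PSt t f m -> `|p.1| <= t ->
     neumann Ps PC f p = f p + s p.2 * neumann Ps PC f (p.1, C p.2) &
   forall f g m m' p, PSt t f m -> PSt t g m' -> `|p.1| <= t ->
     neumann Ps PC (fun q => f q - g q) p = neumann Ps PC f p - neumann Ps PC g p].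
Proof.
pose sn x := \prod_(k < n) s (iter k C x).
have N1 := thol_nlike d beta (ltr01 : 0 < 1 :> R).
have [B HB] : exists B, thol beta 1 sn B.
  exists (\prod_(k < n) ((K ^+ k) `^ beta * sm)); apply: (nl_bigprod N1) => k _.
  apply: (thol_comp (C := iter k C)) => //; first exact: exprn_ege1.
  exact: iter_lipschitz.
have [B0 _ _] := HB.
pose eta := Num.min 1 ((1 - th) / (2 * (B + 1))).
have B1 : 0 < B + 1 by lra.
have eta0 : 0 < eta by rewrite lt_min ltr01 divr_gt0 ?subr_gt0 // mulr_gt0.
have eta1 : eta <= 1 by rewrite ge_min lexx.
have Beta : th + B * eta < 1.
  exact: weight_small.
clearbody eta.
pose th' := Num.max (th + B * eta) (th * (K ^+ n) `^ beta).
have th'1 : th' < 1 by rewrite gt_max Beta.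
have th'0 : 0 <= th' by rewrite le_max addr_ge0 // mulr_ge0 // ltW.
(* The single step is only bounded, not contracted: this is the bound of [thol_wcomp] with the norm
   [sm] of [s] also in the place of [th]. *)
pose Kp := Num.max (sm + sm * eta) (sm * K `^ beta).
have [sm0 sb _] := Hs.
have Kp0 : 0 <= Kp by rewrite le_max addr_ge0 // mulr_ge0 // ltW.
have Nop f m : thol beta eta f m -> thol beta eta (fun x => s x * f (C x)) (Kp * m).
  by move=> Hf; apply: thol_wcomp => // x; exact: sb.
have Nopn f m : thol beta eta f m -> thol beta eta (fun x => sn x * f (iter n C x)) (th' * m).
  move=> Hf; apply: (thol_wcomp (C := iter n C)) => //; first exact: exprn_ege1.
  exact: iter_lipschitz.
have Ne := thol_nlike d beta eta0.
pose A0 := series (fun k => Kp ^+ (k %% n) * th' ^+ (k %/ n)) n / (1 - th').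
have A00 : 0 <= A0 by exact: neumann_cst_ge0.
have up t f m : PSt t f m -> PS (fun=> True) (thol beta eta) t f m.
  rewrite -{2}[m]mul1r; apply: PS_op_id => // g m'; rewrite mul1r; exact: thol_eta.
have down t f m : PS (fun=> True) (thol beta eta) t f m -> PSt t f ((1 + eta^-1) * m).
  apply: PS_op_id => //; first by rewrite addr_ge0 // invr_ge0 ltW.
  by move=> g m'; rewrite mulrDl mul1r [_^-1 * _]mulrC; exact: thol_eta1.
exists ((1 + eta^-1) * A0).
  by rewrite mulr_ge0 // addr_ge0 // invr_ge0 ltW.
move=> t t0.
have Nt := PS_nlike Ne t0.
have DC (p : R * vec) : PSdom (fun=> True) t p -> PSdom (fun=> True) t (PC p) by [].
have Nw f m : PS (fun=> True) (thol beta eta) t f m ->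
    PS (fun=> True) (thol beta eta) t (wcomp Ps PC f) (Kp * m).
  by move=> Hf; apply: (PS_op (s := s) (C := C) Kp0 _ Nop Hf).
have itPC k p : iter k PC p = (p.1, iter k C p.2).
  by elim: k => [|k IH]; [case: p|rewrite !iterS IH].
have Nwn f m : PS (fun=> True) (thol beta eta) t f m ->
    PS (fun=> True) (thol beta eta) t (iter n (wcomp Ps PC) f) (th' * m).
  move=> Hf; have := PS_op (D' := fun=> True) (N' := thol beta eta) (s := sn) (C := iter n C) th'0 (fun _ _ => I) Nopn Hf.
  congr PS; apply: funext => p; rewrite iter_wcomp itPC; congr (_ * _).
  by apply: eq_bigr => k _; rewrite itPC.
split.
- move=> f m /up Hf; rewrite -mulrA; apply: down.
  exact: (N_neumann Nt Kp0 n0 th'0 th'1 Nw Nwn Hf).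
- move=> f m p /up Hf pt; exact: (neumannE Nt DC Kp0 n0 th'0 th'1 Nw Nwn Hf).
- move=> f g m m' p /up Hf /up Hg pt.
  exact: (neumannB Nt Kp0 n0 th'0 th'1 Nw Nwn Hf Hg).
Qed.

End LinearSolver2.

(** * The cohomological equation of the splitting *)

Lemma le_tsupnorm (R : realType) (d : nat) (f : 'rV[R]_d -> R) M x :
  (forall y, `|f y| <= M) -> `|f x| <= tsupnorm f.
Proof.
move=> fM; apply: ub_le_sup; last by exists x.
by exists M => _ [y _ <-].
Qed.

Section Gap.
Variables (R : realType) (d : nat).
Notation vec := 'rV[R]_d.
Variables (A : vec -> vec) (Lam : 'I_d -> vec -> R) (n : nat).
Hypothesis Lbd : forall i, exists m, forall x, `|Lam i x| <= m.
Hypothesis Laway : forall i, exists2 e, 0 < e & forall x, e <= `|Lam i x|.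
Hypothesis Lgap : forall i j : 'I_d, (j = i.+1 :> nat) ->
  tsupnorm (fun x => \prod_(k < n) Lam i (iter k A x)) *
  tsupnorm (fun x => (\prod_(k < n) Lam j (iter k A x))^-1) < 1.

(** The product of sup norms is turned into domination at each point, which chains over consecutive
    indices. The supremum in [tsupnorm] bounds the values only for bounded functions, whence the use
    of [Lbd] and [Laway]. *)
Lemma gap (i j : 'I_d) : (i < j)%N -> exists th, [/\ 0 <= th, th < 1 &
  forall x, `|\prod_(k < n) Lam i (iter k A x)| <= th * `|\prod_(k < n) Lam j (iter k A x)|].
Proof.
have adj (a b : 'I_d) : b = a.+1 :> nat -> exists th, [/\ 0 <= th, th < 1 &
  forall x, `|\prod_(k < n) Lam a (iter k A x)| <= th * `|\prod_(k < n) Lam b (iter k A x)|].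
  move=> ab; have [m Hm] := Lbd a; have [e e0 He] := Laway b.
  have S1 x : `|\prod_(k < n) Lam a (iter k A x)| <= tsupnorm (fun x => \prod_(k < n) Lam a (iter k A x)).
    apply: (le_tsupnorm (M := m ^+ n)) => y; rewrite normr_prod.
    by rewrite -[X in _ ^+ X]card_ord -prodr_const; apply: ler_prod => k _; rewrite normr_ge0 Hm.
  have S2 x : `|(\prod_(k < n) Lam b (iter k A x))^-1| <= tsupnorm (fun x => (\prod_(k < n) Lam b (iter k A x))^-1).
    apply: (le_tsupnorm (M := e^-1 ^+ n)) => y; rewrite -prodfV normr_prod.
    rewrite -[X in _ ^+ X]card_ord -prodr_const; apply: ler_prod => k _.
    by rewrite normr_ge0 normfV lef_pV2 ?posrE ?He // (lt_le_trans e0).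
  have := Lgap ab; move: S1 S2; set s1 := tsupnorm _; set s2 := tsupnorm _ => S1 S2 lt.
  exists (s1 * s2); split => //.
    by apply: mulr_ge0; [exact: le_trans (normr_ge0 _) (S1 0)|exact: le_trans (normr_ge0 _) (S2 0)].
  move=> x; have bn0 : \prod_(k < n) Lam b (iter k A x) != 0.
    by apply/prodf_neq0 => k _; rewrite -normr_gt0 (lt_le_trans e0).
  have := ler_pM (normr_ge0 _) (normr_ge0 _) (S1 x) (S2 x).
  by rewrite normfV ler_pdivrMr ?normr_gt0.
case: j => j; elim: j i => [//|j IH] i jd ij.
have jd' : (j < d)%N by exact: ltnW.
have [th [th0 th1 H]] := adj (Ordinal jd') (Ordinal jd) erefl.
move: ij; rewrite ltnS leq_eqVlt => /orP[/eqP ij|ij].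
  have -> : i = Ordinal jd' by exact: val_inj.
  by exists th.
have [th' [th0' th1' H']] := IH i jd' ij.
exists (th' * th); split; first exact: mulr_ge0.
  by apply: le_lt_trans th1; rewrite ler_piMl // ltW.
move=> x; apply: le_trans (H' x) _; rewrite -mulrA; apply: ler_wpM2l => //; exact: H.
Qed.

End Gap.

Section PairSolver.
Variables (R : realType) (d : nat).
Notation vec := 'rV[R]_d.
Variables (A A' : vec -> vec) (Lam : 'I_d -> vec -> R) (beta0 K : R) (n : nat).
Hypotheses (lA : is_lift A) (n0 : (0 < n)%N) (b00 : 0 < beta0) (K1 : 1 <= K).
Hypothesis A'A : forall x, tcong (A' (A x)) x.
Hypothesis AA' : forall x, tcong (A (A' x)) x.
Hypothesis LipA : forall x y, tdist (A x) (A y) <= K * tdist x y.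
Hypothesis LipA' : forall x y, tdist (A' x) (A' y) <= K * tdist x y.
Hypothesis Lper : forall i, tperiodic (Lam i).
Hypothesis Lhol : forall i beta, 0 < beta -> beta <= beta0 -> exists m, thol beta 1 (Lam i) m.
Hypothesis Lne0 : forall i x, Lam i x != 0.
Hypothesis Lgap : forall i j : 'I_d, (j = i.+1 :> nat) ->
  tsupnorm (fun x => \prod_(k < n) Lam i (iter k A x)) *
  tsupnorm (fun x => (\prod_(k < n) Lam j (iter k A x))^-1) < 1.

Notation PSt beta t := (PS (fun _ : vec => True) (thol beta 1) t).

(** [T] is an additive right inverse of w |-> Lam_j w - Lam_i (w o A); [Kc] precedes [t], so the
    radius in [eps] can shrink without loss. *)
Definition solves (beta : R) (i j : 'I_d) (Kc : R) (T : (R * vec -> R) -> R * vec -> R) :=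
  0 <= Kc /\ forall t, 0 < t ->
  [/\ forall f m, PSt beta t f m -> PSt beta t (T f) (Kc * m),
   forall f m e x, PSt beta t f m -> `|e| <= t ->
     Lam j x * T f (e, x) - Lam i x * T f (e, A x) = f (e, x) &
   forall f g m m' p, PSt beta t f m -> PSt beta t g m' -> `|p.1| <= t ->
     T (fun q => f q - g q) p = T f p - T g p].

Let lA_cong x y : tcong x y -> tcong (A x) (A y).
Proof. by move=> cxy; have := lA y cxy; rewrite [y + _]addrC subrK. Qed.

Let tcong_trans (x y z : vec) : tcong x y -> tcong y z -> tcong x z.
Proof. by move=> cxy cyz; have := latticeD cxy cyz; rewrite addrA subrK. Qed.

Let iterAA' k m x : (k <= m)%N -> tcong (iter k A (iter m A' x)) (iter (m - k) A' x).
Proof.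
elim: k => [|k IH] km; first by rewrite subn0; exact: tcong_refl.
rewrite iterS; apply: tcong_trans (lA_cong (IH (ltnW km))) _.
by rewrite -(subnSK km) iterS; exact: AA'.
Qed.

Let Laway i : exists2 e, 0 < e & forall x, e <= `|Lam i x|.
Proof.
have [m Hm] := Lhol i b00 (lexx _).
exact: thol_away0 b00 Hm (Lne0 i).
Qed.

Let Lbd i : exists m, forall x, `|Lam i x| <= m.
Proof. by have [m [_ Hm _]] := Lhol i b00 (lexx _); exists m => x; exact: Hm. Qed.

Let Linv i beta : 0 < beta -> beta <= beta0 -> exists m, thol beta 1 (fun x => (Lam i x)^-1) m.
Proof.
move=> b0 bb; have [m Hm] := Lhol i b0 bb; have [e e0 He] := Laway i.
exists (e^-1 + m / e ^+ 2); apply: hol_inv => //.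
by move=> x y; exact: tw_ge0.
Qed.

Lemma pair_solver (i j : 'I_d) : i != j -> exists2 b, 0 < b &
  forall beta, 0 < beta -> beta < b -> beta <= beta0 -> exists Kc T, solves beta i j Kc T.
Proof.
move=> ij.
have N1 beta := thol_nlike d beta (ltr01 : 0 < 1 :> R).
have [lt|gt|/val_inj/eqP] := ltngtP i j; last by rewrite (negbTE ij).
- have [th [th0 th1 Hg]] := gap Lbd Laway Lgap lt.
  have [b b0 Hb] := powR_small th0 th1 (exprn_ege1 n K1).
  exists b => // beta be0 beb bebeta0.
  have [mi Hi] := Lhol i be0 bebeta0; have [mj Hj] := Linv j be0 bebeta0.
  (* Divided by Lam_j the equation reads w = f / Lam_j + s (w o A), and the products of [s] along
     orbits are small by the gap. *)
  pose s x := Lam i x / Lam j x.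
  have Hs : thol beta 1 s (mi * mj) by exact: (nl_mul (N1 beta) Hi Hj).
  have Hn x : `|\prod_(k < n) s (iter k A x)| <= th.
    rewrite /s prodf_div normrM normfV ler_pdivrMr ?normr_gt0; first exact: Hg.
    by apply/prodf_neq0 => k _.
  have [Ac Ac0 HA] := lin_solver be0 K1 n0 th0 th1 LipA Hs Hn (Hb _ be0 beb).
  have mj0 := nl_ge0 (N1 beta) Hj.
  pose S := neumann (fun p : R * vec => s p.2) (fun p => (p.1, A p.2)).
  exists (Ac * mj), (fun f => S (fun p => f p * (Lam j p.2)^-1)).
  split; first exact: mulr_ge0.
  move=> t t0; have [S1 S2 S3] := HA t t0.
  have Nt := PS_nlike (N1 beta) t0.
  have Nd f m : PSt beta t f m -> PSt beta t (fun p => f p * (Lam j p.2)^-1) (mj * m).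
    by move=> Hf; rewrite mulrC; apply: (nl_mul Nt Hf); exact: (PS_lift (N1 beta) t Hj).
  split.
  + by move=> f m Hf; rewrite -mulrA; apply: S1; exact: Nd.
  + move=> f m e x Hf et; rewrite /S (S2 _ _ (e, x) (Nd _ _ Hf) et) /= /s.
    by field; exact: Lne0.
  + move=> f g m m' p Hf Hg' pt; rewrite -(S3 _ _ _ _ _ (Nd _ _ Hf) (Nd _ _ Hg') pt).
    by congr (S _ p); apply: funext => q; rewrite mulrBl.
- have [th [th0 th1 Hg]] := gap Lbd Laway Lgap gt.
  have [b b0 Hb] := powR_small th0 th1 (exprn_ege1 n K1).
  exists b => // beta be0 beb bebeta0.
  have [mj Hj] := Lhol j be0 bebeta0; have [mi Hi] := Linv i be0 bebeta0.
  have mi0 := nl_ge0 (N1 beta) Hi.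
  (* Now the equation is solved for w o A and composed with the inverse: w = - (f / Lam_i) o A' + s
     (w o A'). *)
  pose s x := Lam j (A' x) / Lam i (A' x).
  have Hs : thol beta 1 s (K `^ beta * (mj * mi)).
    exact: (thol_comp be0 K1 LipA' ltr01 (nl_mul (N1 beta) Hj Hi)).
  have Hn x : `|\prod_(k < n) s (iter k A' x)| <= th.
    (* A product along the backward orbit is, read in reverse, the forward product from the [n]-th
       preimage, so the same gap applies. A A' is only congruent to the identity, whence the appeal
       to periodicity. *)
    have E l : \prod_(k < n) Lam l (A' (iter k A' x)) = \prod_(k < n) Lam l (iter k A (iter n A' x)).
      rewrite (reindex_inj rev_ord_inj) /=; apply: eq_bigr => k _.
      rewrite -iterS; apply: periodic_cong; first exact: Lper.
      have -> : (n - k.+1).+1 = (n - k)%N by rewrite subnSK.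
      by have := latticeN (iterAA' x (ltnW (ltn_ord k))); rewrite opprB.
    rewrite /s prodf_div !E normrM normfV ler_pdivrMr ?normr_gt0; first exact: Hg.
    by apply/prodf_neq0 => k _.
  have [Ac Ac0 HA] := lin_solver be0 K1 n0 th0 th1 LipA' Hs Hn (Hb _ be0 beb).
  pose S := neumann (fun p : R * vec => s p.2) (fun p => (p.1, A' p.2)).
  pose G (f : R * vec -> R) (p : R * vec) := - (f (p.1, A' p.2) * (Lam i (A' p.2))^-1).
  exists (Ac * (K `^ beta * mi)), (fun f => S (G f)).
  split; first by rewrite !mulr_ge0 // powR_ge0.
  move=> t t0; have [S1 S2 S3] := HA t t0.
  have Nt := PS_nlike (N1 beta) t0.
  have Nd f m : PSt beta t f m -> PSt beta t (G f) (K `^ beta * mi * m).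
    move=> Hf; rewrite -mulrA; apply: (nl_opp Nt).
    have Hfi : PSt beta t (fun p => f p * (Lam i p.2)^-1) (mi * m).
      by rewrite mulrC; apply: (nl_mul Nt Hf); exact: (PS_lift (N1 beta) t Hi).
    exact: (PS_thol_comp be0 K1 LipA' Hfi).
  split.
  + by move=> f m Hf; rewrite -mulrA; apply: S1; rewrite /=; exact: Nd.
  + move=> f m e x Hf et.
    have HS := S1 _ _ (Nd _ _ Hf).
    rewrite [X in _ - _ * X](S2 _ _ (e, A x) (Nd _ _ Hf) et) /= /G /s /=.
    rewrite (PS_cong be0 Hf et (A'A x)).
    rewrite [neumann _ _ _ (e, A' (A x))](PS_cong be0 HS et (A'A x)).
    rewrite !(periodic_cong (Lper _) (A'A x)) -/(S (G f) (e, x)) /S /G.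
    by field; exact: Lne0.
  + move=> f g m m' p Hf Hg' pt; rewrite -(S3 _ _ _ _ _ (Nd _ _ Hf) (Nd _ _ Hg') pt).
    by congr (S _ p); apply: funext => q; rewrite /G mulrBl opprB opprK addrC.
Qed.

End PairSolver.

(** * The nonlinear equation for one invariant direction *)

Section Nonlinear.
Variables (R : realType) (d : nat).
Notation vec := 'rV[R]_d.
Variables (A : vec -> vec) (Lam : 'I_d -> vec -> R) (beta K : R) (i : 'I_d).
Variables (KT e t0 : R) (T : 'I_d -> (R * vec -> R) -> R * vec -> R).
Variable E : 'I_d -> 'I_d -> R * vec -> R.
Hypotheses (b0 : 0 < beta) (K1 : 1 <= K) (KT0 : 0 <= KT) (e0 : 0 <= e) (t00 : 0 < t0).
Hypothesis LipA : forall x y, tdist (A x) (A y) <= K * tdist x y.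
Hypothesis HT : forall j, i != j -> solves A Lam beta i j KT (T j).
Notation PSt t := (PS (fun _ : vec => True) (thol beta 1) t).
Hypothesis HE : forall k j, PSt t0 (E k j) e.

Definition ucoef (w : 'I_d -> R * vec -> R) (k : 'I_d) (p : R * vec) : R :=
  (i == k)%:R + p.1 * w k p.

(** With u = [ucoef w], the factor is L = Lam_i + eps sum_k u_k E_ki, forced by the [i]-th component
    and w_i = 0. The [j]-th component of u (diag Lam + eps E) = L (u o A), divided by [eps], has
    this right-hand side. *)
Definition rhs (w : 'I_d -> R * vec -> R) (j : 'I_d) (p : R * vec) : R :=
  p.1 * (\sum_k ucoef w k p * E k i p) * w j (p.1, A p.2) - \sum_k ucoef w k p * E k j p.

Let KA := K `^ beta.
Let D1 : R := d%:R.
(** [m0] bounds the image of 0 under the fixed point map, [b] is the radius of the ball of the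
    iteration, and t [Cst] is a Lipschitz constant of [rhs] on that ball. *)
Let m0 := KT * (D1 * e).
Let b := 2 * m0.
Let Cst := D1 * e * (KA * b + 2 * KA + 1).

Let KA0 : 0 <= KA. Proof. exact: powR_ge0. Qed.
Let m00 : 0 <= m0. Proof. by rewrite mulr_ge0 // mulr_ge0. Qed.
Let bb0 : 0 <= b. Proof. by rewrite mulr_ge0. Qed.
Let Cst0 : 0 <= Cst.
Proof. by rewrite !mulr_ge0 // !addr_ge0 // mulr_ge0. Qed.

Let sumD1 (u : R) : \sum_(k < d) u = D1 * u.
Proof. by rewrite sumr_const card_ord mulr_natl. Qed.

Section FixedT.
Variable t : R.
Hypotheses (tp : 0 < t) (tt0 : t <= t0) (t1 : t <= 1) (tb : t * b <= 1).
Hypothesis tC : t * (2 * (KT * Cst)) <= 1.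

Let Nt : nlike (PSdom (fun _ : vec => True) t) (PSt t).
Proof. exact: (PS_nlike (thol_nlike d beta ltr01) tp). Qed.

Let HEt k j : PSt t (E k j) e.
Proof. exact: (PS_mono (thol_nlike d beta ltr01) (ltW tp) tt0). Qed.

Let Heps : PSt t (fun p => p.1) t.
Proof. exact: (PS_eps (thol_nlike d beta ltr01) (ltW tp)). Qed.

Lemma N_ucoef w k : (forall j, PSt t (w j) b) -> PSt t (ucoef w k) 2.
Proof.
move=> Hw; have h1 := nl_cst Nt ((i == k)%:R); have h2 := nl_mul Nt Heps (Hw k).
apply: (nl_le Nt (nl_add Nt h1 h2)).
have : `|(i == k)%:R| <= 1 :> R by case: (i == k); rewrite ?normr1 ?normr0.
by move=> h; have -> : 2 = 1 + 1 :> R by []; exact: lerD.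
Qed.

Lemma N_usum w j : (forall j, PSt t (w j) b) ->
  PSt t (fun p => \sum_k ucoef w k p * E k j p) (D1 * (2 * e)).
Proof.
move=> Hw; rewrite -sumD1; apply: (nl_bigsum Nt) => k _.
by apply: (nl_mul Nt); [exact: N_ucoef|exact: HEt].
Qed.

Lemma N_rhs w j : (forall j, PSt t (w j) b) ->
  PSt t (rhs w j) (t * (D1 * (2 * e)) * (KA * b) + D1 * (2 * e)).
Proof.
move=> Hw; apply: (nl_sub Nt); last exact: N_usum.
apply: (nl_mul Nt); last exact: (PS_thol_comp b0 K1 LipA (Hw j)).
by apply: (nl_mul Nt Heps); exact: N_usum.
Qed.

Lemma N_rhsB w w' dl j : 0 <= dl -> (forall j, PSt t (w j) b) -> (forall j, PSt t (w' j) b) ->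
  (forall j, PSt t (fun p => w j p - w' j p) dl) ->
  PSt t (fun p => rhs w j p - rhs w' j p) (t * dl * Cst).
Proof.
move=> dl0 Hw Hw' Hd.
have Hu k : PSt t (fun p => ucoef w k p - ucoef w' k p) (t * dl).
  have := nl_mul Nt Heps (Hd k); congr PS; apply: funext => p; rewrite /ucoef; ring.
have Hs l : PSt t (fun p => \sum_k (ucoef w k p - ucoef w' k p) * E k l p) (D1 * (t * dl * e)).
  rewrite -sumD1; apply: (nl_bigsum Nt) => k _.
  by apply: (nl_mul Nt); [exact: Hu|exact: HEt].
have c1 := PS_thol_comp b0 K1 LipA (Hw j).
have c2 := PS_thol_comp b0 K1 LipA (Hd j).
have h1 := nl_mul Nt (nl_mul Nt Heps (Hs i)) c1.
have h2 := nl_mul Nt (nl_mul Nt Heps (N_usum i Hw')) c2.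
have h := nl_sub Nt (nl_add Nt h1 h2) (Hs j).
apply: (nl_le Nt (nl_ext Nt h _)).
  move=> p _; rewrite /rhs.
  have B l : \sum_k (ucoef w k p - ucoef w' k p) * E k l p =
    \sum_k ucoef w k p * E k l p - \sum_k ucoef w' k p * E k l p.
    by rewrite -sumrB; apply: eq_bigr => k _; rewrite mulrBl.
  rewrite !B; ring.
rewrite -/KA.
have -> : t * dl * Cst = t * (D1 * (1 * dl * e)) * (KA * b) + t * (D1 * (2 * e)) * (KA * dl) + D1 * (t * dl * e).
  by rewrite /Cst; ring.
rewrite lerD2r lerD2r; apply: ler_wpM2r; first exact: mulr_ge0.
apply: ler_wpM2l; first exact: ltW.
by apply: ler_wpM2l => //; apply: ler_wpM2r => //; apply: ler_wpM2r.
Qed.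

Lemma nonlinear_fix : exists w : 'I_d -> R * vec -> R,
  [/\ forall j, PSt t (w j) b, forall ep x, `|ep| <= t -> w i (ep, x) = 0 &
   forall j ep x, i != j -> `|ep| <= t ->
     Lam j x * w j (ep, x) - Lam i x * w j (ep, A x) = rhs w j (ep, x)].
Proof.
(* Setting the component [i] to 0 imposes the normalisation, and avoids j = i, for which no solver
   is given. *)
pose Phi w j := if i == j then (fun=> 0) else T j (rhs w j).
have [w [Nw Hw]] : exists w : 'I_d -> R * vec -> R, (forall j, PSt t (w j) (2 * m0)) /\
    forall j p, PSdom (fun=> True) t p -> Phi w j p = w j p.
  apply: (banach_fix Nt m00).
  - move=> j; rewrite /Phi; case: ifPn => [_|ij].
      by apply: (nl_le Nt (nl_zero Nt)).
    have [_ /(_ t tp) [T1 _ _]] := HT ij; apply: T1.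
    apply: (nl_le Nt (a := \sum_k `|(i == k)%:R| * e)); last first.
      rewrite -sumD1; apply: ler_sum => k _; rewrite ler_piMl //.
      by case: (i == k); rewrite ?normr1 ?normr0.
    have h : PSt t (fun p => - \sum_k (i == k)%:R * E k j p) (\sum_k `|(i == k)%:R| * e).
      apply: (nl_opp Nt); apply: (nl_bigsum Nt) => k _.
      by apply: (nl_scale Nt); exact: HEt.
    apply: (nl_ext Nt h) => p _; rewrite /rhs mulr0 add0r; congr (- _).
    by apply: eq_bigr => k _; rewrite /ucoef mulr0 addr0.
  - move=> w w' dl Hw Hw' Hd j.
    have dl0 := nl_ge0 Nt (Hd j).
    rewrite /Phi; case: ifPn => [_|ij].
      rewrite subr0; apply: (nl_le Nt (nl_zero Nt)); lra.
    have [_ /(_ t tp) [T1 _ T3]] := HT ij.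
    apply: (nl_le Nt (nl_ext Nt (T1 _ _ (N_rhsB j dl0 Hw Hw' Hd)) _)).
      by move=> p [pt _]; rewrite (T3 _ _ _ _ _ (N_rhs j Hw) (N_rhs j Hw') pt).
    have -> : KT * (t * dl * Cst) = dl * (t * (2 * (KT * Cst)) / 2) by field.
    by apply: ler_wpM2l => //; rewrite -[leRHS]mul1r ler_pM2r ?invr_gt0.
exists w; split => //.
- by move=> ep x et; rewrite -(Hw i (ep, x)) // /Phi eqxx.
- move=> j ep x ij et; have [_ /(_ t tp) [_ T2 _]] := HT ij.
  have HP : Phi w j = T j (rhs w j) by rewrite /Phi (negbTE ij).
  by rewrite -!(Hw j (ep, _)) // HP; exact: (T2 _ _ ep x (N_rhs j Nw) et).
Qed.

End FixedT.

(** Solvability for every [t] below a threshold lets all directions share one radius later; [tau]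
    bounds the corrections eps w_j, to keep the frame independent. *)
Lemma nonlinear_solution tau : 0 < tau -> exists2 t1, 0 < t1 /\ t1 <= t0 &
  forall t, 0 < t -> t <= t1 -> exists (w : 'I_d -> R * vec -> R) m,
  [/\ forall j, PSt t (w j) m, t * m <= tau, forall ep x, `|ep| <= t -> w i (ep, x) = 0 &
   forall j ep x, i != j -> `|ep| <= t ->
     Lam j x * w j (ep, x) - Lam i x * w j (ep, A x) = rhs w j (ep, x)].
Proof.
move=> tau0.
have B1 : 0 < b + 1 by rewrite ltr_wpDl.
have C1 : 0 < 2 * (KT * Cst) + 1 by rewrite ltr_wpDl // mulr_ge0 // mulr_ge0.
(* Below [t1]: t b <= 1 keeps each [ucoef] at norm at most 2, t b <= tau is the size claimed, and
   the last entry yields the contraction factor 1/2. *)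
pose t1 := Num.min (Num.min t0 1) (Num.min (Num.min 1 tau / (b + 1)) (2 * (KT * Cst) + 1)^-1).
have t1p : 0 < t1 by rewrite !lt_min t00 ltr01 invr_gt0 C1 andbT divr_gt0 // lt_min ltr01.
exists t1; first by split => //; rewrite !ge_min lexx.
move=> t tp; rewrite !le_min => /andP[/andP[tt0 tt1] /andP[]].
rewrite ler_pdivlMr // le_min => /andP[tb ttau] tC.
have tbl : t * b <= t * (b + 1) by rewrite ler_pM2l // lerDl.
have tC' : t * (2 * (KT * Cst)) <= 1.
  move: tC; rewrite -[_^-1]mul1r ler_pdivlMr // => h.
  by apply: le_trans h; rewrite ler_pM2l // lerDl.
have [w [H1 H2 H3]] := nonlinear_fix tp tt0 tt1 (le_trans tbl tb) tC'.
by exists w, b; split => //; exact: le_trans tbl ttau.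
Qed.

End Nonlinear.

(** * Invariant frames *)

Section FiniteNorm.
Variables (R : realType) (X : Type) (D : X -> Prop) (N : (X -> R) -> R -> Prop).
Hypothesis Nl : nlike D N.

Definition nfin (f : X -> R) : Prop := exists m, N f m.

Lemma nfin_cst c : nfin (fun=> c).
Proof. by exists `|c|; exact: (nl_cst Nl). Qed.

Lemma nfin_add f g : nfin f -> nfin g -> nfin (fun x => f x + g x).
Proof. by move=> [a Nf] [b Ng]; exists (a + b); exact: (nl_add Nl). Qed.

Lemma nfin_sub f g : nfin f -> nfin g -> nfin (fun x => f x - g x).
Proof. by move=> [a Nf] [b Ng]; exists (a + b); exact: (nl_sub Nl). Qed.

Lemma nfin_mul f g : nfin f -> nfin g -> nfin (fun x => f x * g x).
Proof. by move=> [a Nf] [b Ng]; exists (a * b); exact: (nl_mul Nl). Qed.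

Lemma nfin_sum (I : Type) (r : seq I) (P : pred I) (f : I -> X -> R) :
  (forall i, nfin (f i)) -> nfin (fun x => \sum_(i <- r | P i) f i x).
Proof.
move=> Nf; have /choice[a Na] := Nf.
by exists (\sum_(i <- r | P i) a i); apply: (nl_bigsum Nl).
Qed.

Lemma nfin_prod (I : Type) (r : seq I) (P : pred I) (f : I -> X -> R) :
  (forall i, nfin (f i)) -> nfin (fun x => \prod_(i <- r | P i) f i x).
Proof.
move=> Nf; have /choice[a Na] := Nf.
by exists (\prod_(i <- r | P i) a i); apply: (nl_bigprod Nl).
Qed.

Lemma nfin_uniform (I : finType) (f : I -> X -> R) : (forall i, nfin (f i)) ->
  exists2 m, 0 <= m & forall i, N (f i) m.
Proof.
move=> Nf; have /choice[a Na] := Nf.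
have a0 i : 0 <= a i by exact: (nl_ge0 Nl (Na i)).
exists (\sum_i a i) => [|i]; first exact: sumr_ge0.
by apply: (nl_le Nl (Na i)); rewrite (bigD1 i) //= lerDl sumr_ge0.
Qed.

Lemma nfin_det n (M : X -> 'M[R]_n) : (forall i j, nfin (fun x => M x i j)) ->
  nfin (fun x => \det (M x)).
Proof.
move=> HM; apply: nfin_sum => p.
by apply: nfin_mul; [exact: nfin_cst|exact: nfin_prod].
Qed.

Lemma nfin_mulmx a b c (P : X -> 'M[R]_(a, b)) (Q : X -> 'M[R]_(b, c)) :
  (forall i j, nfin (fun x => P x i j)) -> (forall i j, nfin (fun x => Q x i j)) ->
  forall i j, nfin (fun x => (P x *m Q x) i j).
Proof.
move=> HP HQ i j; under eq_fun do rewrite mxE.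
by apply: nfin_sum => k; apply: nfin_mul.
Qed.

Lemma nfin_invmx n (M : X -> 'M[R]_n) : (forall i j, nfin (fun x => M x i j)) ->
  nfin (fun x => (\det (M x))^-1) -> (forall x, M x \in unitmx) ->
  forall i j, nfin (fun x => invmx (M x) i j).
Proof.
move=> HM Hd uM i j.
have -> : (fun x => invmx (M x) i j) = (fun x => (\det (M x))^-1 * cofactor (M x) j i).
  by apply: funext => x; rewrite /invmx uM !mxE.
apply: nfin_mul => //; rewrite /cofactor.
apply: nfin_mul; first exact: nfin_cst.
by apply: nfin_det => k l; under eq_fun do rewrite !mxE.
Qed.

End FiniteNorm.

(** If u U = 0, then u = - u (U - 1), so |u| <= c d |u| < |u| in the sup norm unless u = 0. *)
Lemma near_id_unitmx (R : realType) (d : nat) (U : 'M[R]_d) c : c * d%:R < 1 ->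
  (forall i k, `|U i k - (i == k)%:R| <= c) -> U \in unitmx.
Proof.
move=> cd Uc; rewrite unitmxE unitfE; apply/negP => /det0P [u u0 uU].
have un : 0 < `|u| by rewrite normr_gt0.
have cd0 : 0 <= `|u| * (c * d%:R).
  case: d U cd Uc u u0 uU un => [|d] U cd Uc u u0 uU un; first by rewrite !mulr0.
  by rewrite !mulr_ge0 // (le_trans _ (Uc 0 0)).
suff : `|u| <= `|u| * (c * d%:R).
  by rewrite leNgt => /negP; apply; rewrite -[ltRHS]mulr1 ltr_pM2l.
apply: rV_norm_le => // k.
have -> : u 0 k = - \sum_i u 0 i * (U i k - (i == k)%:R).
  have := congr1 (fun z : 'rV_d => z 0 k) uU; rewrite !mxE => E.
  under eq_bigr do rewrite mulrBr; rewrite sumrB E sub0r opprK.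
  rewrite (bigD1 k) //= eqxx mulr1 big1 ?addr0 // => i /negbTE ->; exact: mulr0.
rewrite normrN; apply: le_trans (ler_norm_sum _ _ _) _.
rewrite mulrA [_ * d%:R]mulrC mulr_natl -[X in _ *+ X]card_ord -sumr_const.
by apply: ler_sum => i _; rewrite normrM; apply: ler_pM => //; exact: rV_coord_le.
Qed.

Lemma jet_comb (R : realType) (d : nat) (f g : 'rV[R]_d -> R) y q q' c :
  jet f y q -> jet g y q' -> jet (fun z => f z + c * g z) y (fun k => q k + c * q' k).
Proof.
move=> [C [r [r0 H]]] [C' [r' [r0' H']]].
exists (C + `|c| * C'), (Num.min r r'); split; first by rewrite lt_min r0.
move=> z; rewrite le_min => /andP[zr zr'].
have -> : f (y + z) + c * g (y + z) - (f y + c * g y) - \sum_k z 0 k * (q k + c * q' k) =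
  (f (y + z) - f y - \sum_k z 0 k * q k) + c * (g (y + z) - g y - \sum_k z 0 k * q' k).
  have -> : \sum_k z 0 k * (q k + c * q' k) = \sum_k z 0 k * q k + c * \sum_k z 0 k * q' k.
    by rewrite mulr_sumr -big_split /=; apply: eq_bigr => k _; ring.
  ring.
apply: le_trans (ler_normD _ _) _; rewrite mulrDl; apply: lerD; first exact: H.
by rewrite normrM -mulrA; apply: ler_wpM2l => //; exact: H'.
Qed.

Section PSTorus.
Variables (R : realType) (d : nat) (beta t : R).
Notation vec := 'rV[R]_d.
Hypotheses (b0 : 0 < beta) (t0 : 0 < t).
Notation PSt := (PS (fun _ : vec => True) (thol beta 1) t).

Lemma PS_at g m e : PSt g m -> `|e| <= t -> thol beta 1 (fun x => g (e, x)) m.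
Proof.
have N1 := thol_nlike d beta (ltr01 : 0 < 1 :> R).
move=> [c [mc [Nc Hm Hc]]] et.
apply: (nl_sum N1 (f := fun n x => e ^+ n * c n x) (m := fun n => t ^+ n * mc n)) => // [n|x _].
  apply: (nl_le N1 (nl_scale N1 (e ^+ n) (Nc n))).
  apply: ler_wpM2r; first exact: (nl_ge0 N1 (Nc n)).
  by rewrite normrX; apply: lerXn2r => //; rewrite nnegrE ltW.
exact: Hc.
Qed.

(** The bounds of finitely many series are added up into one [M]. The free factor [k] leaves room
    for the constants that the passage to [hnorm_le] costs. *)
Lemma PS_coefficients (I : finType) (g : I -> R * vec -> R) :
  (forall a, nfin PSt (g a)) ->
  exists (c : nat -> I -> vec -> R) (M : nat -> R),
  [/\ forall n a, thol beta 1 (c n a) (M n),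
    forall n, 0 <= M n,
    forall k e : R, `|e| <= t -> cvgn (series (fun n => `|e| ^+ n * (k * M n))) &
    forall a (e : R) x, `|e| <= t -> series (fun n => e ^+ n * c n a x) @ \oo --> g a (e, x)].
Proof.
have N1 := thol_nlike d beta (ltr01 : 0 < 1 :> R).
move=> Hg.
have /choice[T HT] a : exists T : (nat -> vec -> R) * (nat -> R) * R,
  [/\ forall n, thol beta 1 (T.1.1 n) (T.1.2 n), forall n, series (fun k => t ^+ k * T.1.2 k) n <= T.2 &
   forall e x, `|e| <= t -> True -> series (fun n => e ^+ n * T.1.1 n x) @ \oo --> g a (e, x)].
  by have [m [c [mc H]]] := Hg a; exists (c, mc, m).
have Tn a n : thol beta 1 ((T a).1.1 n) ((T a).1.2 n) by case: (HT a) => H _ _; exact: H.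
have T0 a n : 0 <= (T a).1.2 n by exact: (nl_ge0 N1 (Tn a n)).
have Tm a n : series (fun k => t ^+ k * (T a).1.2 k) n <= (T a).2 by case: (HT a) => _ H _; exact: H.
exists (fun n a => (T a).1.1 n), (fun n => \sum_a (T a).1.2 n); split.
- by move=> n a; apply: (nl_le N1 (Tn a n)); rewrite (bigD1 a) //= lerDl sumr_ge0.
- by move=> n; exact: sumr_ge0.
- move=> k e et.
  have -> : series (fun n => `|e| ^+ n * (k * \sum_a (T a).1.2 n)) =
     (fun n => \sum_a k * series (fun n => `|e| ^+ n * (T a).1.2 n) n).
    apply: funext => n; rewrite /series /=.
    under [RHS]eq_bigr do rewrite mulr_sumr.
    rewrite exchange_big /=; apply: eq_bigr => i _.
    by rewrite mulrCA mulr_sumr mulr_sumr; apply: eq_bigr => a _.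
  apply: (cvgP (\sum_a k * limn (series (fun n => `|e| ^+ n * (T a).1.2 n)))).
  apply: cvgn_sum => a _; apply: cvgM; first exact: cvg_cst.
  have H : cvgn (series (fun n => `|e| ^+ n * (T a).1.2 n)); last exact: H.
  apply: (pseries_cvg (M := (T a).2)) => n; first by rewrite mulr_ge0 // exprn_ge0.
  apply: le_trans (Tm a n); apply: ler_sum => j _.
  by apply: ler_wpM2r => //; apply: lerXn2r; rewrite // nnegrE ltW.
- by move=> a e x et; case: (HT a) => _ _; apply.
Qed.

End PSTorus.

(** * The displacement of the conjugacy as a power series *)

Section Displacement.
Variables (R : realType) (d : nat).
Notation vec := 'rV[R]_d.
Variables (H : R -> vec -> vec) (h : nat -> vec -> vec) (beta eps0 Cb : R).
Hypotheses (b0 : 0 < beta) (e0 : 0 < eps0) (hper : forall n, tperiodic (h n)).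
Hypothesis Hser : forall eps : R, `|eps| < eps0 -> forall x (i : 'I_d),
  series (fun n => eps ^+ n.+1 * h n.+1 x 0 i) @ \oo --> (H eps x - x) 0 i.
Hypothesis hC : forall n, (0 < n)%N -> hnorm_le (@tenorm R d) beta (h n) (Cb ^+ n).

(** There is no term of order 0 in [eps], so for t C <= 1/2 the norm at radius [t] is at most 2 C t.
    This linear decay in [t] makes the displacement small against the radius of a Taylor series. *)
Lemma displacement_PS : exists T B, [/\ 0 < T, T < eps0, 0 <= B &
  forall i t, 0 < t -> t <= T ->
  PS (fun=> True) (thol beta 1) t (fun p => (H p.1 p.2 - p.2) 0 i) (B * t)].
Proof.
have N1 := thol_nlike d beta (ltr01 : 0 < 1 :> R).
pose C := `|Cb|; have C0 : 0 <= C by exact: normr_ge0.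
have C1 : 0 < 2 * (C + 1) by rewrite mulr_gt0 // ltr_wpDl.
pose T := Num.min (eps0 / 2) (2 * (C + 1))^-1.
have T0 : 0 < T by rewrite lt_min divr_gt0 // invr_gt0.
exists T, (2 * C); split => //.
- by rewrite gt_min; apply/orP; left; rewrite ltr_pdivrMr // ltr_pMr // ltr1n.
- exact: mulr_ge0.
move=> i t t0; rewrite le_min => /andP[te tC].
pose c n x := if n is 0%N then 0 else h n x 0 i.
pose mc n := if n is 0%N then 0 else C ^+ n.
exists c, mc; split.
- move=> [|n]; first exact: (nl_zero N1).
  apply: (nl_le N1 (thol_of_hnorm i b0 (hper n.+1) (hC (ltn0Sn n)))).
  by rewrite /mc /C -normrX ler_norm.
- have q0 : 0 <= t * C by rewrite mulr_ge0 // ltW.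
  have q2 : t * C <= 1 / 2.
    move: tC; rewrite -[_^-1]mul1r ler_pdivlMr // => h1.
    have : t * (2 * (C + 1)) = 2 * (t * C) + 2 * t by ring.
    lra.
  have q1 : t * C != 1 by apply/eqP; lra.
  have -> : 2 * C * t = (t * C) * 2 by ring.
  move=> [|n]; first by rewrite seriesE0 mulr_ge0.
  rewrite /series /= big_nat_recl //= mulr0 add0r.
  have -> : \sum_(0 <= k < n) t ^+ k.+1 * C ^+ k.+1 = (t * C) * series (fun k => (t * C) ^+ k) n.
    rewrite /series /= mulr_sumr; apply: eq_bigr => k _.
    by rewrite -exprMn exprS.
  rewrite geo_series //; apply: ler_wpM2l => //.
  rewrite ler_pdivrMr; last lra.
  have : 0 <= (t * C) ^+ n by rewrite exprn_ge0.
  lra.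
- move=> e x et _ /=.
  have ee : `|e| < eps0 by apply: le_lt_trans et _; apply: le_lt_trans te _; rewrite ltr_pdivrMr // ltr_pMr // ltr1n.
  rewrite -(cvg_shiftS (series _)).
  have -> : [sequence series (fun n => e ^+ n * c n x) n.+1]_n =
     series (fun n => e ^+ n.+1 * h n.+1 x 0 i).
    apply: funext => n /=; rewrite /series /= big_nat_recl //= mulr0 add0r.
    by [].
  exact: Hser.
Qed.

Lemma H0E x : H 0 x = x.
Proof.
apply/eqP; rewrite -subr_eq0; apply/eqP/rowP => i; rewrite [RHS]mxE.
have ee : `|0 : R| < eps0 by rewrite normr0.
have hs := @Hser 0 ee x i.
have E : series (fun n => 0 ^+ n.+1 * h n.+1 x 0 i) = (fun=> 0).
  by apply: funext => n; rewrite /series /= big1 // => k _; rewrite exprS mul0r mul0r.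
by rewrite E in hs; exact: cvg_cstE hs.
Qed.

End Displacement.

Section FixedBeta.
Variables (R : realType) (d : nat).
Notation vec := 'rV[R]_d.
Variables (A F : vec -> vec) (Lam : 'I_d -> vec -> R) (v : 'I_d -> vec -> vec).
Variables (H : R -> vec -> vec) (beta K T B : R).
Hypotheses (b0 : 0 < beta) (b1 : beta < 1) (K1 : 1 <= K) (T0 : 0 < T) (B0 : 0 <= B).
Hypothesis HPS : forall i t, 0 < t -> t <= T ->
  PS (fun=> True) (thol beta 1) t (fun p => (H p.1 p.2 - p.2) 0 i) (B * t).
Hypothesis H0 : forall x, H 0 x = x.
Hypotheses (lA : is_lift A) (aA : ranalytic A) (pF : tperiodic F) (aF : ranalytic F).
Hypothesis LipA : forall x y, tdist (A x) (A y) <= K * tdist x y.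
Hypothesis Lhol : forall i, exists m, thol beta 1 (Lam i) m.
Hypothesis vhol : forall i j, exists m, thol beta 1 (fun x => v i x 0 j) m.
Hypothesis vunit : forall x, tframe v x \in unitmx.
Hypothesis vinv : forall i x, 'D_(v i x) A x = Lam i x *: v i (A x).
Hypothesis Hsolve : forall i j, i != j -> exists Kc S, solves A Lam beta i j Kc S.

Notation PSt t := (PS (fun _ : vec => True) (thol beta 1) t).

Let N1 : nlike (fun _ : vec => True) (thol beta 1).
Proof. exact: thol_nlike. Qed.

Lemma jets_uniform (g : vec -> vec) : ranalytic g ->
  (forall x w, tlattice w -> exists2 r, 0 < r &
     forall z, `|z| <= r -> g (x + w + z) - g (x + w) = g (x + z) - g x) ->
  exists t (G : 'I_d -> 'I_d -> R * vec -> R), [/\ 0 < t, t <= T,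
   forall i k, nfin (PSt t) (G i k) &
   forall i eps x, `|eps| <= t -> jet (fun y => g y 0 i) (H eps x) (G i ^~ (eps, x))].
Proof.
move=> ag gi.
pose P (i : 'I_d) t := exists G : 'I_d -> R * vec -> R,
   (forall k, nfin (PSt t) (G k)) /\
   forall eps x, `|eps| <= t -> jet (fun y => g y 0 i) (H eps x) (G ^~ (eps, x)).
have mono i r r' : 0 < r' -> r' <= r -> P i r -> P i r'.
  move=> r0 rr' [G [NG jG]]; exists G; split.
    by move=> k; have [M HM] := NG k; exists M; apply: (PS_mono N1 (ltW r0) rr' HM).
  by move=> eps x er; apply: jG; exact: le_trans rr'.
have [t t0 Ht] : exists2 t, 0 < t & forall i, P i t.
  apply: fin_uniform mono => i.
  have fi x w : tlattice w -> exists2 r, 0 < r & forall z : vec, `|z| <= r ->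
      g (x + w + z) 0 i - g (x + w) 0 i = g (x + z) 0 i - g x 0 i.
    move=> lw; have [r r0 Hr] := gi x w lw; exists r => // z zr.
    by have := congr1 (fun u : vec => u 0 i) (Hr z zr); rewrite !mxE.
  have [t [M [G [t0 tT NG jG]]]] := jet_global b0 b1 T0 B0 HPS (ag i) fi.
  by exists t => //; exists G; split => // k; exists M.
have t'0 : 0 < Num.min t T by rewrite lt_min t0.
have /choice[G HG] i : P i (Num.min t T) by apply: mono (Ht i); rewrite // ge_min lexx.
exists (Num.min t T), G; split => //.
- by rewrite ge_min lexx orbT.
- by move=> i; case: (HG i).
- by move=> i; case: (HG i).
Qed.

Lemma derivative_PS : exists t (Jm : R * vec -> 'M[R]_d), [/\ 0 < t, t <= T,
   forall k i, nfin (PSt t) (fun p => Jm p k i) &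
   forall eps x u, `|eps| <= t ->
     'D_u (fun y => A y + eps *: F y) (H eps x) = u *m Jm (eps, x)].
Proof.
have [t [G [t0 tT NG jG]]] := jets_uniform aA (fun x w => lift_increment x aA lA).
have [t' [G' [t0' tT' NG' jG']]] : exists t (G : 'I_d -> 'I_d -> R * vec -> R), [/\ 0 < t, t <= T,
   forall i k, nfin (PSt t) (G i k) &
   forall i eps x, `|eps| <= t -> jet (fun y => F y 0 i) (H eps x) (G i ^~ (eps, x))].
  apply: jets_uniform aF _ => x w lw; exists 1 => // z _.
  by rewrite [x + w + z]addrAC (pF (x + z) lw) (pF x lw).
pose s := Num.min t t'.
have s0 : 0 < s by rewrite lt_min t0.
have st : s <= t by rewrite ge_min lexx.
have st' : s <= t' by rewrite ge_min lexx orbT.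
have Ns := PS_nlike N1 s0.
exists s, (fun p => \matrix_(k, i) (G i k p + p.1 * G' i k p)); split => //.
- exact: le_trans tT.
- move=> k i.
  have -> : (fun p : R * vec => (\matrix_(k, i) (G i k p + p.1 * G' i k p)) k i) =
    (fun p => G i k p + p.1 * G' i k p) by apply: funext => p; rewrite mxE.
  apply: (nfin_add Ns).
    by have [m Hm] := NG i k; exists m; exact: (PS_mono N1 (ltW s0) st).
  apply: (nfin_mul Ns); first by exists s; exact: (PS_eps N1 (ltW s0)).
  by have [m Hm] := NG' i k; exists m; exact: (PS_mono N1 (ltW s0) st').
- move=> eps x u es.
  rewrite (jet_derive (q := fun i k => G i k (eps, x) + eps * G' i k (eps, x))); last first.
    move=> i; have := jet_comb eps (jG i eps x (le_trans es st)) (jG' i eps x (le_trans es st')).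
    by congr jet; apply: funext => y; rewrite !mxE.
  by apply/rowP => i; rewrite !mxE; apply: eq_bigr => k _; rewrite mxE.
Qed.

Lemma frame_inv_hol i j : nfin (thol beta 1) (fun x => invmx (tframe v x) i j).
Proof.
have Hv k l : nfin (thol beta 1) (fun x => tframe v x k l).
  by under eq_fun do rewrite mxE; exact: vhol.
apply: (nfin_invmx N1) => //.
have [m Hm] := nfin_det N1 Hv.
have [e e0 He] : exists2 e, 0 < e & forall x, e <= `|\det (tframe v x)|.
  by apply: (thol_away0 b0 Hm) => x; rewrite -unitfE -unitmxE.
exists (e^-1 + m / e ^+ 2); apply: hol_inv => //.
by move=> x y; exact: tw_ge0.
Qed.

Lemma cocycle_frame : exists t (Bm : R * vec -> 'M[R]_d) (E : 'I_d -> 'I_d -> R * vec -> R),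
  [/\ 0 < t, t <= T, forall k j, nfin (PSt t) (E k j),
   forall k j e x, `|e| <= t -> Bm (e, x) k j = (k == j)%:R * Lam k x + e * E k j (e, x) &
   forall e x (u : vec), `|e| <= t ->
     'D_(u *m tframe v x) (fun y => A y + e *: F y) (H e x) =
     u *m Bm (e, x) *m tframe v (A x)].
Proof.
have [t [Jm [t0 tT NJ DJ]]] := derivative_PS.
have Nt := PS_nlike N1 t0.
(* Vectors are rows, so a matrix acts from the right: [Bm] expresses the derivative in the frame at
   [x] and the frame at [A x]. At eps = 0 invariance of the given splitting makes it diagonal. *)
pose Bm (p : R * vec) := tframe v p.2 *m Jm p *m invmx (tframe v (A p.2)).
have NB k j : nfin (PSt t) (fun p => Bm p k j).
  apply: (nfin_mulmx Nt) => {k j} k j.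
    apply: (nfin_mulmx Nt) => // {k j} k j.
    have -> : (fun p : R * vec => tframe v p.2 k j) = (fun p => v k p.2 0 j).
      by apply: funext => p; rewrite mxE.
    by have [m Hm] := vhol k j; exists m; exact: (PS_lift N1 t Hm).
  have [m Hm] := frame_inv_hol k j; exists (K `^ beta * m).
  exact: (PS_lift N1 t (thol_comp b0 K1 LipA ltr01 Hm)).
pose E0 k j p := Bm p k j - (k == j)%:R * Lam k p.2.
have NE k j : nfin (PSt t) (E0 k j).
  apply: (nfin_sub Nt) => //; apply: (nfin_mul Nt); first exact: (nfin_cst Nt).
  by have [m Hm] := Lhol k; exists m; exact: (PS_lift N1 t Hm).
have J0 x u : 'D_u A x = u *m Jm (0, x).
  have z0 : `|0 : R| <= t by rewrite normr0 ltW.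
  rewrite -(DJ 0 x u z0) H0; congr ('D_u _ x); apply: funext => y.
  by rewrite scale0r addr0.
have E00 k j x : E0 k j (0, x) = 0.
  rewrite /E0 /=; have -> : Bm (0, x) = \matrix_(k, j) ((k == j)%:R * Lam k x).
    have E1 : tframe v x *m Jm (0, x) = (\matrix_(k, j) ((k == j)%:R * Lam k x)) *m tframe v (A x).
      apply/row_matrixP => l; rewrite row_mul.
      have -> : row l (tframe v x) = v l x by apply/rowP => c; rewrite !mxE.
      rewrite -J0 vinv; apply/rowP => c; rewrite !mxE (bigD1 l) //= !mxE eqxx mul1r.
      by rewrite big1 ?addr0 // => c' cl; rewrite mxE eq_sym (negbTE cl) !mul0r.
    by rewrite /Bm /= E1 mulmxK.
  by rewrite mxE subrr.
have /choice[E HE] kj : exists E, nfin (PSt t) E /\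
    forall e x, `|e| <= t -> E0 kj.1 kj.2 (e, x) = e * E (e, x).
  have [m Hm] := NE kj.1 kj.2.
  have [E HE1 HE2] := PS_divide N1 t0 Hm (fun x _ => E00 kj.1 kj.2 x).
  by exists E; split; [exists (m / t)|move=> e x et; exact: HE2].
exists t, Bm, (fun k j => E (k, j)); split => //.
- by move=> k j; case: (HE (k, j)).
- move=> k j e x et; have [_ /(_ e x et) /= <-] := HE (k, j).
  by rewrite /E0 addrC subrK.
- move=> e x u et; rewrite DJ // /Bm /= !mulmxA -[RHS]mulmxA mulVmx //.
  by rewrite mulmx1.
Qed.


Lemma invariant_frame : exists t (U : R * vec -> 'M[R]_d) (L : 'I_d -> R * vec -> R),
  [/\ 0 < t, t <= T, forall i k, nfin (PSt t) (fun p => U p i k),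
   forall i, nfin (PSt t) (L i) &
   forall e x, `|e| <= t -> [/\ U (e, x) \in unitmx,
     forall i, 'D_(row i (U (e, x) *m tframe v x)) (fun y => A y + e *: F y) (H e x) =
       L i (e, x) *: row i (U (e, A x) *m tframe v (A x)) &
     e = 0 -> U (e, x) = 1%:M /\ forall i, L i (e, x) = Lam i x]].
Proof.
have [t [Bm [E [t0 tT NE BE DB]]]] := cocycle_frame.
have Nt := PS_nlike N1 t0.
have [eb eb0 HE] : exists2 m, 0 <= m & forall kj : 'I_d * 'I_d, PSt t (E kj.1 kj.2) m.
  by apply: (nfin_uniform Nt) => kj; exact: NE.
have /choice[KS HKS] ij : exists KS : R * ((R * vec -> R) -> R * vec -> R),
    0 <= KS.1 /\ (ij.1 != ij.2 -> solves A Lam beta ij.1 ij.2 KS.1 KS.2).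
  have [E12|n12] := eqVneq ij.1 ij.2; first by exists (0, id); split => //; rewrite eqxx.
  by have [Kc [S HS]] := Hsolve n12; exists (Kc, S); split => //; case: HS.
pose KT := \sum_ij (KS ij).1.
have KS0 ij : 0 <= (KS ij).1 by case: (HKS ij).
have KT0 : 0 <= KT by exact: sumr_ge0.
have HT i j : i != j -> solves A Lam beta i j KT (KS (i, j)).2.
  move=> nij; have [_ /(_ nij) /= [_ HS]] := HKS (i, j); split => // s s0.
  have [S1 S2 S3] := HS s s0; split => // f m Hf.
  have Ns := PS_nlike N1 s0; apply: (nl_le Ns (S1 f m Hf)).
  apply: ler_wpM2r; first exact: (nl_ge0 Ns Hf).
  by rewrite /KT (bigD1 (i, j)) //= lerDl sumr_ge0.
(* Then tau d < 1, which is what [near_id_unitmx] asks of the deviation of [U] from the identity. *)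
pose tau : R := (2 * d.+1%:R)^-1.
have tau0 : 0 < tau by rewrite invr_gt0 mulr_gt0.
pose P (i : 'I_d) s := forall s', 0 < s' -> s' <= s -> exists (w : 'I_d -> R * vec -> R) m,
  [/\ forall j, PSt s' (w j) m, s' * m <= tau, forall ep x, `|ep| <= s' -> w i (ep, x) = 0 &
   forall j ep x, i != j -> `|ep| <= s' ->
     Lam j x * w j (ep, x) - Lam i x * w j (ep, A x) = rhs A i E w j (ep, x)].
have [s1 s10 Hs1] : exists2 s, 0 < s & forall i, P i s.
  apply: fin_uniform.
    move=> i; have [s1 [s10 _] Hs] := nonlinear_solution b0 K1 KT0 eb0 t0 LipA (HT i)
      (fun k j => HE (k, j)) tau0.
    by exists s1.
  move=> i r r' r0 rr' Pr s' s'0 s'r'; apply: Pr => //; exact: le_trans rr'.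
pose s := Num.min s1 t.
have s0 : 0 < s by rewrite lt_min s10.
have st : s <= t by rewrite ge_min lexx orbT.
have ss1 : s <= s1 by rewrite ge_min lexx.
have Ns := PS_nlike N1 s0.
have /choice[w Hw] i := Hs1 i s s0 ss1.
pose U (p : R * vec) : 'M[R]_d := \matrix_(i, k) ucoef i (w i) k p.
pose L i (p : R * vec) := Lam i p.2 + p.1 * \sum_k ucoef i (w i) k p * E k i p.
have Neps : nfin (PSt s) (fun p => p.1) by exists s; exact: (PS_eps N1 (ltW s0)).
have Nu i k : nfin (PSt s) (ucoef i (w i) k).
  have [m [Hm _ _ _]] := Hw i.
  by apply: (nfin_add Ns); [exact: (nfin_cst Ns)|apply: (nfin_mul Ns) => //; exists m].
exists s, U, L; split => //.
- exact: le_trans tT.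
- by move=> i k; have := Nu i k; congr nfin; apply: funext => p; rewrite mxE.
- move=> i; apply: (nfin_add Ns).
    by have [m Hm] := Lhol i; exists m; exact: (PS_lift N1 s Hm).
  apply: (nfin_mul Ns) => //; apply: (nfin_sum Ns) => k; apply: (nfin_mul Ns) => //.
  by exists eb; exact: (PS_mono N1 (ltW s0) st (HE (k, i))).
move=> e x es; have et := le_trans es st.
have uii i y : ucoef i (w i) i (e, y) = 1.
  by have [m [_ _ wi _]] := Hw i; rewrite /ucoef wi // mulr0 addr0 eqxx.
split.
- apply: (near_id_unitmx (c := tau)).
    rewrite /tau mulrC ltr_pdivrMr ?mulr_gt0 // mul1r.
    by rewrite -natrM ltr_nat mulSn mul1n ltn_addr.
  move=> i k; rewrite mxE /ucoef addrC addrA addNr add0r.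
  have [m [Hm sm _ _]] := Hw i; apply: le_trans sm.
  by rewrite normrM; apply: ler_pM => //; apply: (nl_bnd Ns (Hm k)).
- move=> i; rewrite row_mul DB // row_mul scalemxAl; congr (_ *m _).
  apply/rowP => j; rewrite !mxE.
  have -> : \sum_k (row i (U (e, x))) 0 k * Bm (e, x) k j =
      ucoef i (w i) j (e, x) * Lam j x + e * \sum_k ucoef i (w i) k (e, x) * E k j (e, x).
    rewrite mulr_sumr; under eq_bigr do rewrite !mxE BE // mulrDr.
    rewrite big_split /=; congr (_ + _); last by apply: eq_bigr => k _; ring.
    rewrite (bigD1 j) //= eqxx mul1r big1 ?addr0 // => k /negbTE ->.
    by rewrite mul0r mulr0.
  (* The diagonal component holds by the choice of [L]; the others are [eps] times the equation
     solved by [w]. *)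
  have [<-|nij] := eqVneq i j; first by rewrite !uii mul1r mulr1 /L.
  have [m [_ _ _ Heq]] := Hw i; have := Heq j e x nij es.
  have uj y : ucoef i (w i) j (e, y) = e * w i j (e, y).
    by rewrite /ucoef (negbTE nij) add0r.
  rewrite !uj /L /rhs /=; set S1 := \sum_k _; set S2 := \sum_k _ => Hj.
  have -> : e * w i j (e, x) * Lam j x + e * S2 =
    e * (Lam j x * w i j (e, x) - Lam i x * w i j (e, A x)) + e * (Lam i x * w i j (e, A x) + S2).
    ring.
  by rewrite Hj; ring.
- move=> ez; split.
    by apply/matrixP => i k; rewrite !mxE /ucoef ez mul0r addr0.
  by move=> i; rewrite /L /= ez mul0r addr0.
Qed.

End FixedBeta.

Lemma thol_tholder_vec (R : realType) (d : nat) (beta : R) (f : 'rV[R]_d -> 'rV[R]_d) m :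
  0 < beta -> 0 <= m -> (forall j, thol beta 1 (fun x => f x 0 j) m) ->
  tperiodic f /\ tholder (@tenorm R d) beta f.
Proof.
move=> b0 m0 Hf; split.
  by move=> x w lw; apply/rowP => j; exact: (thol_periodic b0 ltr01 (Hf j)).
by have [a [b [_ [_ hb]]]] := hnorm_vec_of_thol m0 Hf; exists b.
Qed.

Lemma thol_tholder (R : realType) (d : nat) (beta : R) (f : 'rV[R]_d -> R) m :
  0 < beta -> thol beta 1 f m -> tperiodic f /\ tholder Num.norm beta f.
Proof.
move=> b0 Hf; split; first exact: (thol_periodic b0 ltr01 Hf).
by have [a [b [_ [_ hb]]]] := hnorm_of_thol Hf; exists b.
Qed.

Theorem theorem2p2 (R : realType) (d : nat)
  (A0 : 'rV[R]_d -> 'rV[R]_d) (F : 'rV[R]_d -> 'rV[R]_d)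
  (H : R -> 'rV[R]_d -> 'rV[R]_d) (h : nat -> 'rV[R]_d -> 'rV[R]_d)
  (v : 'I_d -> 'rV[R]_d -> 'rV[R]_d) (Lam : 'I_d -> 'rV[R]_d -> R)
  (beta0 : R) (N0 : nat) :
  (* standing setup *)
  tanosov A0 ->
  tperiodic F -> ranalytic F ->
  (exists eps0 : R, 0 < eps0 /\
     forall eps : R, `|eps| < eps0 ->
       torus_homeo (H eps) /\
       (forall x, tcong (H eps (A0 x)) (A0 (H eps x) + eps *: F (H eps x))) /\
       (forall x (i : 'I_d),
          series (fun n => eps ^+ n.+1 * h n.+1 x 0 i) @ \oo -->
            (H eps x - x) 0 i)) ->
  (forall n, tperiodic (h n)) ->
  (exists beta1 : R, 0 < beta1 /\
     forall beta, 0 < beta < beta1 ->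
       exists Cb : R, forall n, (0 < n)%N -> hnorm_le (@tenorm R d) beta (h n) (Cb ^+ n)) ->
  (* one-dimensional splitting hypotheses *)
  0 < beta0 ->
  (forall i, tperiodic (v i) /\ tholder (@tenorm R d) beta0 (v i) /\
             forall x, tenorm (v i x) = 1) ->
  (forall x, row_free (tframe v x) && row_full (tframe v x)) ->
  (forall i, tperiodic (Lam i) /\ tholder Num.norm beta0 (Lam i) /\
             forall x, Lam i x != 0) ->
  (forall i x, 'D_(v i x) A0 x = Lam i x *: v i (A0 x)) ->
  (forall n, (N0 <= n)%N -> forall i j : 'I_d, (j = i.+1 :> nat) ->
     tsupnorm (fun x => \prod_(k < n) Lam i (iter k A0 x)) *
     tsupnorm (fun x => (\prod_(k < n) Lam j (iter k A0 x))^-1) < 1) ->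
  (* conclusion *)
  exists (betabar : R) (epsbar : R -> R), 0 < betabar /\
    (forall beta, 0 < beta < betabar -> 0 < epsbar beta) /\
    forall beta, 0 < beta < betabar ->
      exists (V : R -> 'I_d -> 'rV[R]_d -> 'rV[R]_d) (L : R -> 'I_d -> 'rV[R]_d -> R)
             (cV : nat -> 'I_d -> 'rV[R]_d -> 'rV[R]_d) (cL : nat -> 'I_d -> 'rV[R]_d -> R)
             (MV ML : nat -> R),
        (* analyticity in eps, as power series converging in the beta-Hoelder norm *)
        (forall n i, tperiodic (cV n i) /\ tperiodic (cL n i) /\
                     hnorm_le (@tenorm R d) beta (cV n i) (MV n) /\
                     hnorm_le Num.norm beta (cL n i) (ML n)) /\
        (forall eps : R, `|eps| < epsbar beta ->
           cvgn (series (fun n => `|eps| ^+ n * MV n)) /\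
           cvgn (series (fun n => `|eps| ^+ n * ML n)) /\
           forall i x,
             (forall j, series (fun n => eps ^+ n * cV n i x 0 j) @ \oo --> V eps i x 0 j) /\
             series (fun n => eps ^+ n * cL n i x) @ \oo --> L eps i x) /\
        forall eps : R, `|eps| < epsbar beta ->
          (forall i, tperiodic (V eps i) /\ tperiodic (L eps i) /\
                     tholder (@tenorm R d) beta (V eps i) /\ tholder Num.norm beta (L eps i)) /\
          (forall x, row_free (tframe (V eps) x)) /\
          (forall i x, 'D_(V eps i x) (fun y => A0 y + eps *: F y) (H eps x) =
                       L eps i x *: V eps i (A0 x)) /\
          (eps = 0 -> forall i x, V eps i x = v i x /\ L eps i x = Lam i x).
Proof.
move=> anosov pF aF [eps0 [eps00 HH]] hper [beta1 [beta10 hC]] beta00 Hv frame HL DvA gap0.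
have [[lA [aA [A' [lA' [aA' [A'A AA']]]]]] _] := anosov.
have [KA KA1 LipA] := lift_lipschitz aA lA.
have [KA' KA'1 LipA'] := lift_lipschitz aA' lA'.
pose K := Num.max KA KA'.
have K1 : 1 <= K by rewrite le_max KA1.
have LA x y : tdist (A0 x) (A0 y) <= K * tdist x y.
  by apply: le_trans (LipA x y) _; rewrite ler_wpM2r ?tdist_ge0 // le_max lexx.
have LA' x y : tdist (A' x) (A' y) <= K * tdist x y.
  by apply: le_trans (LipA' x y) _; rewrite ler_wpM2r ?tdist_ge0 // le_max lexx orbT.
have Lhol i beta : 0 < beta -> beta <= beta0 -> exists m, thol beta 1 (Lam i) m.
  by move=> b0 bb; have [pL [hL _]] := HL i; exact: thol_of_tholder b0 bb pL hL.
have vhol i j beta : 0 < beta -> beta <= beta0 -> exists m, thol beta 1 (fun x => v i x 0 j) m.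
  move=> b0 bb; have [pv [[b hb] _]] := Hv i; apply: (thol_of_tholder b0 bb).
    by move=> x w lw; rewrite pv.
  exists b => x y xy; apply: le_trans (hb x y xy).
  by apply: le_trans (coord_le_tenorm _ j); rewrite !mxE.
have Lper i : tperiodic (Lam i) by case: (HL i).
have Lne0 i x : Lam i x != 0 by case: (HL i) => _ [].
(* [N0.+1] instead of [N0], because the blocks of the Neumann series must have positive length. *)
have gapN (i j : 'I_d) : (j = i.+1 :> nat) ->
  tsupnorm (fun x => \prod_(k < N0.+1) Lam i (iter k A0 x)) *
  tsupnorm (fun x => (\prod_(k < N0.+1) Lam j (iter k A0 x))^-1) < 1.
  by apply: gap0; exact: leqnSn.
have [bs bs0 Hbs] : exists2 b, 0 < b & forall ij : 'I_d * 'I_d, ij.1 != ij.2 ->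
    forall beta, 0 < beta -> beta < b -> beta <= beta0 ->
    exists Kc S, solves A0 Lam beta ij.1 ij.2 Kc S.
  apply: (fin_uniform (P := fun (ij : 'I_d * 'I_d) b => ij.1 != ij.2 ->
    forall beta, 0 < beta -> beta < b -> beta <= beta0 ->
    exists Kc S, solves A0 Lam beta ij.1 ij.2 Kc S)).
    move=> [i j] /=; have [->|ij] := eqVneq i j; first by exists 1.
    have [b b0 Hb] := pair_solver lA (ltn0Sn N0) beta00 K1 A'A AA' LA LA' Lper Lhol Lne0 gapN ij.
    by exists b.
  move=> ij r r' r0 rr' Hr nij beta b0 br'; apply: Hr => //; exact: lt_le_trans rr'.
pose bb := Num.min (Num.min bs beta0) (Num.min beta1 1).
have bb0 : 0 < bb by rewrite !lt_min bs0 beta00 beta10 ltr01.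
exists bb.
(* The condition on [beta] is placed under the existential: for [beta] outside the interval any [e]
   will do, so choice gives a total function [epsbar]. *)
suff main beta : exists e, 0 < beta < bb -> 0 < e /\
  exists (V : R -> 'I_d -> 'rV[R]_d -> 'rV[R]_d) (L : R -> 'I_d -> 'rV[R]_d -> R)
             (cV : nat -> 'I_d -> 'rV[R]_d -> 'rV[R]_d) (cL : nat -> 'I_d -> 'rV[R]_d -> R)
             (MV ML : nat -> R),
        (forall n i, tperiodic (cV n i) /\ tperiodic (cL n i) /\
                     hnorm_le (@tenorm R d) beta (cV n i) (MV n) /\
                     hnorm_le Num.norm beta (cL n i) (ML n)) /\
        (forall eps : R, `|eps| < e ->
           cvgn (series (fun n => `|eps| ^+ n * MV n)) /\
           cvgn (series (fun n => `|eps| ^+ n * ML n)) /\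
           forall i x,
             (forall j, series (fun n => eps ^+ n * cV n i x 0 j) @ \oo --> V eps i x 0 j) /\
             series (fun n => eps ^+ n * cL n i x) @ \oo --> L eps i x) /\
        forall eps : R, `|eps| < e ->
          (forall i, tperiodic (V eps i) /\ tperiodic (L eps i) /\
                     tholder (@tenorm R d) beta (V eps i) /\ tholder Num.norm beta (L eps i)) /\
          (forall x, row_free (tframe (V eps) x)) /\
          (forall i x, 'D_(V eps i x) (fun y => A0 y + eps *: F y) (H eps x) =
                       L eps i x *: V eps i (A0 x)) /\
          (eps = 0 -> forall i x, V eps i x = v i x /\ L eps i x = Lam i x).
  have [epsbar Hbar] := choice main.
  exists epsbar; split => //; split => beta bbeta; by case: (Hbar beta bbeta).
have [bok|nbok] := boolP (0 < beta < bb); last by exists 1.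
have [b0 b1 bbs bb0' bb1] : [/\ 0 < beta, beta < 1, beta < bs, beta <= beta0 & beta < beta1].
  move/andP: bok => [b0]; rewrite !lt_min => /andP[/andP[h1 h2] /andP[h3 h4]].
  by split => //; exact: ltW.
have [Cb HCb] := hC beta (introT andP (conj b0 bb1)).
have Hser (eps : R) : `|eps| < eps0 -> forall x (i : 'I_d),
  series (fun n => eps ^+ n.+1 * h n.+1 x 0 i) @ \oo --> (H eps x - x) 0 i.
  by move=> /HH [_ []].
have [T [B [T0 _ B0 HPS]]] := displacement_PS b0 eps00 hper Hser HCb.
have H0 := H0E eps00 Hser.
have vunit x : tframe v x \in unitmx by rewrite -row_free_unit; case/andP: (frame x).
have [t [U [L [t0 _ NU NL HU]]]] := invariant_frame b0 b1 K1 T0 B0 HPS H0 lA aA pF aF LA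
  (fun i => Lhol i _ b0 bb0') (fun i j => vhol i j _ b0 bb0') vunit DvA
  (fun i j (nij : i != j) => Hbs (i, j) nij _ b0 bbs bb0').
exists t => _; split => //.
have N1 := thol_nlike d beta (ltr01 : 0 < 1 :> R).
have Nt := PS_nlike N1 t0.
pose W (p : R * 'rV[R]_d) := U p *m tframe v p.2.
have NW (ij : 'I_d * 'I_d) : nfin (PS (fun=> True) (thol beta 1) t) (fun p => W p ij.1 ij.2).
  apply: (nfin_mulmx Nt) => // i j.
  have -> : (fun p : R * 'rV[R]_d => tframe v p.2 i j) = (fun p => v i p.2 0 j).
    by apply: funext => p; rewrite mxE.
  by have [m Hm] := vhol i j _ b0 bb0'; exists m; exact: (PS_lift N1 t Hm).
have [cW [MW [HcW MW0 cvW serW]]] := PS_coefficients t0 NW.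
have [cL [ML [HcL ML0 cvL serL]]] := PS_coefficients t0 NL.
pose V eps i x := row i (W (eps, x)).
exists V, (fun eps i x => L i (eps, x)), (fun n i x => \row_j cW n (i, j) x), (fun n i => cL n i),
  (* One factor 2 because sup norm and seminorm are each bounded by the norm, and [d] for passing
     from coordinates to the Euclidean norm. *)
  (fun n => (2 * d%:R) * MW n), (fun n => 2 * ML n).
have HcV n i j : thol beta 1 (fun x => (\row_j cW n (i, j) x) 0 j) (MW n).
  have := HcW n (i, j); congr thol; by apply: funext => x; rewrite mxE.
split; [|split].
- move=> n i; split; first by case: (thol_tholder_vec b0 (MW0 n) (HcV n i)).
  split; first by case: (thol_tholder b0 (HcL n i)).
  split.
    have -> : 2 * d%:R * MW n = d%:R * MW n + d%:R * MW n by ring.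
    exact: hnorm_vec_of_thol.
  have -> : 2 * ML n = ML n + ML n by ring.
  exact: hnorm_of_thol.
- move=> eps et; have et' := ltW et; split; first exact: cvW.
  split; first exact: cvL.
  move=> i x; split; last exact: serL.
  move=> j; have -> : V eps i x 0 j = W (eps, x) i j by rewrite /V mxE.
  have -> : (fun n => eps ^+ n * (\row_j cW n (i, j) x) 0 j) = (fun n => eps ^+ n * cW n (i, j) x).
    by apply: funext => n; rewrite mxE.
  exact: serW (i, j) _ _ et'.
- move=> eps et; have et' := ltW et.
  have [mW mW0 HW] := nfin_uniform Nt NW.
  have HVe i j : thol beta 1 (fun x => V eps i x 0 j) mW.
    have := PS_at t0 (HW (i, j)) et'; congr thol; by apply: funext => x; rewrite !mxE.
  have VE x : tframe (V eps) x = W (eps, x) by apply/matrixP => i j; rewrite !mxE.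
  split; [|split; [|split]].
  + move=> i; have [pV hV] := thol_tholder_vec b0 mW0 (HVe i).
    have [m Hm] := NL i; have [pL hL] := thol_tholder b0 (PS_at t0 Hm et').
    by split.
  + move=> x; rewrite VE row_free_unit unitmx_mul vunit andbT.
    by case: (HU eps x et').
  + by move=> i x; case: (HU eps x et') => _ HD _; exact: HD.
  + move=> e0 i x; have [_ _ /(_ e0) [U1 L1]] := HU eps x et'.
    split; last exact: L1.
    by rewrite /V /W U1 mul1mx; apply/rowP => j; rewrite !mxE.
Qed.
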